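(* Let $A$ be a unital C*-algebra such that $K_0(A)\cong\mathbb{Z}$ via $[1]\mapsto 1$ and $K_1(A)\cong\mathbb{Z}$ via $[\mathsf{u}]\mapsto 1$ for some unitary matrix $\mathsf{u}\in U_N(A)$. Let $B\cong\Sigma A$ be the non-reduced suspension of $A$, presented as the pullback of two cones of $A$ over $A$, and let $\partial_{10}\colon K_1(A)\to K_0(B)$ and $\delta_{01}\colon K^0(B)\to K^1(A)$ be the connecting homomorphisms of the Mayer-Vietoris six-term exact sequences in K-theory and K-homology, respectively. Then for every $\mathbf{z}\in K^1(A)$ there exists $\mathbf{w}\in K^0(B)$ with $\delta_{01}(\mathbf{w})=\mathbf{z}$, and for any such $\mathbf{w}$, $$\langle\partial_{10}([\mathsf{u}^n]),\mathbf{w}\rangle=\langle[\mathsf{u}^n],\mathbf{z}\rangle=n\,\langle[\mathsf{u}],\mathbf{z}\rangle\qquad\text{for all }n\in\mathbb{Z}.$$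
   Context: $\langle\cdot,\cdot\rangle$ denotes the index pairing between K-theory and K-homology ($K_j(\cdot)\times K^j(\cdot)\to\mathbb{Z}$). Cones: $B_1:=\{f\in C([0,\tfrac12],A)\mid f(0)\in\mathbb{C}\}$, $B_2:=\{f\in C([\tfrac12,1],A)\mid f(1)\in\mathbb{C}\}$ (with $\mathbb{C}=\mathbb{C}1\subseteq A$), and $\pi_i\colon B_i\to A$, $f\mapsto f(\tfrac12)$. The pullback $B=\{(b_1,b_2)\in B_1\times B_2\mid\pi_1(b_1)=\pi_2(b_2)\}$ is identified with $\Sigma A:=\{f\in C([0,1],A)\mid f(0),f(1)\in\mathbb{C}\}$ via $f\mapsto(f|_{[0,1/2]},f|_{[1/2,1]})$. Write $\mathrm{pr}_i\colon B\to B_i$ for the projections. Connecting homomorphisms: $\partial_{10}$ is the one in the Mayer-Vietoris six-term exact sequence $\cdots\to K_1(B_1)\oplus K_1(B_2)\xrightarrow{{\pi_2}_*-{\pi_1}_*}K_1(A)\xrightarrow{\partial_{10}}K_0(B)\xrightarrow{({\mathrm{pr}_1}_*,{\mathrm{pr}_2}_* )}K_0(B_1)\oplus K_0(B_2)\to\cdots$, given explicitly as follows. For $a\in GL_M(A)$ choose $c,d\in M_M(B_2)$ that are entrywise lifts through $\pi_2$ of $a$ and $a^{-1}$; then $\partial_{10}([a])=[p]-[I_M]$, where $$p=\begin{bmatrix}(1,c(2-dc)d)&(0,c(2-dc)(1-dc))\\(0,(1-dc)d)&(0,(1-dc)^2)\end{bmatrix}\in M_{2M}(B)$$ (each block is an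 $M\times M$ matrix of pairs in $B_1\times B_2$; $1$ means $I_M$). $\delta_{01}$ is the one in the K-homology Mayer-Vietoris six-term exact sequence $\cdots\to K^0(B_1)\oplus K^0(B_2)\xrightarrow{\mathrm{pr}_1^*+\mathrm{pr}_2^*}K^0(B)\xrightarrow{\delta_{01}}K^1(A)\xrightarrow{(-\pi_1^*,\pi_2^* )}K^1(B_1)\oplus K^1(B_2)\to\cdots$. Connecting homomorphisms are determined up to sign, and the sign of $\delta_{01}$ is chosen so that the (known) compatibility $\langle\partial_{10}(\mathbf{x}),\mathbf{w}\rangle=\langle\mathbf{x},\delta_{01}(\mathbf{w})\rangle$ holds for all $\mathbf{x}\in K_1(A)$, $\mathbf{w}\in K^0(B)$. *)

(* Defs.v *)
From HB Require Import structures.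
From mathcomp Require Import all_boot all_order all_algebra.
From mathcomp Require Import all_classical all_reals all_analysis.
From mathcomp Require Import complex.
From Stdlib Require Import Relation_Operators.
Set Implicit Arguments. Unset Strict Implicit. Unset Printing Implicit Defensive.
Import Order.TTheory GRing.Theory Num.Theory.
Import numFieldNormedType.Exports.
Local Open Scope classical_set_scope.
Local Open Scope ring_scope.
Local Open Scope complex_scope.

HB.mixin Record isStarAlgebra (R : realType) A of GRing.Algebra R[i] A := {
  star : A -> A;
  starK : involutive star;
  starD : {morph star : x y / x + y};
  starZ : forall (c : R[i]) (x : A), star (c *: x) = c^* *: star x;
  starM : forall x y : A, star (x * y) = star y * star x
}.
#[short(type="starAlgType")]
HB.structure Definition StarAlgebra (R : realType) :=
  {A of GRing.Algebra R[i] A & isStarAlgebra R A}.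

(* The norm is bundled here and not taken from [normedModType R[i]]: ring and
   normed module structures have no common join besides [numDomainType].
   [cnorm 0 = 0] and [0 <= cnorm x] are consequences. *)
HB.mixin Record isCStar (R : realType) A of StarAlgebra R A := {
  cnorm : A -> R;
  cnormD : forall x y : A, cnorm (x + y) <= cnorm x + cnorm y;
  cnormZ : forall (c : R[i]) (x : A), (cnorm (c *: x))%:C = `|c| * (cnorm x)%:C;
  cnorm_eq0 : forall x : A, cnorm x = 0 -> x = 0;
  cnormM : forall x y : A, cnorm (x * y) <= cnorm x * cnorm y;
  cnorm_star : forall x : A, cnorm (star x * x) = cnorm x ^+ 2;
  cnorm_complete : forall a : nat -> A,
    (forall e : R, 0 < e -> exists N : nat, forall m n : nat,
       (N <= m)%N -> (N <= n)%N -> cnorm (a m - a n) <= e) ->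
    exists l : A, forall e : R, 0 < e -> exists N : nat, forall n : nat,
      (N <= n)%N -> cnorm (a n - l) <= e
}.
#[short(type="cstarAlgType")]
HB.structure Definition CStarAlgebra (R : realType) :=
  {A of StarAlgebra R A & isCStar R A}.

Section StarTheory.
Variables (R : realType) (A : starAlgType R).

Lemma star0 : star (0 : A) = 0.
Proof. by apply: (addrI (star 0)); rewrite -starD !addr0. Qed.

Lemma starN (x : A) : star (- x) = - star x.
Proof. by apply/eqP; rewrite -addr_eq0 -starD addNr star0. Qed.

Lemma star1 : star (1 : A) = 1.
Proof.
by rewrite -[LHS]mulr1 -[X in _ * X](starK (1 : A)) -starM mulr1 starK.
Qed.

End StarTheory.

Record starHom (R : realType) (A B : starAlgType R) := StarHom {
  shom :> A -> B;
  shomD : forall x y : A, shom (x + y) = shom x + shom y;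
  shomZ : forall (c : R[i]) (x : A), shom (c *: x) = c *: shom x;
  shomM : forall x y : A, shom (x * y) = shom x * shom y;
  shom1 : shom 1 = 1;
  shomS : forall x : A, shom (star x) = star (shom x)
}.

Section FunAlg.
Variables (R : realType) (T : pointedType).

Lemma fct_scalerAl (A : algType R[i]) (c : R[i]) (f g : T -> A) :
  c *: (f * g) = (c *: f) * g.
Proof. by apply/funext => x; exact: scalerAl. Qed.
HB.instance Definition _ (A : algType R[i]) :=
  GRing.Lmodule_isLalgebra.Build R[i] (T -> A) (@fct_scalerAl A).
Lemma fct_scalerAr (A : algType R[i]) (c : R[i]) (f g : T -> A) :
  c *: (f * g) = f * (c *: g).
Proof. by apply/funext => x; exact: scalerAr. Qed.
HB.instance Definition _ (A : algType R[i]) :=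
  GRing.Lalgebra_isAlgebra.Build R[i] (T -> A) (@fct_scalerAr A).

Variable A : starAlgType R.
Definition fct_star (f : T -> A) : T -> A := fun x => star (f x).
Lemma fct_starK : involutive fct_star.
Proof. by move=> f; apply/funext => x; rewrite /fct_star starK. Qed.
Lemma fct_starD : {morph fct_star : f g / f + g}.
Proof. by move=> f g; apply/funext => x; exact: starD. Qed.
Lemma fct_starZ (c : R[i]) f : fct_star (c *: f) = c^* *: fct_star f.
Proof. by apply/funext => x; exact: starZ. Qed.
Lemma fct_starM f g : fct_star (f * g) = fct_star g * fct_star f.
Proof. by apply/funext => x; exact: starM. Qed.
HB.instance Definition _ := isStarAlgebra.Build R (T -> A)
  fct_starK fct_starD fct_starZ fct_starM.
End FunAlg.

Section ProdAlg.
Variables (R : realType) (A1 A2 : starAlgType R).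
Definition pair_star (x : A1 * A2) : A1 * A2 := (star x.1, star x.2).
Lemma pair_starK : involutive pair_star.
Proof. by case=> a b; rewrite /pair_star /= !starK. Qed.
Lemma pair_starD : {morph pair_star : f g / f + g}.
Proof. by case=> a b [c d]; rewrite /pair_star /= !starD. Qed.
Lemma pair_starZ (c : R[i]) f : pair_star (c *: f) = c^* *: pair_star f.
Proof. by case: f => a b; rewrite /pair_star /= !starZ. Qed.
Lemma pair_starM f g : pair_star (f * g) = pair_star g * pair_star f.
Proof. by case: f g => a b [c d]; rewrite /pair_star /= !starM. Qed.
HB.instance Definition _ := isStarAlgebra.Build R (A1 * A2)%type
  pair_starK pair_starD pair_starZ pair_starM.
End ProdAlg.

Record starSub (R : realType) (V : starAlgType R) := StarSub {
  ssub :> {pred V};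
  ssub_alg : GRing.subsemialg_closed ssub;
  ssub_star : forall x : V, x \in ssub -> star x \in ssub
}.

Record subStar (R : realType) (V : starAlgType R) (S : starSub V) := SubStar {
  ssval :> V;
  ssvalP : ssval \in (S : {pred V})
}.

Section SubStarAlg.
Variables (R : realType) (V : starAlgType R) (S : starSub V).
HB.instance Definition _ := [isSub of subStar S for @ssval R V S].
HB.instance Definition _ := [Choice of subStar S by <:].
HB.instance Definition _ :=
  GRing.SubChoice_isSubAlgebra.Build R[i] V (ssub S) (subStar S) (ssub_alg S).
Definition sub_star (x : subStar S) : subStar S :=
  SubStar (ssub_star (ssvalP x)).
Lemma sub_starK : involutive sub_star.
Proof. by move=> x; apply/val_inj; rewrite /= starK. Qed.
Lemma sub_starD : {morph sub_star : f g / f + g}.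
Proof. by move=> x y; apply/val_inj; rewrite /= starD. Qed.
Lemma sub_starZ (c : R[i]) f : sub_star (c *: f) = c^* *: sub_star f.
Proof. by apply/val_inj; rewrite /= starZ. Qed.
Lemma sub_starM f g : sub_star (f * g) = sub_star g * sub_star f.
Proof. by apply/val_inj; rewrite /= starM. Qed.
HB.instance Definition _ := isStarAlgebra.Build R (subStar S)
  sub_starK sub_starD sub_starZ sub_starM.
End SubStarAlg.

Section CNormTheory.
Variables (R : realType) (A : cstarAlgType R).
Implicit Types x y : A.

Lemma cnorm0 : cnorm (0 : A) = 0.
Proof.
have /eqP := @cnormZ R A 0 0; rewrite scale0r normr0 mul0r.
by rewrite eq_complex /= eqxx andbT => /eqP.
Qed.

Lemma cnorm_scale (r : R) x : cnorm (r%:C *: x) = `|r| * cnorm x.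
Proof.
have /eqP := @cnormZ R A r%:C x.
by rewrite normc_def /= expr0n /= addr0 sqrtr_sqr -rmorphM => /eqP /complexI.
Qed.

Lemma cnormN x : cnorm (- x) = cnorm x.
Proof.
have := cnorm_scale (-1) x.
by rewrite rmorphN1 scaleN1r normrN1 mul1r.
Qed.

Lemma cnorm_ge0 x : 0 <= cnorm x.
Proof.
have := cnormD x (- x); rewrite subrr cnorm0 cnormN -mulr2n.
by rewrite pmulrn_lge0.
Qed.

Lemma cnorm_star_le x : cnorm x <= cnorm (star x).
Proof.
have [->|n0] := eqVneq (cnorm x) 0; first exact: cnorm_ge0.
have p : 0 < cnorm x by rewrite lt_def n0 cnorm_ge0.
by rewrite -(ler_pM2r p) -expr2 -cnorm_star cnormM.
Qed.

Lemma cnormS x : cnorm (star x) = cnorm x.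
Proof.
by apply/le_anti; rewrite cnorm_star_le -{2}(starK x) cnorm_star_le.
Qed.

End CNormTheory.

Definition ccontinuous (R : realType) (A : cstarAlgType R)
    (T : topologicalType) (f : T -> A) : Prop :=
  forall x : T, forall e : R, 0 < e ->
    \forall y \near x, cnorm (f y - f x) < e.

Section Cone.
Variables (R : realType) (A : cstarAlgType R) (T : ptopologicalType) (e : T).
Implicit Types f g : T -> A.

Lemma ccontinuous_cst (a : A) : ccontinuous (fun _ : T => a).
Proof.
by move=> x d d0; apply: nearW => y; rewrite subrr cnorm0.
Qed.

Lemma ccontinuousD f g :
  ccontinuous f -> ccontinuous g -> ccontinuous (fun x => f x + g x).
Proof.
move=> cf cg x d d0; have d2 : 0 < d / 2 by rewrite divr_gt0.
near=> y; rewrite opprD addrACA (le_lt_trans (cnormD _ _))//.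
rewrite [d]splitr ltrD//; near: y; [exact: cf | exact: cg].
Unshelve. all: end_near. Qed.

Lemma ccontinuousM f g :
  ccontinuous f -> ccontinuous g -> ccontinuous (fun x => f x * g x).
Proof.
move=> cf cg x d d0.
pose K := cnorm (f x) + cnorm (g x) + 1.
have K0 : 0 < K by rewrite ltr_wpDl// addr_ge0 ?cnorm_ge0.
have dK : 0 < d / K / 2 by rewrite !divr_gt0.
have -> : d = d / K / 2 * K + K * (d / K / 2).
  by rewrite [K * _]mulrC -mulrDl -splitr divfK// gt_eqF.
near=> y.
have -> : f y * g y - f x * g x = (f y - f x) * g x + f y * (g y - g x).
  by rewrite mulrBl mulrBr [RHS]addrC subrKA.
have fy : cnorm (f y - f x) < d / K / 2 by near: y; exact: cf.
have gy : cnorm (g y - g x) < d / K / 2 by near: y; exact: cg.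
have f1 : cnorm (f y - f x) < 1 by near: y; exact: cf.
have gK : cnorm (g x) <= K by rewrite /K -addrA addrCA lerDl addr_ge0 ?cnorm_ge0.
have fK : cnorm (f y) <= K.
  rewrite -[f y](subrK (f x)) (le_trans (cnormD _ _))// /K addrC.
  by rewrite -addrA lerD2l (le_trans (ltW f1))// lerDr cnorm_ge0.
rewrite (le_lt_trans (cnormD _ _))// ltr_leD//.
  rewrite (le_lt_trans (cnormM _ _))//.
  rewrite (le_lt_trans (ler_wpM2l (cnorm_ge0 _) gK))//.
  by rewrite ltr_pM2r.
rewrite (le_trans (cnormM _ _))//.
by apply: ler_pM => //; rewrite ?cnorm_ge0// ltW.
Unshelve. all: end_near. Qed.

Lemma ccontinuousS f : ccontinuous f -> ccontinuous (fun x => star (f x)).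
Proof.
move=> cf x d d0; near=> y.
by rewrite -starN -starD cnormS; near: y; exact: cf.
Unshelve. all: end_near. Qed.

Definition coneSet : set (T -> A) :=
  [set f | ccontinuous f /\ exists c : R[i], f e = c *: 1].

Lemma coneSet_alg : GRing.subsemialg_closed (mem coneSet : {pred T -> A}).
Proof.
have coneM f g : coneSet f -> coneSet g -> coneSet (f * g).
  move=> [cf [a fa]] [cg [b gb]]; split; first exact: ccontinuousM.
  exists (a * b); rewrite -[LHS]/(f e * g e) fa gb.
  by rewrite -scalerAl mul1r scalerA.
have cone_cst (c : R[i]) : coneSet (fun _ : T => c *: (1 : A)).
  by split; [exact: ccontinuous_cst | exists c].
split.
- rewrite inE.
  by have := cone_cst 1; rewrite scale1r.
- split; first by rewrite inE; have := cone_cst 0; rewrite scale0r.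
  move=> f g; rewrite !inE => -[cf [a fa]] [cg [b gb]].
  split; first exact: ccontinuousD.
  by exists (a + b); rewrite -[LHS]/(f e + g e) fa gb scalerDl.
- move=> c f; rewrite !inE => hf.
  have -> : c *: f = (fun _ : T => c *: (1 : A)) * f.
    apply/funext => x; rewrite -[LHS]/(c *: f x) -[RHS]/((c *: 1) * f x).
    by rewrite -scalerAl mul1r.
  exact: coneM.
- by move=> f g; rewrite !inE; exact: coneM.
Qed.

Lemma coneSet_star f : f \in mem coneSet -> star f \in mem coneSet.
Proof.
rewrite !inE => -[cf [a fa]]; split; first exact: ccontinuousS.
by exists (a^*); rewrite -[LHS]/(star (f e)) fa starZ star1.
Qed.

Definition coneSub : starSub (T -> A : starAlgType R) :=
  StarSub coneSet_alg coneSet_star.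
Definition cone : starAlgType R := subStar coneSub.

Section Eval.
Variable x : T.
Let ev (f : cone) : A := (ssval f : T -> A) x.
Definition coneEval : starHom cone A :=
  @StarHom R cone A ev (fun _ _ => erefl) (fun _ _ => erefl)
    (fun _ _ => erefl) erefl (fun _ => erefl).
End Eval.
End Cone.

Section Pullback.
Variables (R : realType) (B1 B2 A : starAlgType R).
Variables (f1 : starHom B1 A) (f2 : starHom B2 A).

Lemma shom0 (B C : starAlgType R) (f : starHom B C) : f 0 = 0.
Proof. by apply: (addrI (f 0)); rewrite -shomD !addr0. Qed.

Definition pullbackSet : set (B1 * B2) := [set b | f1 b.1 = f2 b.2].

Lemma pullbackSet_alg :
  GRing.subsemialg_closed (mem pullbackSet : {pred B1 * B2}).
Proof.
split.
- by rewrite inE /pullbackSet /= !shom1.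
- split; first by rewrite inE /pullbackSet /= !shom0.
  by move=> x y; rewrite !inE /pullbackSet /= !shomD => -> ->.
- by move=> c x; rewrite !inE /pullbackSet /= !shomZ => ->.
- by move=> x y; rewrite !inE /pullbackSet /= !shomM => -> ->.
Qed.

Lemma pullbackSet_star b : b \in mem pullbackSet -> star b \in mem pullbackSet.
Proof. by rewrite !inE /pullbackSet /= !shomS => ->. Qed.

Definition pullbackSub : starSub (B1 * B2 : starAlgType R)%type :=
  StarSub pullbackSet_alg pullbackSet_star.
Definition pullback : starAlgType R := subStar pullbackSub.

Definition pullback_pr1 : starHom pullback B1 :=
  @StarHom R pullback B1 (fun b => (ssval b).1) (fun _ _ => erefl)
    (fun _ _ => erefl) (fun _ _ => erefl) erefl (fun _ => erefl).
Definition pullback_pr2 : starHom pullback B2 :=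
  @StarHom R pullback B2 (fun b => (ssval b).2) (fun _ _ => erefl)
    (fun _ _ => erefl) (fun _ _ => erefl) erefl (fun _ => erefl).
End Pullback.

Section Segments.
Variable R : realType.

Definition seg (a b : R) := set_type (`[a, b] : set R).
HB.instance Definition _ a b := Topological.copy (seg a b) (set_type (`[a, b] : set R)).

Definition segpt (a b x : R) (h : a <= x <= b) : seg a b :=
  exist _ x (@mem_set R (`[a, b] : set R) x h).

Lemma seg_le0 : (0 : R) <= (0 : R) <= (2^-1 : R). Proof. by rewrite lexx invr_ge0 ler0n. Qed.
Lemma seg_leL : (0 : R) <= (2^-1 : R) <= (2^-1 : R). Proof. by rewrite lexx invr_ge0 ler0n. Qed.
Lemma seg_leR : (2^-1 : R) <= (2^-1 : R) <= (1 : R).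
Proof. by rewrite lexx invf_le1 ?ler1n. Qed.
Lemma seg_le1 : (2^-1 : R) <= (1 : R) <= (1 : R).
Proof. by rewrite lexx invf_le1 ?ler1n. Qed.

(* [piL], [piR] are the two cones' evaluations at 1/2; [susp] is their pullback,
   identified with {f in C([0, 1], A) | f(0), f(1) in C1} *)
Definition segL := seg 0 2^-1.
Definition segR := seg 2^-1 1.
HB.instance Definition _ := Topological.copy segL (seg 0 2^-1).
HB.instance Definition _ := Topological.copy segR (seg 2^-1 1).
HB.instance Definition _ := isPointed.Build segL (segpt seg_leL).
HB.instance Definition _ := isPointed.Build segR (segpt seg_leR).

Variable A : cstarAlgType R.
Definition coneL : starAlgType R := cone A (segpt seg_le0 : segL).
Definition coneR : starAlgType R := cone A (segpt seg_le1 : segR).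
Definition piL : starHom coneL A := coneEval A (segpt seg_le0 : segL) (segpt seg_leL).
Definition piR : starHom coneR A := coneEval A (segpt seg_le1 : segR) (segpt seg_leR).
Definition susp : starAlgType R := pullback piL piR.
Definition prL : starHom susp coneL := pullback_pr1 piL piR.
Definition prR : starHom susp coneR := pullback_pr2 piL piR.
End Segments.

(* The quotient of a type by the equivalence relation generated by [r].  Below,
   operations on classes are computed on the representatives [qrepr], which is
   harmless as they respect the relations. *)
Section Quot.
Variables (T : Type) (r : T -> T -> Prop).

Record quot := Quot {
  qset : T -> Prop;
  qsetP : exists x : T, qset = clos_refl_sym_trans T r x
}.

Definition cls (x : T) : quot := Quot (ex_intro _ x erefl).
Definition qrepr (q : quot) : T := sval (cid (qsetP q)).

Lemma qreprK q : cls (qrepr q) = q.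
Proof.
rewrite /qrepr; case: (cid _) => x /=; case: q => s hs /= e; subst s.
by rewrite /cls (Prop_irrelevance (ex_intro _ x erefl) hs).
Qed.

Lemma cls_eq x y : cls x = cls y <-> clos_refl_sym_trans T r x y.
Proof.
split=> [[e]|h]; first by rewrite e; exact: rst_refl.
have e : clos_refl_sym_trans T r x = clos_refl_sym_trans T r y.
  apply/funext => z; apply/propext; split => hz.
    by apply: rst_trans hz; exact: rst_sym.
  exact: rst_trans hz.
rewrite /cls; move: (ex_intro _ x _) (ex_intro _ y _); rewrite e => p q.
by rewrite (Prop_irrelevance p q).
Qed.

Lemma cls_qrepr x : clos_refl_sym_trans T r x (qrepr (cls x)).
Proof. by apply/cls_eq; rewrite qreprK. Qed.
End Quot.

Section K0.
Variable B : pzRingType.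

(* K_0 is built from idempotents, not necessarily self-adjoint, since the
   Mayer-Vietoris boundary produces such; for a unital C*-algebra this is the
   usual K_0 *)
Record idem := Idem {
  idem_size : nat;
  idem_mx :> 'M[B]_idem_size;
  idemP : idem_mx *m idem_mx = idem_mx
}.

Definition idem1 (n : nat) : idem := Idem (mul1mx (1%:M : 'M[B]_n)).

Lemma idem_sum_subproof (p q : idem) :
  block_mx p 0 0 q *m block_mx p 0 0 q = block_mx p 0 0 q.
Proof. by rewrite mulmx_block !mul0mx !mulmx0 !addr0 !add0r !idemP. Qed.
Definition idem_sum (p q : idem) : idem := Idem (idem_sum_subproof p q).

(* algebraic Murray-von Neumann equivalence *)
Definition idem_equiv (p q : idem) : Prop :=
  exists (x : 'M[B]_(idem_size p, idem_size q))
         (y : 'M[B]_(idem_size q, idem_size p)),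
    x *m y = p /\ y *m x = q.

(* (p, q) stands for [p] - [q] *)
Definition K0rel (x y : idem * idem) : Prop :=
  exists r : idem, idem_equiv (idem_sum (idem_sum x.1 y.2) r)
                              (idem_sum (idem_sum y.1 x.2) r).

Definition K0 : Type := quot K0rel.
Definition K0diff (p q : idem) : K0 := cls K0rel (p, q).
Definition K0cls (p : idem) : K0 := K0diff p (idem1 0).
Definition K0add (x y : K0) : K0 :=
  K0diff (idem_sum (qrepr x).1 (qrepr y).1) (idem_sum (qrepr x).2 (qrepr y).2).
End K0.
Arguments idem1 {B} n.

Section GL.
Variable B : pzRingType.

Record gl := GL {
  gl_size : nat;
  gl_mx :> 'M[B]_gl_size;
  gl_inv : 'M[B]_gl_size;
  gl_mulV : gl_mx *m gl_inv = 1%:M;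
  gl_mulVl : gl_inv *m gl_mx = 1%:M
}.

Lemma gl_sum_mulV (g h : gl) :
  block_mx g 0 0 h *m block_mx (gl_inv g) 0 0 (gl_inv h) = 1%:M.
Proof.
by rewrite mulmx_block !mul0mx !mulmx0 !addr0 !add0r !gl_mulV -scalar_mx_block.
Qed.
Lemma gl_sum_mulVl (g h : gl) :
  block_mx (gl_inv g) 0 0 (gl_inv h) *m block_mx g 0 0 h = 1%:M.
Proof.
by rewrite mulmx_block !mul0mx !mulmx0 !addr0 !add0r !gl_mulVl -scalar_mx_block.
Qed.
Definition gl_sum (g h : gl) : gl := GL (gl_sum_mulV g h) (gl_sum_mulVl g h).

Lemma mx_exp_inv n (a b : 'M[B]_n) k :
  a *m b = 1%:M -> b *m a = 1%:M -> (a ^+ k) *m (b ^+ k) = 1%:M.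
Proof.
move=> ab ba; have c : GRing.comm a b by rewrite /GRing.comm -!mulmxE ab ba.
by rewrite mulmxE -exprMn_comm// -mulmxE ab expr1n.
Qed.

Definition gl_pow_nat (g : gl) (k : nat) : gl :=
  GL (mx_exp_inv k (gl_mulV g) (gl_mulVl g))
     (mx_exp_inv k (gl_mulVl g) (gl_mulV g)).
Definition gl_inverse (g : gl) : gl := GL (gl_mulVl g) (gl_mulV g).
Definition gl_pow (g : gl) (n : int) : gl :=
  match n with
  | Posz k => gl_pow_nat g k
  | Negz k => gl_pow_nat (gl_inverse g) k.+1
  end.

(* g (+) 1_{k - gl_size g}, meaningful when gl_size g <= k *)
Definition gl_stab (k : nat) (g : gl) : 'M[B]_k :=
  \matrix_(i < k, j < k)
    match insub (val i), insub (val j) with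
    | Some i', Some j' => g i' j'
    | _, _ => (i == j)%:R
    end.
End GL.

Section K1.
Variables (R : realType) (A : cstarAlgType R).

Lemma seg01_le0 : (0 : R) <= (0 : R) <= (1 : R). Proof. by rewrite lexx ler01. Qed.
Lemma seg01_le1 : (0 : R) <= (1 : R) <= (1 : R). Proof. by rewrite lexx ler01. Qed.
Definition seg01 := seg (0 : R) 1.
HB.instance Definition _ := Topological.copy seg01 (seg (0 : R) 1).
Definition seg0 : seg01 := segpt seg01_le0.
Definition seg1 : seg01 := segpt seg01_le1.

(* g (+) 1 and h (+) 1 are joined by a path in some GL_k(A), so that the quotient
   is GL_oo(A) / GL_oo(A)_0; entrywise continuity is norm continuity *)
Definition K1rel (g h : gl A) : Prop :=
  exists k : nat, [/\ (gl_size g <= k)%N, (gl_size h <= k)%N &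
    exists gamma : seg01 -> 'M[A]_k,
      [/\ forall i j, ccontinuous (fun t => gamma t i j),
          forall t, exists v, gamma t *m v = 1%:M /\ v *m gamma t = 1%:M,
          gamma seg0 = gl_stab k g & gamma seg1 = gl_stab k h]].

Definition K1 : Type := quot K1rel.
Definition K1cls (g : gl A) : K1 := cls K1rel g.
Definition K1add (x y : K1) : K1 := K1cls (gl_sum (qrepr x) (qrepr y)).

Definition mxstar (n : nat) (u : 'M[A]_n) : 'M[A]_n := map_mx star u^T.
Definition mx_unitary (n : nat) (u : 'M[A]_n) : Prop :=
  u *m mxstar u = 1%:M /\ mxstar u *m u = 1%:M.
Definition unitary_gl (n : nat) (u : 'M[A]_n) (hu : mx_unitary u) : gl A :=
  GL (proj1 hu) (proj2 hu).
End K1.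

Section ShomMorph.
Variables (R : realType) (B C : starAlgType R) (f : starHom B C).
Lemma shomB : {morph (shom f) : x y / x - y}.
Proof.
move=> x y; rewrite shomD; congr (_ + _).
by rewrite -scaleN1r shomZ scaleN1r.
Qed.
HB.instance Definition _ := GRing.isZmodMorphism.Build B C (shom f) shomB.
HB.instance Definition _ :=
  GRing.isMonoidMorphism.Build B C (shom f) (shom1 f, shomM f).
End ShomMorph.

Section Boundary.
Variables (R : realType) (B1 B2 A : starAlgType R).
Variables (f1 : starHom B1 A) (f2 : starHom B2 A).
Local Notation B := (pullback f1 f2).

Section Cycle.
Variables (a : gl A) (c d : 'M[B2]_(gl_size a)).
Hypothesis hc : map_mx f2 c = gl_mx a.
Hypothesis hd : map_mx f2 d = gl_inv a.
Local Notation M := (gl_size a).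

Definition bd_fst : 'M[B1]_(M + M) := block_mx 1 0 0 0.
Definition bd_snd : 'M[B2]_(M + M) :=
  block_mx (c * (2 - d * c) * d) (c * (2 - d * c) * (1 - d * c))
           ((1 - d * c) * d)     ((1 - d * c) ^+ 2).

Lemma bd_compat i j : (bd_fst i j, bd_snd i j) \in pullbackSub f1 f2.
Proof.
suff e : map_mx f1 bd_fst = map_mx f2 bd_snd.
  have := congr1 (fun m : matrix A (M + M) (M + M) => m i j) e.
  by rewrite !mxE inE.
have dc : map_mx f2 (d * c) = 1 by rewrite -mulmxE map_mxM hc hd gl_mulVl.
have m1 : map_mx f2 (1 : 'M[B2]_M) = 1 by exact: map_mx1.
have e0 : map_mx f2 (1 - d * c) = 0 by rewrite map_mxB dc m1 subrr.
have e1 : map_mx f2 (2 - d * c) = 1.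
  by rewrite -[2]/(1 + 1) map_mxB map_mxD dc m1 addrK.
rewrite /bd_fst /bd_snd !map_block_mx expr2 -!mulmxE !map_mxM e0 e1.
rewrite hc hd !mulmx0 !mul0mx mulmx1 gl_mulV !map_mx0.
by rewrite map_mx1.
Qed.

Definition bd_mx : 'M[B]_(M + M) :=
  \matrix_(i, j) (SubStar (bd_compat i j) : B).

Lemma bd_mx_fst : map_mx (pullback_pr1 f1 f2) bd_mx = bd_fst.
Proof. by apply/matrixP => i j; rewrite !mxE. Qed.
Lemma bd_mx_snd : map_mx (pullback_pr2 f1 f2) bd_mx = bd_snd.
Proof. by apply/matrixP => i j; rewrite !mxE. Qed.

Lemma bd_fst_idem : bd_fst *m bd_fst = bd_fst.
Proof.
by rewrite /bd_fst mulmx_block !mulmx0 !mul0mx !addr0 mulmxE mulr1.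
Qed.

Lemma bd_snd_idem : bd_snd *m bd_snd = bd_snd.
Proof.
pose e := 1 - d * c.
have e2 : 2 - d * c = 1 + e by rewrite /e addrA.
have -> : bd_snd = col_mx (c * (1 + e)) e *m row_mx d e.
  by rewrite mul_col_row /bd_snd e2 expr2 -!mulmxE.
have E : row_mx d e *m col_mx (c * (1 + e)) e = 1%:M.
  have dc : d * c = 1 - e by rewrite /e opprB addrC subrK.
  rewrite mul_row_col !mulmxE mulrA dc mulrDr mulr1 mulrBl mul1r.
  by rewrite subrKA subrK.
by rewrite mulmxA -(mulmxA (col_mx _ _)) E mulmx1.
Qed.

Lemma bd_idem : bd_mx *m bd_mx = bd_mx.
Proof.
apply/matrixP => i j; apply: val_inj.
have h1 : map_mx (pullback_pr1 f1 f2) (bd_mx *m bd_mx) =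
    map_mx (pullback_pr1 f1 f2) bd_mx.
  by rewrite map_mxM bd_mx_fst bd_fst_idem.
have h2 : map_mx (pullback_pr2 f1 f2) (bd_mx *m bd_mx) =
    map_mx (pullback_pr2 f1 f2) bd_mx.
  by rewrite map_mxM bd_mx_snd bd_snd_idem.
have k1 := congr1 (fun m : matrix B1 (M + M) (M + M) => m i j) h1.
have k2 := congr1 (fun m : matrix B2 (M + M) (M + M) => m i j) h2.
by rewrite [LHS]surjective_pairing [RHS]surjective_pairing; congr pair;
  [move: k1 | move: k2]; rewrite [LHS]mxE [RHS]mxE.
Qed.
End Cycle.

(* [p] - [1_M], where p is given in M_2M(B1) x M_2M(B2) by [bd_fst] and [bd_snd] *)
Definition bd_cycle (a : gl A) (c d : 'M[B2]_(gl_size a))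
    (hc : map_mx f2 c = gl_mx a) (hd : map_mx f2 d = gl_inv a) : K0 B :=
  K0diff (Idem (bd_idem hc hd)) (idem1 (gl_size a)).
End Boundary.

Section Suspension.
Variables (R : realType) (A : cstarAlgType R).

Lemma piR_surj (a : A) : exists b : coneR A, piR A b = a.
Proof.
pose f (t : segR R) : A := ((1 - val t) * 2)%:C *: a.
have cf : coneSet (segpt (@seg_le1 R) : segR R) f.
  split; last by exists 0; rewrite /f /= subrr mul0r !scale0r.
  move=> x e e0.
  have K0 : 0 < (2 * cnorm a + 1) by rewrite ltr_wpDl// mulr_ge0// cnorm_ge0.
  have cv : {for x, continuous (fun t : segR R => val t : R)}.
    exact: initial_continuous.
  have eK : 0 < e / (2 * cnorm a + 1) by rewrite divr_gt0.
  have := cv; move/cvgrPdist_lt => /(_ _ eK); apply: filterS => y hy.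
  rewrite /f -scalerBl -rmorphB cnorm_scale -mulrBl normrM opprB addrC addrA.
  rewrite subrK [`|2|]gtr0_norm// -mulrA.
  move: hy; rewrite ltr_pdivlMr//; apply: le_lt_trans.
  by rewrite ler_wpM2l// lerDl.
have cf' : f \in coneSub A (segpt (@seg_le1 R) : segR R) by rewrite inE.
exists (SubStar cf'); rewrite /piR /coneEval /= /f /=.
have -> : (1 - 2^-1) * 2 = 1 :> R by rewrite mulrBl mul1r mulVf// -[2]/(1+1) addrK.
by rewrite scale1r.
Qed.

Lemma piR_lift m n (a : 'M[A]_(m, n)) :
  exists c : 'M[coneR A]_(m, n), map_mx (piR A) c = a.
Proof.
exists (\matrix_(i, j) sval (cid (piR_surj (a i j)))).
by apply/matrixP => i j; rewrite !mxE; case: cid.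
Qed.

Definition bd10 (x : K1 A) : K0 (susp A) :=
  let a := qrepr x in
  bd_cycle (piL A) (proj2_sig (cid (piR_lift a)))
    (proj2_sig (cid (piR_lift (gl_inv a)))).
End Suspension.

(* For X a point these are the Hilbert spaces.  The remaining C(X)-module
   axioms for [hm_act] follow from [hm_act_ip] because the inner product is
   nondegenerate; the values of [hm_act] at discontinuous functions are
   irrelevant.  The norm is ||x|| = sup_t <x, x>(t)^(1/2), and [norm_le x c]
   says ||x|| <= c. *)
Record hilbMod (R : realType) (X : topologicalType) := HilbMod {
  hm_sort :> lmodType R[i];
  hm_act : (X -> R[i]) -> hm_sort -> hm_sort;
  hm_ip : hm_sort -> hm_sort -> X -> R[i];
  hm_cont : forall x y, continuous (hm_ip x y : X -> R[i]^o);
  hm_ipD : forall x y z t, hm_ip x (y + z) t = hm_ip x y t + hm_ip x z t;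
  hm_ipZ : forall x (c : R[i]) y t, hm_ip x (c *: y) t = c * hm_ip x y t;
  hm_ipC : forall x y t, hm_ip y x t = (hm_ip x y t)^*;
  hm_act_ip : forall x (f : X -> R[i]) y t, continuous (f : X -> R[i]^o) ->
    hm_ip x (hm_act f y) t = f t * hm_ip x y t;
  hm_ip_ge0 : forall x t, 0 <= hm_ip x x t;
  hm_ip_eq0 : forall x, (forall t, hm_ip x x t = 0) -> x = 0;
  hm_complete :
    let norm_le (x : hm_sort) (c : R) :=
      forall t, hm_ip x x t <= (c ^+ 2)%:C in
    forall a : nat -> hm_sort,
    (forall e : R, 0 < e -> exists N : nat, forall m n : nat,
       (N <= m)%N -> (N <= n)%N -> norm_le (a m - a n) e) ->
    exists l : hm_sort, forall e : R, 0 < e -> exists N : nat, forall n : nat,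
      (N <= n)%N -> norm_le (a n - l) e
}.

Section HilbOps.
Variables (R : realType) (X : topologicalType).
Implicit Types E F : hilbMod R X.

Definition norm_le E (x : E) (c : R) : Prop :=
  forall t, hm_ip x x t <= (c ^+ 2)%:C.

(* <T x, y> = <x, S y>; both maps are then C(X)-linear and bounded *)
Definition adjoint E F (T : E -> F) (S : F -> E) : Prop :=
  forall x y t, hm_ip (T x) y t = hm_ip x (S y) t.

(* z |-> x <y, z> *)
Definition rank1 E F (x : F) (y : E) (z : E) : F := hm_act (hm_ip y z) x.

(* the norm closure of the span of the operators [rank1 x y] *)
Definition compactOp E F (T : E -> F) : Prop :=
  forall e : R, 0 < e -> exists s : seq (F * E),
    forall (z : E) (c : R), 0 <= c -> norm_le z c ->
      norm_le (T z - \sum_(p <- s) rank1 p.1 p.2 z) (e * c).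
End HilbOps.

Section HilbTheory.
Variables (R : realType) (X : topologicalType).
Implicit Types E F : hilbMod R X.

Lemma hm_ipDl E (x y z : E) t : hm_ip (x + y) z t = hm_ip x z t + hm_ip y z t.
Proof. by rewrite hm_ipC hm_ipD rmorphD /= -!hm_ipC. Qed.

Lemma hm_ipZl E (c : R[i]) (x z : E) t : hm_ip (c *: x) z t = c^* * hm_ip x z t.
Proof. by rewrite hm_ipC hm_ipZ rmorphM /= -!hm_ipC. Qed.

Lemma hm_ipNl E (x z : E) t : hm_ip (- x) z t = - hm_ip x z t.
Proof. by rewrite -scaleN1r hm_ipZl rmorphN1 mulN1r. Qed.

Lemma hm_ipN E (x z : E) t : hm_ip x (- z) t = - hm_ip x z t.
Proof. by rewrite -scaleN1r hm_ipZ mulN1r. Qed.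

Lemma hm_ip0 E (x : E) t : hm_ip x 0 t = 0.
Proof. by rewrite -(scale0r 0) hm_ipZ mul0r. Qed.

Lemma hm_ip_inj E (x y : E) : (forall z t, hm_ip z x t = hm_ip z y t) -> x = y.
Proof.
move=> h; apply/eqP; rewrite -subr_eq0; apply/eqP/hm_ip_eq0 => t.
by rewrite hm_ipD hm_ipN h subrr.
Qed.

Lemma adjoint_sym E F (T : E -> F) S : adjoint T S -> adjoint S T.
Proof. by move=> h x y t; rewrite hm_ipC -h -hm_ipC. Qed.

Lemma adjointD E F (T : E -> F) S x y :
  adjoint T S -> T (x + y) = T x + T y.
Proof.
move/adjoint_sym => h; apply: hm_ip_inj => z t.
by rewrite hm_ipD -!h hm_ipD.
Qed.

Lemma adjointN E F (T : E -> F) S x : adjoint T S -> T (- x) = - T x.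
Proof.
move/adjoint_sym => h; apply: hm_ip_inj => z t.
by rewrite hm_ipN -!h hm_ipN.
Qed.

Lemma norm_leN E (x : E) c : norm_le x c -> norm_le (- x) c.
Proof. by move=> h t; rewrite hm_ipNl hm_ipN opprK; exact: h. Qed.

Lemma rank1N E F (x : F) (y z : E) : rank1 (- x) y z = - rank1 x y z.
Proof.
apply: hm_ip_inj => w t.
by rewrite hm_ipN /rank1 !hm_act_ip ?hm_ipN ?mulrN//; exact: hm_cont.
Qed.

Lemma compactOpN E F (T : E -> F) : compactOp T -> compactOp (fun x => - T x).
Proof.
move=> h e e0; have [s hs] := h e e0.
exists [seq (- p.1, p.2) | p <- s] => z c c0 zc.
rewrite big_map (eq_bigr (fun p => - rank1 p.1 p.2 z)); last first.
  by move=> p _; rewrite rank1N.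
by rewrite sumrN -opprD; apply: norm_leN; exact: hs.
Qed.
End HilbTheory.

Section HilbSum.
Variables (R : realType) (X : topologicalType) (E F : hilbMod R X).
Local Notation EF := (E * F)%type.
Definition hsum_act (f : X -> R[i]) (x : EF) : EF := (hm_act f x.1, hm_act f x.2).
Definition hsum_ip (x y : EF) (t : X) : R[i] :=
  hm_ip x.1 y.1 t + hm_ip x.2 y.2 t.

Lemma hsum_cont x y : continuous (hsum_ip x y : X -> R[i]^o).
Proof. by move=> t; apply: cvgD; exact: hm_cont. Qed.
Lemma hsum_ipD x y z t : hsum_ip x (y + z) t = hsum_ip x y t + hsum_ip x z t.
Proof. by rewrite /hsum_ip !hm_ipD addrACA. Qed.
Lemma hsum_ipZ x (c : R[i]) y t : hsum_ip x (c *: y) t = c * hsum_ip x y t.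
Proof. by rewrite /hsum_ip !hm_ipZ mulrDr. Qed.
Lemma hsum_ipC x y t : hsum_ip y x t = (hsum_ip x y t)^*.
Proof. by rewrite /hsum_ip rmorphD /= -!hm_ipC. Qed.
Lemma hsum_act_ip x (f : X -> R[i]) y t : continuous (f : X -> R[i]^o) ->
  hsum_ip x (hsum_act f y) t = f t * hsum_ip x y t.
Proof. by move=> cf; rewrite /hsum_ip /= !hm_act_ip// mulrDr. Qed.
Lemma hsum_ip_ge0 x t : 0 <= hsum_ip x x t.
Proof. by rewrite addr_ge0 ?hm_ip_ge0. Qed.
Lemma hsum_ip_eq0 x : (forall t, hsum_ip x x t = 0) -> x = 0.
Proof.
move=> h; have k t : hm_ip x.1 x.1 t = 0 /\ hm_ip x.2 x.2 t = 0.
  move/eqP: (h t); rewrite paddr_eq0 ?hm_ip_ge0//.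
  by move=> /andP[/eqP -> /eqP ->].
rewrite [x]surjective_pairing (_ : 0 = (0, 0))//.
by congr pair; apply: hm_ip_eq0 => t; case: (k t).
Qed.

Definition hsum_norm_le (x : EF) (c : R) : Prop :=
  forall t, hsum_ip x x t <= (c ^+ 2)%:C.

Lemma hsum_norm_le1 x c : hsum_norm_le x c -> norm_le x.1 c.
Proof. by move=> h t; apply: le_trans (h t); rewrite lerDl hm_ip_ge0. Qed.
Lemma hsum_norm_le2 x c : hsum_norm_le x c -> norm_le x.2 c.
Proof. by move=> h t; apply: le_trans (h t); rewrite lerDr hm_ip_ge0. Qed.
Lemma hsum_norm_leP x c :
  norm_le x.1 (c / 2) -> norm_le x.2 (c / 2) -> hsum_norm_le x c.
Proof.
move=> h1 h2 t; rewrite /hsum_ip (le_trans (lerD (h1 t) (h2 t)))//.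
rewrite -rmorphD lecR [X in _ <= X ^+ 2](splitr c) sqrrD lerD2r lerDl.
by rewrite mulrn_wge0// -expr2 sqr_ge0.
Qed.

Lemma hsum_complete (a : nat -> EF) :
  (forall e : R, 0 < e -> exists N : nat, forall m n : nat,
     (N <= m)%N -> (N <= n)%N -> hsum_norm_le (a m - a n) e) ->
  exists l : EF, forall e : R, 0 < e -> exists N : nat, forall n : nat,
    (N <= n)%N -> hsum_norm_le (a n - l) e.
Proof.
move=> h.
have [l1 hl1] := @hm_complete R X E (fun n => (a n).1) (fun e e0 =>
  let: ex_intro N hN := h e e0 in
  ex_intro _ N (fun m n hm hn => hsum_norm_le1 (hN m n hm hn))).
have [l2 hl2] := @hm_complete R X F (fun n => (a n).2) (fun e e0 =>
  let: ex_intro N hN := h e e0 in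
  ex_intro _ N (fun m n hm hn => hsum_norm_le2 (hN m n hm hn))).
exists (l1, l2) => e e0; have e2 : 0 < e / 2 by rewrite divr_gt0.
have [N1 h1] := hl1 _ e2; have [N2 h2] := hl2 _ e2.
exists (maxn N1 N2) => n; rewrite geq_max => /andP[n1 n2].
by apply: hsum_norm_leP; [exact: h1 | exact: h2].
Qed.

Definition hsum : hilbMod R X := @HilbMod R X (E * F)%type hsum_act hsum_ip
  hsum_cont hsum_ipD hsum_ipZ hsum_ipC hsum_act_ip hsum_ip_ge0 hsum_ip_eq0
  hsum_complete.
End HilbSum.

Definition map_pair (S T S' T' : Type) (f : S -> S') (g : T -> T')
  (x : S * T) : S' * T' := (f x.1, g x.2).

Section HilbSumOps.
Variables (R : realType) (X : topologicalType) (E F : hilbMod R X).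

Lemma hsum_adjoint (T S : E -> E) (T' S' : F -> F) : adjoint T S ->
  adjoint T' S' ->
  adjoint (map_pair T T' : hsum E F -> hsum E F) (map_pair S S').
Proof. by move=> h h' x y t; rewrite /= /hsum_ip /= h h'. Qed.

Lemma norm_le0 (G : hilbMod R X) (c : R) : norm_le (0 : G) c.
Proof. by move=> t; rewrite hm_ip0 ler0c sqr_ge0. Qed.

Lemma hsum_rank1 (s : seq (E * E)) (s' : seq (F * F)) (z : hsum E F) :
  \sum_(p <- [seq ((p.1, 0), (p.2, 0)) | p <- s] ++
             [seq ((0, p.1), (0, p.2)) | p <- s'])
     rank1 (p.1 : hsum E F) (p.2 : hsum E F) z =
  (\sum_(p <- s) rank1 p.1 p.2 z.1, \sum_(p <- s') rank1 p.1 p.2 z.2)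
  :> hsum E F.
Proof.
have r0 (G : hilbMod R X) (f : X -> R[i]) : continuous (f : X -> R[i]^o) ->
    hm_act f (0 : G) = 0.
  by move=> cf; apply: hm_ip_inj => w t; rewrite hm_act_ip// !hm_ip0 mulr0.
have l0 (G : hilbMod R X) (w : G) t : hm_ip 0 w t = 0.
  by rewrite hm_ipC hm_ip0 rmorph0.
have ipl (y : E) (w : hsum E F) : hm_ip ((y, 0) : hsum E F) w = hm_ip y w.1.
  by apply/funext => t; rewrite /= /hsum_ip /= l0 addr0.
have ipr (y : F) (w : hsum E F) : hm_ip ((0, y) : hsum E F) w = hm_ip y w.2.
  by apply/funext => t; rewrite /= /hsum_ip /= l0 add0r.
rewrite big_cat !big_map /=.
rewrite (eq_bigr (fun p => (rank1 p.1 p.2 z.1, 0) : hsum E F)); last first.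
  move=> p _; set w : hsum E F := (p.2, 0).
  rewrite -[LHS]/(hm_act (hm_ip w z) p.1, hm_act (hm_ip w z) 0).
  rewrite ipl r0//; exact: hm_cont.
rewrite [X in _ + X](eq_bigr (fun p => (0, rank1 p.1 p.2 z.2) : hsum E F));
  last first.
  move=> p _; set w : hsum E F := (0, p.2).
  rewrite -[LHS]/(hm_act (hm_ip w z) 0, hm_act (hm_ip w z) p.1).
  rewrite ipr r0//; exact: hm_cont.
have e1 : \sum_(p <- s) ((rank1 p.1 p.2 z.1, 0) : hsum E F) =
    (\sum_(p <- s) rank1 p.1 p.2 z.1, 0).
  by elim: s => [|p s IH]; rewrite ?big_nil// !big_cons IH; congr pair; rewrite addr0.
have e2 : \sum_(p <- s') ((0, rank1 p.1 p.2 z.2) : hsum E F) =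
    (0, \sum_(p <- s') rank1 p.1 p.2 z.2).
  by elim: s' => [|p s' IH]; rewrite ?big_nil// !big_cons IH; congr pair; rewrite addr0.
by rewrite e1 e2; congr pair; rewrite ?addr0 ?add0r.
Qed.

Lemma hsum_compact (T : E -> E) (T' : F -> F) : compactOp T -> compactOp T' ->
  compactOp (map_pair T T' : hsum E F -> hsum E F).
Proof.
move=> h h' e e0; have e2 : 0 < e / 2 by rewrite divr_gt0.
have [s hs] := h _ e2; have [s' hs'] := h' _ e2.
exists ([seq ((p.1, 0), (p.2, 0)) | p <- s] ++
        [seq ((0, p.1), (0, p.2)) | p <- s']) => z c c0 zc.
rewrite hsum_rank1; apply: hsum_norm_leP; rewrite mulrAC.
  by apply: hs => //; exact: hsum_norm_le1 zc.
by apply: hs' => //; exact: hsum_norm_le2 zc.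
Qed.
End HilbSumOps.

(* The representation need not be unital.  A star algebra is enough here: on a
   C*-algebra, representations by adjointable operators are automatically
   contractive. *)
Record kasMod (R : realType) (A : starAlgType R) (X : topologicalType) := KasMod {
  kas_hilb :> hilbMod R X;
  kas_rep : A -> kas_hilb -> kas_hilb;
  kas_op : kas_hilb -> kas_hilb;
  kas_adj : kas_hilb -> kas_hilb;
  kas_repL : forall (c : R[i]) (a b : A) x,
    kas_rep (c *: a + b) x = c *: kas_rep a x + kas_rep b x;
  kas_repM : forall (a b : A) x, kas_rep (a * b) x = kas_rep a (kas_rep b x);
  kas_repS : forall a : A, adjoint (kas_rep a) (kas_rep (star a));
  kas_opS : adjoint kas_op kas_adj;
  kas_sq : forall a : A,
    compactOp (fun x => kas_rep a (kas_op (kas_op x) - x));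
  kas_comm : forall a : A,
    compactOp (fun x => kas_op (kas_rep a x) - kas_rep a (kas_op x));
  kas_sa : forall a : A,
    compactOp (fun x => kas_rep a (kas_op x - kas_adj x))
}.

(* Z/2-graded modules: the grading operator commutes with the representation
   and anticommutes with the operator *)
Record gkasMod (R : realType) (A : starAlgType R) (X : topologicalType) := GKasMod {
  gkas_mod :> kasMod A X;
  gkas_gr : gkas_mod -> gkas_mod;
  gkas_grS : adjoint gkas_gr gkas_gr;
  gkas_grK : involutive gkas_gr;
  gkas_gr_rep : forall (a : A) x,
    gkas_gr (kas_rep a x) = kas_rep a (gkas_gr x);
  gkas_gr_op : forall x, gkas_gr (kas_op x) = - kas_op (gkas_gr x)
}.

Section KasConstructions.
Variables (R : realType) (X : topologicalType).

Section Pull.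
Variables (A B : starAlgType R) (f : starHom A B).

Section Odd.
Variable M : kasMod B X.
Definition pull_rep (a : A) : M -> M := kas_rep (f a).
Lemma pull_repL (c : R[i]) (a b : A) x :
  pull_rep (c *: a + b) x = c *: pull_rep a x + pull_rep b x.
Proof. by rewrite /pull_rep shomD shomZ kas_repL. Qed.
Lemma pull_repM (a b : A) x : pull_rep (a * b) x = pull_rep a (pull_rep b x).
Proof. by rewrite /pull_rep shomM kas_repM. Qed.
Lemma pull_repS (a : A) : adjoint (pull_rep a) (pull_rep (star a)).
Proof. by rewrite /pull_rep shomS; exact: kas_repS. Qed.
Definition kas_pull : kasMod A X :=
  KasMod pull_repL pull_repM pull_repS (@kas_opS _ _ _ M)
    (fun a => kas_sq M (f a)) (fun a => kas_comm M (f a))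
    (fun a => kas_sa M (f a)).
End Odd.

Definition gkas_pull (M : gkasMod B X) : gkasMod A X :=
  @GKasMod R A X (kas_pull M) (@gkas_gr _ _ _ M) (@gkas_grS _ _ _ M)
    (@gkas_grK _ _ _ M) (fun a => gkas_gr_rep (f a)) (@gkas_gr_op _ _ _ M).
End Pull.

Section Sum.
Variables (A : starAlgType R).

Section Odd.
Variables M N : kasMod A X.
Definition ksum_rep (a : A) : hsum M N -> hsum M N :=
  map_pair (kas_rep a) (kas_rep a).
Definition ksum_op : hsum M N -> hsum M N :=
  map_pair (@kas_op _ _ _ M) (@kas_op _ _ _ N).
Definition ksum_adj : hsum M N -> hsum M N :=
  map_pair (@kas_adj _ _ _ M) (@kas_adj _ _ _ N).
Lemma ksum_repL (c : R[i]) (a b : A) x :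
  ksum_rep (c *: a + b) x = c *: ksum_rep a x + ksum_rep b x.
Proof. by rewrite /ksum_rep /map_pair !kas_repL. Qed.
Lemma ksum_repM (a b : A) x : ksum_rep (a * b) x = ksum_rep a (ksum_rep b x).
Proof. by rewrite /ksum_rep /map_pair !kas_repM. Qed.
Lemma ksum_repS (a : A) : adjoint (ksum_rep a) (ksum_rep (star a)).
Proof. by apply: hsum_adjoint; exact: kas_repS. Qed.
Lemma ksum_opS : adjoint ksum_op ksum_adj.
Proof. by apply: hsum_adjoint; exact: kas_opS. Qed.
Lemma ksum_sq (a : A) :
  compactOp (fun x => ksum_rep a (ksum_op (ksum_op x) - x)).
Proof. exact: (hsum_compact (kas_sq M a) (kas_sq N a)). Qed.
Lemma ksum_comm (a : A) :
  compactOp (fun x => ksum_op (ksum_rep a x) - ksum_rep a (ksum_op x)).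
Proof. exact: (hsum_compact (kas_comm M a) (kas_comm N a)). Qed.
Lemma ksum_sa (a : A) :
  compactOp (fun x => ksum_rep a (ksum_op x - ksum_adj x)).
Proof. exact: (hsum_compact (kas_sa M a) (kas_sa N a)). Qed.
Definition kas_sum : kasMod A X :=
  KasMod ksum_repL ksum_repM ksum_repS ksum_opS ksum_sq ksum_comm ksum_sa.
End Odd.

Section Even.
Variables M N : gkasMod A X.
Definition gksum_gr : kas_sum M N -> kas_sum M N :=
  map_pair (@gkas_gr _ _ _ M) (@gkas_gr _ _ _ N).
Lemma gksum_grS : adjoint gksum_gr gksum_gr.
Proof. by apply: hsum_adjoint; exact: gkas_grS. Qed.
Lemma gksum_grK : involutive gksum_gr.
Proof. by move=> [x y]; rewrite /gksum_gr /map_pair /= !gkas_grK. Qed.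
Lemma gksum_gr_rep (a : A) x : gksum_gr (kas_rep a x) = kas_rep a (gksum_gr x).
Proof.
by rewrite /gksum_gr /= /ksum_rep /map_pair /=; congr pair; exact: gkas_gr_rep.
Qed.
Lemma gksum_gr_op x : gksum_gr (kas_op x) = - kas_op (gksum_gr x).
Proof.
by rewrite /gksum_gr /= /ksum_op /map_pair /=; congr pair; exact: gkas_gr_op.
Qed.
Definition gkas_sum : gkasMod A X :=
  GKasMod gksum_grS gksum_grK gksum_gr_rep gksum_gr_op.
End Even.
End Sum.

Section Opp.
Variables (A : starAlgType R) (M : kasMod A X).
Definition kopp_op (x : M) : M := - kas_op x.
Definition kopp_adj (x : M) : M := - kas_adj x.
Lemma kopp_opS : adjoint kopp_op kopp_adj.
Proof.
move=> x y t; rewrite /kopp_op /kopp_adj hm_ipNl hm_ipN.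
by congr (- _); exact: kas_opS.
Qed.
Lemma kopp_sq (a : A) : compactOp (fun x => kas_rep a (kopp_op (kopp_op x) - x)).
Proof.
have -> : (fun x : M => kas_rep a (kopp_op (kopp_op x) - x)) =
          (fun x => kas_rep a (kas_op (kas_op x) - x)).
  by apply/funext => x; rewrite /kopp_op (adjointN _ (@kas_opS _ _ _ M)) opprK.
exact: kas_sq.
Qed.
Lemma kopp_comm (a : A) :
  compactOp (fun x => kopp_op (kas_rep a x) - kas_rep a (kopp_op x)).
Proof.
have -> : (fun x : M => kopp_op (kas_rep a x) - kas_rep a (kopp_op x)) =
          (fun x => - (kas_op (kas_rep a x) - kas_rep a (kas_op x))).
  apply/funext => x.
  by rewrite /kopp_op (adjointN _ (@kas_repS _ _ _ M a)) opprB opprK addrC.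
exact/compactOpN/kas_comm.
Qed.
Lemma kopp_sa (a : A) : compactOp (fun x => kas_rep a (kopp_op x - kopp_adj x)).
Proof.
have -> : (fun x : M => kas_rep a (kopp_op x - kopp_adj x)) =
          (fun x => - kas_rep a (kas_op x - kas_adj x)).
  apply/funext => x.
  by rewrite /kopp_op /kopp_adj -opprD (adjointN _ (@kas_repS _ _ _ M a)).
exact/compactOpN/kas_sa.
Qed.
Definition kas_opp : kasMod A X :=
  KasMod (@kas_repL _ _ _ M) (@kas_repM _ _ _ M) (@kas_repS _ _ _ M)
    kopp_opS kopp_sq kopp_comm kopp_sa.
End Opp.

Section Zero.
Variable A : starAlgType R.
Local Notation O := 'rV[R[i]]_0.
Lemma rV0_eq (x y : O) : x = y. Proof. by rewrite [x]thinmx0 [y]thinmx0. Qed.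
Definition hzero_ip (x y : O) (t : X) : R[i] := 0.
Lemma hzero_cont x y : continuous (hzero_ip x y : X -> R[i]^o).
Proof. by move=> t; exact: cvg_cst. Qed.
Lemma hzero_ipC x y t : hzero_ip y x t = (hzero_ip x y t)^*.
Proof. by rewrite /hzero_ip rmorph0. Qed.
Lemma hzero_complete (a : nat -> O) :
  (forall e : R, 0 < e -> exists N : nat, forall m n : nat,
     (N <= m)%N -> (N <= n)%N ->
     forall t, hzero_ip (a m - a n) (a m - a n) t <= (e ^+ 2)%:C) ->
  exists l : O, forall e : R, 0 < e -> exists N : nat, forall n : nat,
    (N <= n)%N -> forall t, hzero_ip (a n - l) (a n - l) t <= (e ^+ 2)%:C.
Proof.
by move=> _; exists 0 => e e0; exists 0%N => n _ t; rewrite ler0c sqr_ge0.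
Qed.
Definition hzero : hilbMod R X := @HilbMod R X O (fun _ x => x) hzero_ip
  hzero_cont (fun _ _ _ _ => esym (addr0 0)) (fun _ c _ _ => esym (mulr0 c))
  hzero_ipC (fun _ f _ t _ => esym (mulr0 (f t))) (fun _ _ => lexx 0)
  (fun x _ => rV0_eq x 0) hzero_complete.

Definition hzero_id (x : hzero) : hzero := x.
Lemma hzero_adjoint : adjoint hzero_id hzero_id.
Proof. by []. Qed.
Lemma hzero_compact (T : hzero -> hzero) : compactOp T.
Proof. by move=> e e0; exists [::] => z c c0 _ t; rewrite ler0c sqr_ge0. Qed.
Definition kas_zero : kasMod A X :=
  @KasMod R A X hzero (fun _ => hzero_id) hzero_id hzero_id
    (fun _ _ _ _ => rV0_eq _ _) (fun _ _ _ => erefl) (fun _ => hzero_adjoint)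
    hzero_adjoint (fun _ => hzero_compact _) (fun _ => hzero_compact _)
    (fun _ => hzero_compact _).
Definition gkas_zero : gkasMod A X :=
  @GKasMod R A X kas_zero hzero_id hzero_adjoint (fun _ => erefl)
    (fun _ _ => erefl) (fun _ => rV0_eq _ _).
End Zero.
End KasConstructions.

Definition pt : topologicalType := discrete_topology unit.

Section KHomology.
Variables (R : realType) (A : starAlgType R).

(* [q] induces a unitary equivalence from the fibre of [M] at [t], that is,
   the interior tensor product of [M] with C along evaluation at [t], to [N];
   this fibre is the quotient of [M] by {x | <x, x>(t) = 0} *)
Definition is_fibre (X : topologicalType) (M : kasMod A X) (t : X)
    (N : kasMod A pt) (q : M -> N) : Prop :=
  [/\ forall y, exists x, q x = y,
      forall x y, hm_ip (q x) (q y) tt = hm_ip x y t,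
      forall a x, q (kas_rep a x) = kas_rep a (q x) &
      forall x, q (kas_op x) = kas_op (q x)].

(* homotopy through Kasparov (A, C([0, 1]))-modules *)
Definition homotopic1 (M N : kasMod A pt) : Prop :=
  exists H : kasMod A (seg01 R),
    (exists q, is_fibre (seg0 R) (M := H) (N := M) q) /\
    (exists q, is_fibre (seg1 R) (M := H) (N := N) q).

Definition homotopic0 (M N : gkasMod A pt) : Prop :=
  exists H : gkasMod A (seg01 R),
    (exists q, is_fibre (seg0 R) (M := H) (N := M) q /\
       forall x, q (gkas_gr x) = gkas_gr (q x)) /\
    (exists q, is_fibre (seg1 R) (M := H) (N := N) q /\
       forall x, q (gkas_gr x) = gkas_gr (q x)).

(* KK^0(A, C) is given by graded and KK^1(A, C) by ungraded modules *)
Definition KH0 : Type := quot homotopic0.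
Definition KH1 : Type := quot homotopic1.
Definition KH0zero : KH0 := cls homotopic0 (gkas_zero pt A).
Definition KH1zero : KH1 := cls homotopic1 (kas_zero pt A).
Definition KH0add (x y : KH0) : KH0 :=
  cls homotopic0 (gkas_sum (qrepr x) (qrepr y)).
Definition KH1add (x y : KH1) : KH1 :=
  cls homotopic1 (kas_sum (qrepr x) (qrepr y)).
Definition KH1opp (x : KH1) : KH1 := cls homotopic1 (kas_opp (qrepr x)).
End KHomology.
Arguments KH0zero {R A}.
Arguments KH1zero {R A}.

Definition KH0pull (R : realType) (A B : starAlgType R) (f : starHom A B)
  (x : KH0 B) : KH0 A := cls (@homotopic0 R A) (gkas_pull f (qrepr x)).
Definition KH1pull (R : realType) (A B : starAlgType R) (f : starHom A B)
  (x : KH1 B) : KH1 A := cls (@homotopic1 R A) (kas_pull f (qrepr x)).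

Section Index.
Variables (K : fieldType) (V : lmodType K).

(* dim (W1 / W2) = n, for subspaces W2 of W1 *)
Definition qdim (W1 W2 : set V) (n : nat) : Prop :=
  exists e : 'I_n -> V, (forall i, W1 (e i)) /\
    forall x, W1 x ->
      exists! c : 'I_n -> K, W2 (x - \sum_(i < n) c i *: e i).

(* the Fredholm index of T : W1 -> W2 *)
Definition has_index (T : V -> V) (W1 W2 : set V) (k : int) : Prop :=
  exists m n : nat,
    [/\ qdim [set x | W1 x /\ T x = 0] [set 0] m,
        qdim W2 (T @` W1) n & k = m%:Z - n%:Z].

Definition findex (T : V -> V) (W1 W2 : set V) : int :=
  xget 0 [set k | has_index T W1 W2 k].
End Index.

Section Pairing.
Variables (R : realType) (A : starAlgType R).

(* operators on M^n *)
Definition amp_rep (M : kasMod A pt) n (a : 'M[A]_n) (x : {ffun 'I_n -> M}) :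
    {ffun 'I_n -> M} := [ffun i => \sum_(j < n) kas_rep (a i j) (x j)].
Definition amp (M : kasMod A pt) n (T : M -> M) (x : {ffun 'I_n -> M}) :
    {ffun 'I_n -> M} := [ffun i => T (x i)].

(* index of p F p : p M_+^n -> p M_-^n, where M = M_+ (+) M_- *)
Definition index0 (M : gkasMod A pt) (p : idem A) : int :=
  let n := idem_size p in
  findex (fun x : {ffun 'I_n -> M} => amp_rep p (amp (@kas_op _ _ _ M) x))
    [set x | amp_rep p x = x /\ amp (@gkas_gr _ _ _ M) x = x]
    [set x | amp_rep p x = x /\ amp (@gkas_gr _ _ _ M) x = - x].

(* index of P u P + 1 - P on the range of the representation of 1, where P is
   the compression of (1 + F) / 2 to this range *)
Definition index1 (M : kasMod A pt) (u : gl A) : int :=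
  let n := gl_size u in
  let W := [set x : {ffun 'I_n -> M} | amp_rep 1%:M x = x] in
  let P (x : {ffun 'I_n -> M}) :=
    amp_rep 1%:M (2^-1 *: (x + amp (@kas_op _ _ _ M) x)) in
  findex (fun x => P (amp_rep u (P x)) + (x - P x)) W W.

Definition pairing0 (x : K0 A) (w : KH0 A) : int :=
  index0 (qrepr w) (qrepr x).1 - index0 (qrepr w) (qrepr x).2.
End Pairing.

Definition pairing1 (R : realType) (A : cstarAlgType R) (x : K1 A) (z : KH1 A) :
  int := index1 (qrepr z) (qrepr x).

(* [delta] fits into the Mayer-Vietoris sequence
   K^0(B1) (+) K^0(B2) -> K^0(B) -> K^1(A) -> K^1(B1) (+) K^1(B2) *)
Definition is_boundary01 (R : realType) (A : cstarAlgType R)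
    (delta : KH0 (susp A) -> KH1 A) : Prop :=
  [/\ forall w1 w2, delta (KH0add w1 w2) = KH1add (delta w1) (delta w2),
      forall w, delta w = KH1zero <->
        exists w1 w2, w = KH0add (KH0pull (prL A) w1) (KH0pull (prR A) w2) &
      forall z, (exists w, delta w = z) <->
        KH1opp (KH1pull (piL A) z) = KH1zero /\ KH1pull (piR A) z = KH1zero].

(* fixes the sign of the K-homology boundary *)
Definition compatible10 (R : realType) (A : cstarAlgType R)
    (delta : KH0 (susp A) -> KH1 A) : Prop :=
  forall (x : K1 A) (w : KH0 (susp A)),
    pairing0 (bd10 x) w = pairing1 x (delta w).

(* the group (G, add) is isomorphic to Z via g |-> 1 *)
Definition iso_int (G : Type) (add : G -> G -> G) (g : G) : Prop :=
  exists h : G -> int,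
    [/\ bijective h, forall x y, h (add x y) = h x + h y & h g = 1].

(* Main.v *)
From HB Require Import structures.
From Stdlib Require Import Relation_Operators.
Require Import Defs.
From mathcomp Require Import all_boot all_order all_algebra.
From mathcomp Require Import all_classical all_reals all_analysis.
From mathcomp Require Import complex.
From mathcomp Require Import zify ring lra.

(** By exactness at K^1(A), a class z lies in the image of the boundary map once
    its pullbacks to the two cones vanish.  Sliding the evaluation point to the end of the
    cone is a homotopy from that pullback to a Kasparov module on which the cone
    acts through a character f |-> f(end).  Let P be the projection by which 1
    acts.  On the range of P the operator F is, modulo compacts, self-adjoint with
    square 1; filling its finite-dimensional kernel and dividing by its absolute
    value yields U = U^*, U^2 = 1 commuting with P and equal to F on the range of
    P up to a compact operator.  The segment from F to U is a homotopy to the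
    degenerate module defined by U, and paths ending at 0 contract the latter.

    The pairing of a class of K^1(A) with u is the Fredholm index of the Toeplitz
    compression of u.  Compression is multiplicative modulo compact operators, so
    the index is additive; it is also unchanged by stabilization and along paths
    of invertible matrices, so it depends only on the class of u in K_1(A) and
    the pairing with u^n is n times the pairing with u. *)

Set Implicit Arguments. Unset Strict Implicit. Unset Printing Implicit Defensive.
Import Order.TTheory GRing.Theory Num.Theory.
Import numFieldNormedType.Exports.
Local Open Scope classical_set_scope.
Local Open Scope ring_scope.

(** * Relative dimension *)

(** Boundedness is not part of the data of a Kasparov module, whose operators are only adjointable,
    and the Fredholm index is the algebraic one, a difference of dimensions of quotients. Bounds
    therefore come from uniform boundedness, and every square root is the fixed point of a
    contraction rather than a value of a functional calculus. Filling a kernel by a self-adjoint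
    finite-rank operator gives an injective operator whose square is 1 modulo compacts; index zero
    of that square makes it onto, so no index obstructs the passage from F to a symmetry. The
    representation need not be unital: the relations for F hold only next to a represented element,
    and estimates must first bring P next to the difference that is to be compact. A homotopy has to
    satisfy the Kasparov conditions over C([0,1]), where pointwise compactness does not suffice.
    Fields are approximated uniformly by sums of scalar weights times fixed compact operators; for
    the slide this rests on the bound of rho(a) by the norm of a, hence on square roots in the
    C*-algebra. The same bound makes the index locally constant along paths of matrices. *)

Section Qdim.
Variable K : fieldType.

Definition subsp (V : lmodType K) (W : set V) : Prop :=
  W 0 /\ forall a x y, W x -> W y -> W (a *: x + y).

Lemma subspT (V : lmodType K) : subsp [set: V].
Proof. by []. Qed.

Lemma subsp0 (V : lmodType K) : subsp [set (0 : V)].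
Proof. by split=> // a x y -> ->; rewrite /= scaler0 addr0. Qed.

Section Subsp.
Variables (V : lmodType K) (W : set V).
Hypothesis hW : subsp W.

Lemma subspD x y : W x -> W y -> W (x + y).
Proof. by move=> hx hy; have := hW.2 1 x y hx hy; rewrite scale1r. Qed.

Lemma subspZ a x : W x -> W (a *: x).
Proof. by move=> hx; have := hW.2 a x 0 hx hW.1; rewrite addr0. Qed.

Lemma subspB x y : W x -> W y -> W (x - y).
Proof. by move=> hx hy; have := hW.2 (-1) y x hy hx; rewrite scaleN1r addrC. Qed.

Lemma subsp_sum n (c : 'I_n -> K) (e : 'I_n -> V) :
  (forall i, W (e i)) -> W (\sum_(i < n) c i *: e i).
Proof.
move=> he; elim/big_rec: _ => [|i x _]; first exact: hW.1.
exact: hW.2.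
Qed.
End Subsp.

(** Linearity is asked only on [W]: the coordinate maps below are obtained by choice and are
    arbitrary off [W]. *)
Definition lin_on (V V' : lmodType K) (W : set V) (f : V -> V') : Prop :=
  forall a x y, W x -> W y -> f (a *: x + y) = a *: f x + f y.

Lemma lin_on_sum (V V' : lmodType K) (W : set V) (f : V -> V') n
  (c : 'I_n -> K) (e : 'I_n -> V) : subsp W -> lin_on W f -> (forall i, W (e i)) ->
  f (\sum_(i < n) c i *: e i) = \sum_(i < n) c i *: f (e i).
Proof.
move=> hW hf he.
have f0 : f 0 = 0.
  have := hf 1 0 0 hW.1 hW.1; rewrite !scale1r !addr0.
  by move/(congr1 (fun x => x - f 0)); rewrite subrr addrK.
pose Q x y := W x /\ f x = y.
suff [] : Q (\sum_(i < n) c i *: e i) (\sum_(i < n) c i *: f (e i)) by [].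
elim/big_rec2: _ => [|i y x _ [hx hy]]; first by split=> //; exact: hW.1.
by split; [exact: hW.2 | rewrite hf// hy].
Qed.

Lemma lin_onB (V V' : lmodType K) (W : set V) (f : V -> V') x y :
  lin_on W f -> W x -> W y -> f (x - y) = f x - f y.
Proof. by move=> hf hx hy; rewrite addrC -scaleN1r hf// scaleN1r addrC. Qed.

(** Uniqueness of the coefficients makes the coordinate map linear with kernel [W2]; conversely,
    preimages of the unit vectors form a basis of the quotient. In this form dimension counts become
    statements about matrices. *)
Lemma qdimP (V : lmodType K) (W1 W2 : set V) n : subsp W1 -> subsp W2 ->
  qdim W1 W2 n <-> exists phi : V -> 'rV[K]_n,
    [/\ lin_on W1 phi, forall x, W1 x -> phi x = 0 <-> W2 x &
        forall c, exists2 x, W1 x & phi x = c].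
Proof.
move=> h1 h2; split.
  move=> [e [he hc]].
  pose Q x (c : 'rV[K]_n) := W2 (x - \sum_(i < n) c 0 i *: e i).
  have ex x : exists c, W1 x -> Q x c.
    case: (pselect (W1 x)) => [hx|]; last by exists 0.
    have [c [hcx _]] := hc x hx.
    exists (\row_i c i) => _; rewrite /Q.
    by under eq_bigr do rewrite mxE.
  pose phi x := sval (cid (ex x)).
  have hphi x : W1 x -> Q x (phi x) by exact: (svalP (cid (ex x))).
  have un x c : W1 x -> Q x c -> phi x = c.
    move=> hx hq; have [d [_ hd]] := hc x hx.
    apply/rowP => i; have e1 := hd (fun i => phi x 0 i) (hphi x hx).
    by rewrite -(congr1 (fun f => f i) e1) (congr1 (fun f => f i) (hd (fun i => c 0 i) hq)).
  exists phi; split.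
  - move=> a x y hx hy; apply: un; first exact: h1.2.
    rewrite /Q; have -> : a *: x + y - \sum_i (a *: phi x + phi y) 0 i *: e i =
       a *: (x - \sum_i phi x 0 i *: e i) + (y - \sum_i phi y 0 i *: e i).
      rewrite scalerBr scaler_sumr addrACA -opprD -big_split /=.
      congr (_ - _); apply: eq_bigr => i _.
      by rewrite !mxE scalerDl scalerA.
    by apply: h2.2; exact: hphi.
  - move=> x hx; split=> [h0|hx2].
      have := hphi x hx; rewrite h0 /Q big1 ?subr0// => i _.
      by rewrite mxE scale0r.
    by apply: un => //; rewrite /Q big1 ?subr0// => i _; rewrite mxE scale0r.
  - move=> c; exists (\sum_i c 0 i *: e i); first exact: subsp_sum.
    apply: un; first exact: subsp_sum.
    by rewrite /Q subrr; exact: h2.1.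
move=> [phi [hl hk hs]].
have [e he] : exists e : 'I_n -> V, forall i, W1 (e i) /\ phi (e i) = delta_mx 0 i.
  have ex i : exists x, W1 x /\ phi x = delta_mx 0 i.
    by have [x hx1 hx2] := hs (delta_mx 0 i); exists x.
  by exists (fun i => sval (cid (ex i))) => i; exact: (svalP (cid (ex i))).
exists e; split; first by move=> i; case: (he i).
have hsum (c : 'I_n -> K) : phi (\sum_(i < n) c i *: e i) = \row_i c i.
  rewrite (lin_on_sum _ h1 hl); last by move=> i; case: (he i).
  rewrite [RHS]row_sum_delta; apply: eq_bigr => i _.
  by rewrite mxE (he i).2.
have hW c : W1 (\sum_(i < n) c i *: e i).
  by apply: subsp_sum => // i; case: (he i).
move=> x hx; exists (fun i => phi x 0 i); split.
  apply/hk; first exact: subspB.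
  rewrite (lin_onB hl)// hsum; apply/rowP => i.
  by rewrite !mxE subrr.
move=> c /hk; rewrite (lin_onB hl)// hsum => /(_ (subspB h1 hx (hW c))) h0.
apply/funext => i; move/rowP: h0 => /(_ i); rewrite !mxE => /eqP.
by rewrite subr_eq0 => /eqP.
Qed.

(** The coordinates of the [n] basis vectors in the other basis form an n x m matrix with
    independent rows: a relation between the rows puts a combination of the vectors in [W2], and the
    coordinates of 0 are unique. *)
Lemma qdim_uniq_le (V : lmodType K) (W1 W2 : set V) n m : subsp W1 -> subsp W2 ->
  qdim W1 W2 n -> qdim W1 W2 m -> (n <= m)%N.
Proof.
move=> h1 h2 [e [he hc]] /qdimP => /(_ h1 h2) [psi [hl hk hs]].
pose A : 'M[K]_(n, m) := \matrix_i psi (e i).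
suff : row_free A by rewrite /row_free => /eqP <-; exact: rank_leq_col.
rewrite -kermx_eq0 -submx0; apply/row_subP => i.
set c := row i (kermx A).
have c0 : c *m A = 0 by rewrite /c -row_mul mulmx_ker row0.
have hx : W1 (\sum_i c 0 i *: e i) by exact: subsp_sum.
have : W2 (\sum_i c 0 i *: e i).
  apply/hk => //; rewrite (lin_on_sum _ h1 hl)//.
  rewrite -[RHS]c0 mulmx_sum_row.
  by apply: eq_bigr => j _; rewrite rowK.
have [d [hd1 hd2]] := hc 0 h1.1.
move=> hW; rewrite submx0; apply/eqP/rowP => j; rewrite [RHS]mxE.
have e1 := hd2 (fun j => - c 0 j); have e2 := hd2 (fun=> 0).
have : d = (fun j => - c 0 j).
  apply: e1; rewrite sub0r -sumrN; under eq_bigr do rewrite scaleNr opprK.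
  exact: hW.
have -> : d = (fun=> 0).
  apply: e2; rewrite big1 ?subr0; first exact: h2.1.
  by move=> k _; rewrite scale0r.
by move/(congr1 (fun f => - f j)); rewrite oppr0 opprK => ->.
Qed.

Lemma qdim_uniq (V : lmodType K) (W1 W2 : set V) n m : subsp W1 -> subsp W2 ->
  qdim W1 W2 n -> qdim W1 W2 m -> n = m.
Proof.
move=> h1 h2 hn hm; apply/eqP; rewrite eqn_leq.
by rewrite (qdim_uniq_le h1 h2 hn hm) (qdim_uniq_le h1 h2 hm hn).
Qed.

(** Take a matrix of maximal rank among those with row space inside [S]; a vector of [S] outside
    that row space would raise the rank. *)
Lemma subsp_row_space n (S : set 'rV[K]_n) : subsp S ->
  exists A : 'M[K]_n, forall v, S v <-> (v <= A)%MS.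
Proof.
move=> hS.
pose P r := `[< exists A : 'M[K]_n, (forall v, (v <= A)%MS -> S v) /\ \rank A = r >].
have exP : exists r, P r.
  exists 0%N; apply/asboolP; exists 0; split; last exact: mxrank0.
  by move=> v; rewrite submx0 => /eqP ->; exact: hS.1.
have ubP r : P r -> (r <= n)%N by move=> /asboolP [A [_ <-]]; exact: rank_leq_row.
case: (ex_maxnP exP ubP) => r /asboolP [A [hA rA]] hmax.
exists A => v; split; last exact: hA.
move=> hv; have := hmax (\rank (A + v)%MS).
have -> : P (\rank (A + v)%MS).
  apply/asboolP; exists (A + v)%MS; split=> // w /sub_addsmxP [[x y] ->] /=.
  rewrite addrC (_ : y *m v = (y 0 0) *: v); last first.
    by rewrite [y in LHS]mx11_scalar mul_scalar_mx.
  by apply: hS.2 => //; apply: hA; exact: submxMl.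
move=> /(_ isT); rewrite -rA => hr.
apply: submx_trans (addsmxSr A v) _.
by rewrite -(geq_leqif (mxrank_leqif_sup (addsmxSl A v))).
Qed.

(** In coordinates modulo [W3], the subspace [W2] becomes the row space of a matrix [A]. A row basis
    of [A] gives coordinates on W2/W3, and the cokernel matrix of [A] gives coordinates on W1/W2. *)
Lemma qdim_sub (V : lmodType K) (W1 W2 W3 : set V) n :
  subsp W1 -> subsp W2 -> subsp W3 -> W3 `<=` W2 -> W2 `<=` W1 ->
  qdim W1 W3 n -> exists a b, [/\ qdim W1 W2 a, qdim W2 W3 b & n = (a + b)%N].
Proof.
move=> h1 h2 h3 h32 h21 /qdimP => /(_ h1 h3) [phi [hl hk hs]].
pose S := [set v | exists2 x, W2 x & phi x = v].
have hS : subsp S.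
  split; first by exists 0; [exact: h2.1|apply/hk; [exact: h1.1|exact: h3.1]].
  move=> a _ _ [x hx <-] [y hy <-]; exists (a *: x + y); first exact: h2.2.
  by rewrite hl//; exact: h21.
have [A hA] := subsp_row_space hS.
exists (\rank (cokermx A)), (\rank A); split; last first.
- by rewrite mxrank_coker subnK// rank_leq_col.
- apply/qdimP => //; exists (fun x => phi x *m pinvmx (row_base A)); split.
  + by move=> a x y hx hy; rewrite hl ?mulmxDl ?scalemxAl//; exact: h21.
  + move=> x hx; have : (phi x <= row_base A)%MS.
      by rewrite eq_row_base; apply/hA; exists x.
    move=> hx'; split=> [e|h]; last by have /hk -> := h; [rewrite mul0mx|exact: h21].
    by apply/hk; [exact: h21|rewrite -(mulmxKpV hx') e mul0mx].
  + move=> c; have [x hx e] : S (c *m row_base A).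
      by apply/hA; rewrite -(eq_row_base A) submxMl.
    exists x => //; rewrite e.
    apply: (row_free_inj (row_base_free A)).
    by rewrite mulmxKpV// submxMl.
- apply/qdimP => //; exists (fun x => phi x *m col_base (cokermx A)); split.
  + by move=> a x y hx hy; rewrite hl ?mulmxDl ?scalemxAl//; exact: h21.
  + move=> x hx.
    have -> : (phi x *m col_base (cokermx A) = 0) <-> (phi x <= A)%MS.
      rewrite submxE.
      have e : phi x *m cokermx A =
          phi x *m col_base (cokermx A) *m row_base (cokermx A).
        by rewrite -mulmxA mulmx_base.
      rewrite e; split=> [->|/eqP h]; first by rewrite mul0mx eqxx.
      by apply: (row_free_inj (row_base_free (cokermx A))); rewrite h mul0mx.
    rewrite -hA; split=> [[y hy e]|hx3]; last first.
      by exists x.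
    rewrite -[x](subrK y); apply: subspD => //; apply: h32.
    apply/hk; first by apply: subspB => //; exact: h21.
    by rewrite (lin_onB hl) ?e ?subrr//; exact: h21.
  + move=> c; have /row_fullP [B hB] : row_full (col_base (cokermx A)).
      exact: col_base_full.
    have [x hx e] := hs (c *m B); exists x => //.
    by rewrite e -mulmxA hB mulmx1.
Qed.

Lemma qdim_trans (V : lmodType K) (W1 W2 W3 : set V) a b :
  subsp W1 -> subsp W2 -> subsp W3 -> W3 `<=` W2 -> W2 `<=` W1 ->
  qdim W1 W2 a -> qdim W2 W3 b -> qdim W1 W3 (a + b).
Proof.
move=> h1 h2 h3 h32 h21 hq /qdimP => /(_ h2 h3) [psi [hl' hk' hs']].
have [e [he hc]] := hq.
move/qdimP: hq => /(_ h1 h2) [phi [hl hk hs]].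
(* A projection [f] of [W1] onto [W2] splits the quotient: coordinates of [x] modulo [W2] and of
   [f x] modulo [W3] can then be put side by side. *)
have [f hf] : exists f : V -> V, [/\ lin_on W1 f, forall x, W1 x -> W2 (f x),
    forall x, W2 x -> f x = x & forall c, exists x, [/\ W1 x, phi x = c & f x = 0]].
  have [e' he'] : exists e : 'I_a -> V, forall i, W1 (e i) /\ phi (e i) = delta_mx 0 i.
    have ex i : exists x, W1 x /\ phi x = delta_mx 0 i.
      by have [x hx1 hx2] := hs (delta_mx 0 i); exists x.
    by exists (fun i => sval (cid (ex i))) => i; exact: (svalP (cid (ex i))).
  have hsum (c : 'I_a -> K) : phi (\sum_(i < a) c i *: e' i) = \row_i c i.
    rewrite (lin_on_sum _ h1 hl); last by move=> i; case: (he' i).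
    rewrite [RHS]row_sum_delta; apply: eq_bigr => i _.
    by rewrite mxE (he' i).2.
  have hW c : W1 (\sum_(i < a) c i *: e' i).
    by apply: subsp_sum => // i; case: (he' i).
  exists (fun x => x - \sum_i phi x 0 i *: e' i); split.
  - move=> c x y hx hy; rewrite hl// scalerBr scaler_sumr addrACA -opprD -big_split /=.
    congr (_ - _); apply: eq_bigr => i _.
    by rewrite !mxE scalerDl scalerA.
  - move=> x hx; apply/hk; first exact: subspB.
    by rewrite (lin_onB hl)// hsum; apply/rowP => i; rewrite !mxE subrr.
  - move=> x hx; have /hk := hx => -> //; last exact: h21.
    by rewrite big1 ?subr0// => i _; rewrite mxE scale0r.
  - move=> c; exists (\sum_i c 0 i *: e' i); split=> //.
      by rewrite hsum; apply/rowP => i; rewrite mxE.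
    by rewrite hsum; apply/eqP; rewrite subr_eq0; apply/eqP/eq_bigr => i _; rewrite mxE.
have [fl f2 fid fs] := hf.
apply/qdimP => //; exists (fun x => row_mx (phi x) (psi (f x))); split.
- move=> c x y hx hy; rewrite hl// fl// hl' ?scale_row_mx ?add_row_mx//; exact: f2.
- move=> x hx; split.
    rewrite -row_mx0 => /eq_row_mx [/hk h /hk' k].
    by rewrite -(fid x); [apply: k; exact: f2 | exact: h].
  move=> hx3; have hx2 := h32 _ hx3; have -> : phi x = 0 by apply/hk.
  have p0 : psi x = 0 by apply/hk'.
  by rewrite fid// p0 row_mx0.
- move=> c; have [x [hx ex fx]] := fs (lsubmx c).
  have [y hy ey] := hs' (rsubmx c).
  have hy1 := h21 _ hy.
  exists (1 *: x + y); first exact: h1.2.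
  rewrite hl// fl// fx scaler0 add0r scale1r fid// ex ey.
  have -> : phi y = 0 by apply/hk.
  by rewrite addr0 hsubmxK.
Qed.

(** The hypotheses say that [f] induces an isomorphism from W1/W2 onto W1'/W2'; coordinates are
    pulled back along it. *)
Lemma qdim_preim (V V' : lmodType K) (f : V -> V') (W1 W2 : set V) (W1' W2' : set V') n :
  subsp W1 -> subsp W2 -> subsp W1' -> subsp W2' -> lin_on W1 f ->
  (forall x, W1 x -> W1' (f x)) ->
  (forall y, W1' y -> exists2 x, W1 x & W2' (y - f x)) ->
  (forall x, W1 x -> W2 x <-> W2' (f x)) ->
  qdim W1' W2' n -> qdim W1 W2 n.
Proof.
move=> h1 h2 h1' h2' fl f1 fs fk.
move/qdimP => /(_ h1' h2') [phi [hl hk hs]].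
apply/qdimP => //; exists (phi \o f); split=> /=.
- by move=> a x y hx hy /=; rewrite fl// hl//; exact: f1.
- by move=> x hx; rewrite fk//=; apply: hk; exact: f1.
- move=> c; have [y hy <-] := hs c; have [x hx hyx] := fs y hy.
  exists x => //; apply/esym/eqP; rewrite -subr_eq0; apply/eqP.
  by have f1x := f1 _ hx; rewrite -(lin_onB hl)//; apply/hk => //; exact: subspB.
Qed.

(** Here a basis is pushed forward along the same isomorphism, so that no inverse of [f] has to be
    constructed. *)
Lemma qdim_image (V V' : lmodType K) (f : V -> V') (W1 W2 : set V) (W1' W2' : set V') n :
  subsp W1 -> subsp W2 -> subsp W1' -> subsp W2' -> lin_on W1 f ->
  (forall x, W1 x -> W1' (f x)) ->
  (forall y, W1' y -> exists2 x, W1 x & W2' (y - f x)) ->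
  (forall x, W1 x -> W2 x <-> W2' (f x)) ->
  qdim W1 W2 n -> qdim W1' W2' n.
Proof.
move=> h1 h2 h1' h2' fl f1 fs fk.
move=> [e [he hc]]; exists (f \o e); split; first by move=> i; exact: f1.
have fsum c : f (\sum_(i < n) c i *: e i) = \sum_(i < n) c i *: f (e i).
  exact: (lin_on_sum _ h1 fl).
have key x c : W1 x -> W2 (x - \sum_i c i *: e i) <->
    W2' (f x - \sum_i c i *: (f \o e) i).
  move=> hx; rewrite fk; last by apply: subspB => //; exact: subsp_sum.
  by rewrite (lin_onB fl) ?fsum//; exact: subsp_sum.
move=> y hy; have [x hx hyx] := fs y hy.
have [c [c1 c2]] := hc x hx.
have eq d : W2' (y - \sum_i d i *: (f \o e) i) <-> W2' (f x - \sum_i d i *: (f \o e) i).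
  have -> : y - \sum_i d i *: (f \o e) i = (y - f x) + (f x - \sum_i d i *: (f \o e) i).
    by rewrite addrA subrK.
  split=> h; last exact: subspD.
  by rewrite -[X in W2' X](addKr (y - f x)) addrC; apply: subspB.
exists c; split; first by apply/eq/key.
by move=> d /eq /key => /(_ hx); exact: c2.
Qed.

End Qdim.

(** * Algebraic Fredholm index *)

Section Fredholm.
Variables (K : fieldType) (V : lmodType K).
Implicit Types T S : V -> V.

Local Notation linT := (lin_on [set: V]).
Local Notation ker T := [set x | [set: V] x /\ T x = 0].
Local Notation ran T := (T @` [set: V]).
Local Notation fredholm T k := (has_index T [set: V] [set: V] k).

Lemma linT0 T : linT T -> T 0 = 0.
Proof.
move=> hT; have := hT 1 0 0 I I; rewrite !scale1r addr0.
by move/(congr1 (fun x => x - T 0)); rewrite subrr addrK.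
Qed.

Lemma linTD T x y : linT T -> T (x + y) = T x + T y.
Proof. by move=> hT; have := hT 1 x y I I; rewrite !scale1r. Qed.

Lemma linTB T x y : linT T -> T (x - y) = T x - T y.
Proof. by move=> hT; rewrite (lin_onB hT). Qed.

Lemma subsp_ker T : linT T -> subsp (ker T).
Proof.
move=> hT; split; first by split=> //; exact: linT0.
by move=> a x y [_ ex] [_ ey]; split=> //; rewrite hT// ex ey scaler0 addr0.
Qed.

Lemma subsp_ran T : linT T -> subsp (ran T).
Proof.
move=> hT; split; first by exists 0 => //; exact: linT0.
by move=> a _ _ [x _ <-] [y _ <-]; exists (a *: x + y) => //; rewrite hT.
Qed.

Lemma subspI (W1 W2 : set V) : subsp W1 -> subsp W2 -> subsp (W1 `&` W2).
Proof.
move=> h1 h2; split; first by split; [exact: h1.1 | exact: h2.1].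
by move=> a x y [? ?] [? ?]; split; [exact: h1.2 | exact: h2.2].
Qed.

Definition sumsp (W1 W2 : set V) : set V :=
  [set x | exists y z, [/\ W1 y, W2 z & x = y + z]].

Lemma subsp_sumsp (W1 W2 : set V) : subsp W1 -> subsp W2 -> subsp (sumsp W1 W2).
Proof.
move=> h1 h2; split.
  by exists 0, 0; split; [exact: h1.1 | exact: h2.1 | rewrite addr0].
move=> a _ _ [x1 [x2 [hx1 hx2 ->]]] [y1 [y2 [hy1 hy2 ->]]].
exists (a *: x1 + y1), (a *: x2 + y2); split; [exact: h1.2 | exact: h2.2 |].
by rewrite scalerDr addrACA.
Qed.

Lemma has_index_uniq T k l : linT T -> fredholm T k -> fredholm T l -> k = l.
Proof.
move=> hT [m [n [hm hn ->]]] [m' [n' [hm' hn' ->]]].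
rewrite (qdim_uniq (subsp_ker hT) (@subsp0 _ V) hm hm').
by rewrite (qdim_uniq (@subspT _ V) (subsp_ran hT) hn hn').
Qed.

Lemma findexE T k : linT T -> fredholm T k -> Defs.findex T [set: V] [set: V] = k.
Proof.
move=> hT hk; apply: (has_index_uniq hT) => //.
by rewrite /Defs.findex; case: xgetP => [y _ //|/(_ k)].
Qed.

(** Let I be the intersection of ker T and ran S. Then [S] maps ker(TS)/ker S onto I, [T] maps
    V/(ran S + ker T) onto ran T/ran(TS), and ker T/I is isomorphic to (ran S + ker T)/ran S, whose
    dimension cancels in the difference. *)
Lemma has_index_comp T S k l : linT T -> linT S ->
  fredholm T k -> fredholm S l -> fredholm (T \o S) (k + l).
Proof.
move=> hT hS [m' [n' [hm' hn' ->]]] [m [n [hm hn ->]]].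
have hTS : linT (T \o S) by move=> a x y _ _ /=; rewrite hS// hT.
have kT := subsp_ker hT; have kS := subsp_ker hS; have kTS := subsp_ker hTS.
have rT := subsp_ran hT; have rS := subsp_ran hS; have rTS := subsp_ran hTS.
have s0 := @subsp0 _ V; have sT := @subspT _ V.
set I := ker T `&` ran S.
have sI : subsp I by exact: subspI.
have sU : subsp (sumsp (ran S) (ker T)) by exact: subsp_sumsp.
have I0 : [set 0] `<=` I by move=> x ->; exact: sI.1.
have [a [b [ha hb eab]]] := qdim_sub kT sI s0 I0 (@subIsetl _ _ _) hm'.
have [c [d [hc hd ecd]]] := qdim_sub sT sU rS
  (fun x (hx : ran S x) => ex_intro _ x (ex_intro _ 0 (And3 hx (kT.1) (esym (addr0 x)))))
  (fun x _ => Logic.I) hn.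
have had : qdim (sumsp (ran S) (ker T)) (ran S) a.
  apply: (qdim_image (f := id) kT sI sU rS 
  _ _ _ _ ha) => //.
  - by move=> x hx; exists 0, x; split=> //; [exact: rS.1 | rewrite add0r].
  - by move=> y [u [v [hu hv ->]]]; exists v => //; rewrite addrK.
  - by move=> x hx; split=> [[]|].
have ead := qdim_uniq sU rS had hd.
have hb' : qdim (ker (T \o S)) (ker S) b.
  apply: (qdim_preim (f := S) kTS kS sI s0 _ _ _ _ hb) => //.
  - by move=> ? x y _ _; exact: hS.
  - move=> y [[_ hy] [x _ e]]; exists x; first by split=> //=; rewrite e.
    by rewrite e; exact: subrr.
  - by move=> x _; split=> [[]|].
have hc' : qdim (ran T) (ran (T \o S)) c.
  apply: (qdim_image (f := T) sT sU rT rTS _ _ _ _ hc) => //.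
  - by move=> y [x _ <-]; exists x => //; rewrite subrr; exact: rTS.1.
  - move=> x _; split=> [[u [v [[w _ <-] [_ hv] ->]]]|[w _ /= e]].
      by exists w => //=; rewrite linTD// hv addr0.
    exists (S w), (x - S w); split; [by exists w | split=> // | by rewrite addrC subrK].
    by rewrite linTB// e subrr.
exists (b + m)%N, (n' + c)%N; split.
- apply: (qdim_trans kTS kS s0) hb' hm.
    by move=> x ->; exact: kS.1.
  by move=> x [_ hx]; split=> //=; rewrite hx linT0.
- apply: (qdim_trans sT rT rTS) hn' hc' => //.
  by move=> _ [x _ <-]; exists (S x).
- by rewrite eab ecd ead !PoszD; lia.
Qed.

Lemma has_index_bij T S : linT T -> cancel T S -> cancel S T -> fredholm T 0.
Proof.
move=> hT TS ST; rewrite /has_index.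
have -> : ker T = [set 0].
  apply/seteqP; split=> [x [_ /(congr1 S)]|x ->]; last by split=> //; exact: linT0.
  by rewrite TS => ->; have := TS 0; rewrite (linT0 hT).
have -> : ran T = [set: V] by apply/seteqP; split=> // x _; exists (S x).
exists 0%N, 0%N; split=> //.
  exists (fun=> 0); split; first by case.
  move=> _ ->; exists (fun=> 0); split; first by rewrite big_ord0 subr0.
  by move=> c _; apply/funext; case.
exists (fun=> 0); split; first by case.
move=> x _; exists (fun=> 0); split=> //.
by move=> c _; apply/funext; case.
Qed.

(** ker T lies in ker(ST) and ran T contains ran(TS'), so the kernel and the cokernel of [T] are
    both finite dimensional. *)
Lemma has_index_factor T S S' k l : linT T -> linT S -> linT S' ->
  fredholm (S \o T) k -> fredholm (T \o S') l -> exists j, fredholm T j.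
Proof.
move=> hT hS hS' [m [_ [hm _ _]]] [_ [n [_ hn _]]].
have hST : linT (S \o T) by move=> a x y _ _ /=; rewrite hT// hS.
have hTS : linT (T \o S') by move=> a x y _ _ /=; rewrite hS'// hT.
have [|x [_ hx]|_ [b [_ hb _]]] := qdim_sub (subsp_ker hST) (subsp_ker hT) (@subsp0 _ V) _ _ hm.
- by move=> x ->; exact: (subsp_ker hT).1.
- by split=> //=; rewrite hx linT0.
have [|//|a [_ [ha _ _]]] := qdim_sub (@subspT _ V) (subsp_ran hT) (subsp_ran hTS) _ _ hn.
  by move=> _ [x _ <-]; exists (S' x).
by exists (b%:Z - a%:Z), b, a.
Qed.

Definition span (s : seq V) : set V :=
  [set x | exists c : 'I_(size s) -> K, x = \sum_i c i *: s`_i].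

Lemma subsp_span s : subsp (span s).
Proof.
split; first by exists (fun=> 0); rewrite big1// => i _; rewrite scale0r.
move=> a _ _ [c ->] [d ->]; exists (fun i => a * c i + d i).
rewrite scaler_sumr -big_split /=; apply: eq_bigr => i _.
by rewrite scalerDl scalerA.
Qed.

(** The vectors of [s] may be dependent; the dimension is that of the coefficient space modulo the
    relations. *)
Lemma qdim_span s : exists n, qdim (span s) [set 0] n.
Proof.
pose f (c : 'rV[K]_(size s)) : V := \sum_i c 0 i *: s`_i.
have fl : lin_on [set: 'rV[K]_(size s)] f.
  move=> a x y _ _; rewrite /f scaler_sumr -big_split /=; apply: eq_bigr => i _.
  by rewrite !mxE scalerDl scalerA.
pose N := [set c | f c = 0].
have hN : subsp N.
  split; first by rewrite /N/= /f big1// => i _; rewrite mxE scale0r.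
  by move=> a x y hx hy; rewrite /N/= fl// hx hy scaler0 addr0.
have hT : qdim [set: 'rV[K]_(size s)] [set 0] (size s).
  apply/qdimP; [exact: subspT|exact: subsp0|exists id; split=> //].
  by move=> c; exists c.
have [|//|a [_ [ha _ _]]] := qdim_sub (@subspT _ _) hN (@subsp0 _ _) _ _ hT.
  by move=> x ->; exact: hN.1.
exists a; apply: (qdim_image (f := f) (@subspT _ _) hN (subsp_span s) (@subsp0 _ V) 
  _ _ _ _ ha) => //.
- by move=> x _; exists (fun i => x 0 i).
- move=> _ [c ->]; exists (\row_i c i) => //=; apply/eqP; rewrite subr_eq0; apply/eqP.
  by apply: eq_bigr => i _; rewrite mxE.
Qed.

(* The kernel of 1 + f lies in a finite-dimensional space U containing the image
   of f, and V / (1 + f) V = U / (1 + f) U. *)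
Lemma has_index_finite_rank (f : V -> V) s : linT f -> (forall x, span s (f x)) ->
  fredholm (fun x => x + f x) 0.
Proof.
move=> hf fs; set g := fun x => x + f x.
have hg : linT g.
  by move=> a x y _ _; rewrite /g hf// scalerDr addrACA.
have sU := subsp_span s; set U := span s in fs sU.
have [N hN] := qdim_span s.
have s0 := @subsp0 _ V; have sT := @subspT _ V.
have kg := subsp_ker hg; have rg := subsp_ran hg.
have kU : ker g `<=` U.
  move=> x [_ /eqP]; rewrite /g addr_eq0 => /eqP ->.
  by rewrite -scaleN1r; exact: subspZ.
have gU x : U (g x) <-> U x.
  split=> h; last exact: subspD.
  by rewrite -[x](addrK (f x)); exact: subspB.
have sI : subsp (U `&` ran g) by exact: subspI.
have [a [b [ha hb eab]]] := qdim_sub sU kg s0 (fun x h => eq_ind_r (ker g) kg.1 h) kU hN.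
have [c [d [hc hd ecd]]] := qdim_sub sU sI s0 (fun x h => eq_ind_r (U `&` ran g) sI.1 h)
  (@subIsetl _ _ _) hN.
have had : qdim (U `&` ran g) [set 0] a.
  apply: (qdim_image (f := g) sU kg sI s0 
  _ _ _ _ ha) => //.
  - by move=> ? x y _ _; exact: hg.
  - by move=> x hx; split; [exact/gU | exists x].
  - by move=> y [hy [x _ e]]; exists x; [apply/gU; rewrite e | rewrite e; exact: subrr].
  - by move=> x _; split=> [[]|].
have e := qdim_uniq sI s0 had hd.
exists b, c; split=> //.
  apply: (qdim_image (f := id) sU sI sT rg _ _ _ _ hc) => //.
    by move=> y _; exists (- f y); [rewrite -scaleN1r; exact: subspZ | exists y => //; rewrite opprK].
  by move=> x hx; split=> [[]|].
by move: eab; rewrite ecd e addnC => /addnI ->; rewrite subrr.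
Qed.

End Fredholm.

(** * Hilbert spaces *)

Section Contraction.
Variables (R : realType) (X : Type) (D : X -> X -> R -> Prop) (S : X -> Prop).
Hypothesis Dxx : forall x, D x x 0.
Hypothesis Dsym : forall x y c, D x y c -> D y x c.
Hypothesis Dtri : forall x y z a b, D x y a -> D y z b -> D x z (a + b).
Hypothesis Dle : forall x y a b, a <= b -> D x y a -> D x y b.
Hypothesis Dcomplete : forall x : nat -> X, (forall n, S (x n)) ->
  (forall e, 0 < e -> exists N, forall m n, (N <= m)%N -> (N <= n)%N ->
     D (x m) (x n) e) ->
  exists l, S l /\ forall e, 0 < e -> exists N, forall n, (N <= n)%N -> D (x n) l e.

Lemma expr_le_eps (C r e : R) : 0 <= r < 1 -> 0 < e ->
  exists N : nat, forall n, (N <= n)%N -> C * r ^+ n <= e.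
Proof.
move=> /andP[r0 r1] e0.
have h : (C * r ^+ n @[n --> \oo] --> C * 0)%classic.
  by apply: cvgMr; apply: cvg_expr; rewrite ger0_norm.
rewrite mulr0 in h; move/cvgrPdist_lt : h => /(_ e e0) [N _ hN].
exists N => n hn; have := hN n hn; rewrite /= sub0r normrN.
by move/ltW; apply: le_trans; exact: ler_norm.
Qed.

Section Geometric.
Variables (x : nat -> X) (C r : R).
Hypotheses (C0 : 0 <= C) (r01 : 0 <= r < 1).
Hypothesis hx : forall n, D (x n) (x n.+1) (C * r ^+ n).

Lemma geometric_dist n m : (n <= m)%N -> D (x n) (x m) (C / (1 - r) * r ^+ n).
Proof.
have [/andP[r0 r1]] := (r01, I) => _.
have r1' : 0 < 1 - r by rewrite subr_gt0.
(* Keeping the exact geometric sum instead of its upper bound is what lets the induction on [k]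
   close. *)
have hsum k : D (x n) (x (n + k)%N) (C / (1 - r) * (r ^+ n - r ^+ (n + k))).
  elim: k => [|k IH]; first by rewrite addn0 subrr mulr0.
  rewrite addnS; apply: Dle (Dtri IH (hx _)); rewrite exprS.
  set a := r ^+ (n + k); set b := r ^+ n.
  suff -> : C / (1 - r) * (b - r * a) = C / (1 - r) * (b - a) + C * a by [].
  by field; rewrite gt_eqF.
move=> nm; have := hsum (m - n)%N; rewrite subnKC//; apply: Dle.
rewrite ler_wpM2l ?divr_ge0 ?(ltW r1')//.
by rewrite lerBlDr lerDl exprn_ge0.
Qed.

Lemma geometric_cvg : (forall n, S (x n)) ->
  exists l, S l /\ forall n e, 0 < e -> D (x n) l (C / (1 - r) * r ^+ n + e).
Proof.
move=> Sx; have [|l [Sl hl]] := Dcomplete Sx.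
  move=> e e0; have [N hN] := expr_le_eps (C / (1 - r)) r01 e0.
  exists N => m n Nm Nn; have [mn|/ltnW nm] := leqP m n.
    by apply: Dle (geometric_dist mn); exact: hN.
  by apply: Dsym; apply: Dle (geometric_dist nm); exact: hN.
exists l; split=> // n e e0; have [N hN] := hl e e0.
have h1 := geometric_dist (leq_maxl n N).
exact: Dtri h1 (hN _ (leq_maxr n N)).
Qed.
End Geometric.

(** [D x y c] stands for a distance of at most [c]. As a predicate it also covers operators, which
    are handled through bounds and not through a numerical norm. [S] carries invariants such as
    self-adjointness to the limit. The conclusion stops at arbitrarily small distance because [D] is
    not assumed to separate points. *)
Lemma contraction_fixpoint (f : X -> X) (x0 : X) (C r : R) : 0 <= C -> 0 <= r < 1 ->
  S x0 -> (forall x, S x -> S (f x)) ->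
  (forall x y c, S x -> S y -> 0 <= c -> D x y c -> D (f x) (f y) (r * c)) ->
  D x0 (f x0) C -> exists l, S l /\ forall e, 0 < e -> D (f l) l e.
Proof.
move=> C0 r01 S0 Sf Df D0; pose x n := iter n f x0.
have [/andP[r0 r1]] := (r01, I) => _.
have Sx n : S (x n) by elim: n => //= n; exact: Sf.
have hx n : D (x n) (x n.+1) (C * r ^+ n).
  elim: n => [|n IH]; first by rewrite mulr1.
  rewrite exprS mulrCA; apply: Df (Sx n) (Sx n.+1) _ IH.
  by rewrite mulr_ge0// exprn_ge0.
have [l [Sl hl]] := geometric_cvg C0 r01 hx Sx.
exists l; split=> // e e0.
have e4 : 0 < e / 4 by rewrite divr_gt0.
have [N hN] := expr_le_eps (C / (1 - r)) r01 e4.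
have hl' n : (N <= n)%N -> D (x n) l (e / 2).
  move=> Nn; apply: Dle (hl n _ e4); have := hN n Nn; lra.
have /Dsym h1 := hl' _ (leqnn N); have h2 := hl' _ (leqnSn N).
have e2 : 0 <= e / 2 by lra.
have h3 := Df _ _ _ Sl (Sx N) e2 h1.
apply: Dle (Dtri h3 h2).
have : r * (e / 2) <= 1 * (e / 2) by rewrite ler_wpM2r// ltW.
lra.
Qed.
End Contraction.

(** * Cauchy-Schwarz, completeness and uniform boundedness *)

Section HilbertSpace.
Variables (R : realType).
Local Notation normc := Normc.normc.
Local Open Scope complex_scope.
Implicit Type E : hilbMod R pt.

Definition ip E (x y : E) : R[i] := hm_ip x y tt.
Definition hnorm E (x : E) : R := Num.sqrt (complex.Re (ip x x)).

Lemma ptE (P : pt -> Prop) : (forall t, P t) <-> P tt.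
Proof. by split=> [//|h []]. Qed.

Section Basic.
Variable E : hilbMod R pt.
Implicit Types (x y z : E) (c : R[i]).

Lemma ipD x y z : ip x (y + z) = ip x y + ip x z. Proof. exact: hm_ipD. Qed.
Lemma ipZ x c y : ip x (c *: y) = c * ip x y. Proof. exact: hm_ipZ. Qed.
Lemma ipC x y : ip y x = (ip x y)^*%C. Proof. exact: hm_ipC. Qed.
Lemma ipDl x y z : ip (x + y) z = ip x z + ip y z. Proof. exact: hm_ipDl. Qed.
Lemma ipZl c x y : ip (c *: x) y = c^*%C * ip x y. Proof. exact: hm_ipZl. Qed.
Lemma ipN x y : ip x (- y) = - ip x y. Proof. exact: hm_ipN. Qed.
Lemma ipNl x y : ip (- x) y = - ip x y. Proof. exact: hm_ipNl. Qed.
Lemma ip0 x : ip x 0 = 0. Proof. exact: hm_ip0. Qed.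
Lemma ip0l x : ip 0 x = 0. Proof. by rewrite ipC ip0 conjc0. Qed.
Lemma ipB x y z : ip x (y - z) = ip x y - ip x z. Proof. by rewrite ipD ipN. Qed.
Lemma ipBl x y z : ip (x - y) z = ip x z - ip y z. Proof. by rewrite ipDl ipNl. Qed.

Lemma ip_inj x y : (forall z, ip z x = ip z y) -> x = y.
Proof. by move=> h; apply: hm_ip_inj => z [] ; exact: h. Qed.

Lemma ipxx_ge0 x : 0 <= ip x x. Proof. exact: hm_ip_ge0. Qed.

Lemma ipxxE x : ip x x = (hnorm x ^+ 2)%:C.
Proof.
have := ipxx_ge0 x; rewrite lecE/= => /andP[/eqP i0 r0].
by rewrite sqr_sqrtr//; case: (ip x x) i0 => a b /= ->.
Qed.

Lemma hnorm_ge0 x : 0 <= hnorm x. Proof. exact: sqrtr_ge0. Qed.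

Lemma hnorm_sqr x : hnorm x ^+ 2 = complex.Re (ip x x).
Proof. by rewrite ipxxE. Qed.

Lemma hnorm0 : hnorm (0 : E) = 0.
Proof. by rewrite /hnorm ip0 sqrtr0. Qed.

Lemma hnorm0_eq0 x : hnorm x = 0 -> x = 0.
Proof.
move=> h; apply: hm_ip_eq0 => -[]; rewrite -/(ip x x) ipxxE h.
by rewrite expr0n.
Qed.

Lemma normc_ge0 c : 0 <= normc c. Proof. by case: c => a b; exact: sqrtr_ge0. Qed.

Lemma RcM (a b : R) : (a * b)%:C = a%:C * b%:C :> R[i]. Proof. exact: rmorphM. Qed.
Lemma RcD (a b : R) : (a + b)%:C = a%:C + b%:C :> R[i]. Proof. exact: rmorphD. Qed.
Lemma RcB (a b : R) : (a - b)%:C = a%:C - b%:C :> R[i]. Proof. exact: rmorphB. Qed.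

Lemma normrE c : `|c| = (normc c)%:C. Proof. by case: c. Qed.

Lemma ler_normcD c d : normc (c + d) <= normc c + normc d.
Proof. by rewrite -lecR RcD -!normrE ler_normD. Qed.

Lemma normcNr c : normc (- c) = normc c.
Proof. by apply: complexI; rewrite -!normrE normrN. Qed.

Lemma normc_sqr c : c * c^*%C = (normc c ^+ 2)%:C.
Proof.
by rewrite -sqr_normc rmorphXn /=; case: c.
Qed.

Lemma normcR (r : R) : normc r%:C = `|r|.
Proof. by rewrite /= expr0n addr0 sqrtr_sqr. Qed.

Lemma Re_le_normc c : complex.Re c <= normc c.
Proof.
have := normc_ge_Re c; have -> : `|c| = (normc c)%:C by case: c.
by rewrite lecR; apply: le_trans; exact: ler_norm.
Qed.

Lemma hnormZ c x : hnorm (c *: x) = normc c * hnorm x.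
Proof.
apply/eqP; rewrite -(@eqrXn2 _ 2)// ?mulr_ge0 ?hnorm_ge0 ?normc_ge0//.
apply/eqP/complexI; rewrite -ipxxE ipZ ipZl mulrA normc_sqr ipxxE -RcM.
by rewrite exprMn.
Qed.

Lemma hnormN x : hnorm (- x) = hnorm x.
Proof. by rewrite /hnorm ipN ipNl opprK. Qed.

Lemma hdistC x y : hnorm (x - y) = hnorm (y - x).
Proof. by rewrite -hnormN opprB. Qed.

Lemma hnormRZ (r : R) x : hnorm (r%:C *: x) = `|r| * hnorm x.
Proof. by rewrite hnormZ normcR. Qed.

(** Positivity of the inner square of ||x||^2 y - <x, y> x, a multiple of the usual vector that
    avoids division. *)
Lemma cauchy_schwarz x y : normc (ip x y) <= hnorm x * hnorm y.
Proof.
have [x0|x0] := eqVneq (hnorm x) 0.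
  by rewrite (hnorm0_eq0 x0) ip0l hnorm0 mul0r Normc.normc0.
have xp : 0 < hnorm x by rewrite lt_def x0 hnorm_ge0.
set w := ip x y; have := ipxx_ge0 (((hnorm x ^+ 2)%:C) *: y - w *: x).
have -> : ip (((hnorm x ^+ 2)%:C) *: y - w *: x) (((hnorm x ^+ 2)%:C) *: y - w *: x) =
   (hnorm x ^+ 2 * (hnorm x ^+ 2 * hnorm y ^+ 2 - normc w ^+ 2))%:C.
  rewrite ipB !ipBl !ipZ !ipZl !ipxxE conjc_real (ipC x y) -/w.
  rewrite RcM RcB RcM -normc_sqr /=.
  set a := (hnorm x ^+ 2)%:C; set b := (hnorm y ^+ 2)%:C; set w' := w^*%C.
  ring.
rewrite ler0c pmulr_rge0 ?exprn_gt0// subr_ge0 -exprMn.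
by rewrite ler_pXn2r// ?nnegrE ?normc_ge0 ?mulr_ge0 ?hnorm_ge0.
Qed.

Lemma hnormD x y : hnorm (x + y) <= hnorm x + hnorm y.
Proof.
rewrite -(@ler_pXn2r _ 2)// ?nnegrE ?addr_ge0 ?hnorm_ge0//.
rewrite -lecR -ipxxE ipD !ipDl (ipC x y) !ipxxE.
have -> : (hnorm x ^+ 2)%:C + (ip x y)^*%C + (ip x y + (hnorm y ^+ 2)%:C) =
  (hnorm x ^+ 2 + hnorm y ^+ 2 + 2 * complex.Re (ip x y))%:C.
  have := addcJ (ip x y); rewrite !RcD RcM => h.
  have -> : (2 : R)%:C = 2%:R by exact: rmorph_nat.
  by rewrite -h; set w' := (ip x y)^*%C; ring.
rewrite lecR; have := le_trans (Re_le_normc _) (cauchy_schwarz x y).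
by move=> h; rewrite sqrrD; lra.
Qed.

Lemma hnormB x y : hnorm (x - y) <= hnorm x + hnorm y.
Proof. by rewrite (le_trans (hnormD _ _))// hnormN. Qed.

Lemma hdist_tri x y z a b :
  hnorm (x - y) <= a -> hnorm (y - z) <= b -> hnorm (x - z) <= a + b.
Proof.
by move=> h1 h2; rewrite -(subrK y x) -addrA (le_trans (hnormD _ _))// lerD.
Qed.

Lemma hnorm_sum I (s : seq I) (F : I -> E) :
  hnorm (\sum_(i <- s) F i) <= \sum_(i <- s) hnorm (F i).
Proof.
elim/big_rec2 : _ => [|i a x _ h]; first by rewrite hnorm0.
by rewrite (le_trans (hnormD _ _))// lerD2l.
Qed.

Lemma norm_leE x (c : R) : 0 <= c -> norm_le x c <-> hnorm x <= c.
Proof.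
move=> c0; rewrite /norm_le ptE -/(ip x x) ipxxE lecR.
by rewrite ler_pXn2r// nnegrE hnorm_ge0.
Qed.

Lemma norm_leW x : norm_le x (hnorm x).
Proof. by apply/norm_leE => //; exact: hnorm_ge0. Qed.

Lemma hcomplete (a : nat -> E) :
  (forall e, 0 < e -> exists N, forall m n, (N <= m)%N -> (N <= n)%N ->
     hnorm (a m - a n) <= e) ->
  exists l, forall e, 0 < e -> exists N, forall n, (N <= n)%N -> hnorm (a n - l) <= e.
Proof.
move=> h; have [|l hl] := @hm_complete R pt E a.
  move=> e e0; have [N hN] := h e e0; exists N => m n Nm Nn.
  by apply/norm_leE; [exact: ltW | exact: hN].
exists l => e e0; have [N hN] := hl e e0; exists N => n Nn.
by apply/norm_leE; [exact: ltW | exact: hN].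
Qed.

Lemma hnorm_lt_eps x : (forall e, 0 < e -> hnorm x <= e) -> x = 0.
Proof.
move=> h; apply: hnorm0_eq0; apply/eqP; rewrite eq_le hnorm_ge0 andbT.
by apply/ler_addgt0Pr => e e0; rewrite add0r h.
Qed.

Let D x y (a : R) : Prop := hnorm (x - y) <= a.
Let Dxx x : D x x 0. Proof. by rewrite /D subrr hnorm0. Qed.
Let Dsym x y a : D x y a -> D y x a. Proof. by rewrite /D hdistC. Qed.
Let Dtri x y z a b : D x y a -> D y z b -> D x z (a + b).
Proof. exact: hdist_tri. Qed.
Let Dle x y a b : a <= b -> D x y a -> D x y b.
Proof. by move=> ab; rewrite /D => /le_trans; apply. Qed.
Let Dcomplete (a : nat -> E) : (forall n : nat, True) ->
  (forall e, 0 < e -> exists N, forall m n, (N <= m)%N -> (N <= n)%N ->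
     D (a m) (a n) e) ->
  exists l, True /\ forall e, 0 < e -> exists N, forall n, (N <= n)%N -> D (a n) l e.
Proof. by move=> _ /hcomplete [l hl]; exists l. Qed.

Lemma hcontraction (f : E -> E) (r : R) : 0 <= r < 1 ->
  (forall x y, hnorm (f x - f y) <= r * hnorm (x - y)) -> exists x, f x = x.
Proof.
move=> r01 hf; have [/andP[r0 r1]] := (r01, I) => _.
have [x y a _ _ _ h||l [_ hl]] := contraction_fixpoint Dxx Dsym Dtri Dle Dcomplete
  (f := f) (x0 := 0) (hnorm_ge0 (0 - f 0)) r01 Logic.I (fun _ => id).
- by rewrite /D (le_trans (hf _ _))// ler_wpM2l.
- exact: lexx.
- by exists l; apply/eqP; rewrite -subr_eq0; apply/eqP; exact: hnorm_lt_eps.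
Qed.

(* A gliding hump: if z_n in P is large, step from x_n by 4^-n in the direction
   +z_n or -z_n, whichever makes <z_n, x_{n+1}> large. *)
Lemma weakly_bounded (P : set E) :
  (forall x, exists C, forall z, P z -> normc (ip z x) <= C) ->
  exists C, forall z, P z -> hnorm z <= C.
Proof.
move=> wb; apply/not_existsP => ub.
have [z hz] : exists z : nat -> E, forall n, P (z n) /\ n%:R * 4 ^+ n < hnorm (z n).
  suff h n : exists y, P y /\ n%:R * 4 ^+ n < hnorm y.
    by exists (fun n => sval (cid (h n))) => n; exact: (svalP (cid (h n))).
  have /existsNP [y /not_implyP [Py /negP]] := ub (n%:R * 4 ^+ n).
  by rewrite -ltNge => hy; exists y.
have z0 n : 0 < hnorm (z n).
  by apply: le_lt_trans (hz n).2; rewrite mulr_ge0 ?exprn_ge0.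
pose v n : E := ((4^-1 ^+ n / hnorm (z n))%:C) *: z n.
have q0 n : 0 <= (4^-1 : R) ^+ n by rewrite exprn_ge0.
have hv n : hnorm (v n) = 4^-1 ^+ n.
  rewrite hnormRZ normrM normfV [`|hnorm _|]ger0_norm ?hnorm_ge0// divfK ?gt_eqF//.
  by rewrite ger0_norm.
pose step n x : E :=
  if normc (ip (z n) (x + v n)) < normc (ip (z n) (x - v n)) then x - v n else x + v n.
pose x := fix x n := if n is m.+1 then step m (x m) else 0.
have hx n : hnorm (x n - x n.+1) <= 1 * 4^-1 ^+ n.
  rewrite /= /step mul1r; case: ifP => _.
    by rewrite opprB addrC subrK hv.
  by rewrite opprD addrA subrr sub0r hnormN hv.
have hzx n : 4^-1 ^+ n * hnorm (z n) <= normc (ip (z n) (x n.+1)).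
  set a := normc (ip (z n) (x n + v n)); set b := normc (ip (z n) (x n - v n)).
  have hab : 2 * (4^-1 ^+ n * hnorm (z n)) <= a + b.
    have -> : 2 * (4^-1 ^+ n * hnorm (z n)) =
        normc (ip (z n) (x n + v n) - ip (z n) (x n - v n)).
      have e2 : x n + v n - (x n - v n) = 2%:R *: v n.
        by rewrite scaler_nat mulr2n opprB [LHS]addrC addrA subrK.
      rewrite -ipB e2 ipZ Normc.normcM.
      rewrite ipZ ipxxE -RcM normcR; congr (_ * _).
        by rewrite -(rmorph_nat (real_complex R)) normcR ger0_norm.
      rewrite ger0_norm; first by field; rewrite gt_eqF.
      by rewrite mulr_ge0 ?divr_ge0 ?exprn_ge0 ?hnorm_ge0.
    by apply: (le_trans (ler_normcD _ _)); rewrite normcNr.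
  rewrite -[x n.+1]/(step n (x n)) /step -/a -/b.
  by case: ltrP => ab; rewrite -?/a -?/b; move: hab ab; set q := 4^-1 ^+ n * _; lra.
have r01 : 0 <= (4^-1 : R) < 1 by lra.
have [l [_ hl]] := geometric_cvg Dxx Dsym Dtri Dle Dcomplete ler01 r01 hx (fun=> Logic.I).
have [C hC] := wb l.
have hl' n : hnorm (x n - l) <= 4 / 3 * 4^-1 ^+ n.
  apply/ler_addgt0Pr => e /(hl n); rewrite /D.
  by have -> : 1 / (1 - 4^-1) = 4 / 3 :> R by field.
(* The steps after the n-th move the limit by at most 4/3 times 4^-(n+1), one third of 4^-n, so two
   thirds of 4^-n ||z_n|| survive in <z_n, l>; and 4^-n ||z_n|| exceeds n. *)
have key n : 3^-1 * (2 * n%:R) <= C.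
  apply: le_trans (hC _ (hz n).1).
  have e : ip (z n) l = ip (z n) (x n.+1) - ip (z n) (x n.+1 - l).
    by rewrite -ipB opprB addrC subrK.
  have h1 : normc (ip (z n) (x n.+1 - l)) <= 3^-1 * (4^-1 ^+ n * hnorm (z n)).
    rewrite (le_trans (cauchy_schwarz _ _))// mulrC mulrA ler_wpM2r ?hnorm_ge0//.
    by rewrite (le_trans (hl' _))// exprS; set q := _ ^+ n; lra.
  have h2 : normc (ip (z n) (x n.+1)) <= normc (ip (z n) l) + normc (ip (z n) (x n.+1 - l)).
    by rewrite e; apply: (le_trans _ (ler_normcD _ _)); rewrite subrK.
  have h3 : n%:R <= 4^-1 ^+ n * hnorm (z n).
    by rewrite exprVn mulrC ler_pdivlMr ?exprn_gt0// ltW// (hz n).2.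
  have h4 := hzx n.
  set q := _ * hnorm (z n) in h1 h3 h4; lra.
have C0 : 0 <= C by have := key 0%N; rewrite mulr0 mulr0.
have := key (Num.bound (C * 2)); have := archi_boundP (_ : 0 <= C * 2).
by move=> /(_ ltac:(lra)); lra.
Qed.
End Basic.

Lemma adjointP (E F : hilbMod R pt) (T : E -> F) S : adjoint T S ->
  forall x y, ip (T x) y = ip x (S y).
Proof. by move=> h x y; exact: h. Qed.

(** Uniform boundedness for the image of the unit ball under [S]: <S y, x> = <y, T x> is at most ||T
    x|| there. The resulting bound on [S y] bounds [T x] when y is [T x] normalized. *)
Lemma adjoint_bounded (E F : hilbMod R pt) (T : E -> F) S : adjoint T S ->
  exists2 C, 0 <= C & forall x, hnorm (T x) <= C * hnorm x.
Proof.
move=> h.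
have [x|C hC] := @weakly_bounded E [set z | exists2 y : F, hnorm y <= 1 & z = S y].
  exists (hnorm (T x)) => _ [y y1 ->].
  rewrite (adjointP (adjoint_sym h)) ?(le_trans (cauchy_schwarz _ _))//.
  by rewrite -[leRHS]mul1r ler_wpM2r ?hnorm_ge0.
have C0 : 0 <= C.
  rewrite -(hnorm0 E); apply: hC; exists 0; first by rewrite hnorm0.
  by apply: ip_inj => z; rewrite -(adjointP h) !ip0.
exists C => // x; have [->|n0] := eqVneq (hnorm (T x)) 0.
  by rewrite mulr_ge0 ?hnorm_ge0.
have p : 0 < hnorm (T x) by rewrite lt_def n0 hnorm_ge0.
pose y := ((hnorm (T x))^-1)%:C *: T x.
have y1 : hnorm y <= 1.
  by rewrite hnormRZ normfV ger0_norm ?hnorm_ge0// mulVf.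
have : normc (ip (S y) x) <= C * hnorm x.
  rewrite (le_trans (cauchy_schwarz _ _))// ler_wpM2r ?hnorm_ge0//.
  by apply: hC; exists y.
rewrite (adjointP (adjoint_sym h)) /y ipZl conjc_real ipxxE -RcM normcR.
by rewrite ger0_norm ?mulr_ge0 ?invr_ge0 ?exprn_ge0 ?hnorm_ge0// expr2 mulKf.
Qed.

End HilbertSpace.

(** * Adjointable operators and their index *)

Section Operators.
Variables (R : realType).
Local Notation normc := Normc.normc.
Local Open Scope complex_scope.

(** The adjoint is kept as an existence statement, so that operators agreeing as functions are
    equal; [badj] recovers it by choice. *)
Record bop (E : hilbMod R pt) := Bop {
  bfun :> E -> E;
  bopP : exists S : E -> E, adjoint bfun S
}.

Lemma ip_adjoint (E F : hilbMod R pt) (T : E -> F) (S : F -> E) :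
  (forall x y, ip (T x) y = ip x (S y)) -> adjoint T S.
Proof. by move=> h x y []; exact: h. Qed.

Section Ring.
Variable E : hilbMod R pt.
Implicit Types (T S U : bop E) (x y : E).

Lemma bop_eq T S : (forall x, T x = S x) -> T = S.
Proof.
case: T S => [f hf] [g hg] /= h; have e : f = g by exact/funext.
by subst g; congr Bop; exact: Prop_irrelevance.
Qed.

Definition badj T : bop E := Bop (ex_intro _ _ (adjoint_sym (svalP (cid (bopP T))))).

Lemma ip_adj T x y : ip (T x) y = ip x (badj T y).
Proof. exact: (adjointP (svalP (cid (bopP T)))). Qed.

Lemma ip_adjr T x y : ip x (T y) = ip (badj T x) y.
Proof. by rewrite (ipC y) (ipC (T y)) ip_adj. Qed.

Lemma bopD T x y : T (x + y) = T x + T y.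
Proof. by have [S /adjointD] := bopP T. Qed.
Lemma bopN T x : T (- x) = - T x.
Proof. by have [S /adjointN] := bopP T. Qed.
Lemma bopB T x y : T (x - y) = T x - T y. Proof. by rewrite bopD bopN. Qed.
Lemma bop0 T : T 0 = 0. Proof. by apply: (addrI (T 0)); rewrite -bopD !addr0. Qed.
Lemma bopZ T c x : T (c *: x) = c *: T x.
Proof. by apply: ip_inj => z; rewrite ip_adjr !ipZ -ip_adjr. Qed.
Lemma bop_sum T I (s : seq I) (F : I -> E) : T (\sum_(i <- s) F i) = \sum_(i <- s) T (F i).
Proof. by rewrite (big_morph T (@bopD T) (bop0 T)). Qed.

Lemma bop_lin T : lin_on [set: E] T.
Proof. by move=> a x y _ _; rewrite bopD bopZ. Qed.

Lemma badd_subproof T S : exists U : E -> E, adjoint (fun x => T x + S x) U.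
Proof.
exists (fun x => badj T x + badj S x); apply: ip_adjoint => x y.
by rewrite ipDl ipD !ip_adj.
Qed.
Definition badd T S : bop E := Bop (badd_subproof T S).
Lemma bopp_subproof T : exists U : E -> E, adjoint (fun x => - T x) U.
Proof.
by exists (fun x => - badj T x); apply: ip_adjoint => x y; rewrite ipNl ipN ip_adj.
Qed.
Definition bopp T : bop E := Bop (bopp_subproof T).
Lemma bzero_subproof : exists U : E -> E, adjoint (fun _ : E => 0 : E) U.
Proof. by exists (fun=> 0); apply: ip_adjoint => x y; rewrite ip0 ip0l. Qed.
Definition bzero : bop E := Bop bzero_subproof.
Lemma bone_subproof : exists U : E -> E, adjoint (fun x : E => x) U.
Proof. by exists id; exact: ip_adjoint. Qed.
Definition bone : bop E := Bop bone_subproof.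
Lemma bmul_subproof T S : exists U : E -> E, adjoint (fun x => T (S x)) U.
Proof.
exists (fun x => badj S (badj T x)); apply: ip_adjoint => x y.
by rewrite !ip_adj.
Qed.
Definition bmul T S : bop E := Bop (bmul_subproof T S).
Lemma bscale_subproof (c : R[i]) T : exists U : E -> E, adjoint (fun x => c *: T x) U.
Proof.
exists (fun x => c^*%C *: badj T x); apply: ip_adjoint => x y.
by rewrite ipZl ipZ ip_adj.
Qed.
Definition bscale (c : R[i]) T : bop E := Bop (bscale_subproof c T).

HB.instance Definition _ := gen_eqMixin (bop E).
HB.instance Definition _ := gen_choiceMixin (bop E).

Lemma baddA : associative badd. Proof. by move=> T S U; apply: bop_eq => x; exact: addrA. Qed.
Lemma baddC : commutative badd. Proof. by move=> T S; apply: bop_eq => x; exact: addrC. Qed.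
Lemma badd0 : left_id bzero badd. Proof. by move=> T; apply: bop_eq => x; exact: add0r. Qed.
Lemma baddN : left_inverse bzero bopp badd.
Proof. by move=> T; apply: bop_eq => x; exact: addNr. Qed.
HB.instance Definition _ := GRing.isZmodule.Build (bop E) baddA baddC badd0 baddN.

Lemma bmulA : associative bmul. Proof. by move=> T S U; apply: bop_eq. Qed.
Lemma bmul1 : left_id bone bmul. Proof. by move=> T; apply: bop_eq. Qed.
Lemma bmulr1 : right_id bone bmul. Proof. by move=> T; apply: bop_eq. Qed.
Lemma bmulDl : left_distributive bmul badd. Proof. by move=> T S U; apply: bop_eq. Qed.
Lemma bmulDr : right_distributive bmul badd.
Proof. by move=> T S U; apply: bop_eq => x /=; rewrite bopD. Qed.
HB.instance Definition _ := GRing.Zmodule_isPzRing.Build (bop E)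
  bmulA bmul1 bmulr1 bmulDl bmulDr.

Lemma bscaleA a b T : bscale a (bscale b T) = bscale (a * b) T.
Proof. by apply: bop_eq => x /=; rewrite scalerA. Qed.
Lemma bscale1 : left_id 1 bscale. Proof. by move=> T; apply: bop_eq => x /=; rewrite scale1r. Qed.
Lemma bscaleDr : right_distributive bscale badd.
Proof. by move=> a T S; apply: bop_eq => x /=; rewrite scalerDr. Qed.
Lemma bscaleDl T : {morph bscale^~ T : a b / a + b >-> badd a b}.
Proof. by move=> a b; apply: bop_eq => x /=; rewrite scalerDl. Qed.
HB.instance Definition _ := GRing.Zmodule_isLmodule.Build R[i] (bop E)
  bscaleA bscale1 bscaleDr bscaleDl.

Lemma bDE T S x : (T + S) x = T x + S x. Proof. by []. Qed.
Lemma bNE T x : (- T) x = - T x. Proof. by []. Qed.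
Lemma bBE T S x : (T - S) x = T x - S x. Proof. by []. Qed.
Lemma bME T S x : (T * S) x = T (S x). Proof. by []. Qed.
Lemma b1E x : (1 : bop E) x = x. Proof. by []. Qed.
Lemma b0E x : (0 : bop E) x = 0. Proof. by []. Qed.
Lemma bZE c T x : (c *: T) x = c *: T x. Proof. by []. Qed.
Lemma bscaleAl c T S : c *: (T * S) = c *: T * S. Proof. exact: bop_eq. Qed.
Lemma bscaleAr c T S : c *: (T * S) = T * (c *: S).
Proof. by apply: bop_eq => x; rewrite -[LHS]/(c *: T (S x)) -bopZ. Qed.

Lemma badj_uniq T S : (forall x y, ip (T x) y = ip x (S y)) -> badj T = S.
Proof. by move=> h; apply: bop_eq => y; apply: ip_inj => x; rewrite -h ip_adj. Qed.
Lemma badjM T S : badj (T * S) = badj S * badj T.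
Proof. by apply: badj_uniq => x y; rewrite !bME !ip_adj. Qed.
Lemma badjD T S : badj (T + S) = badj T + badj S.
Proof. by apply: badj_uniq => x y; rewrite !bDE ipDl ipD !ip_adj. Qed.
Lemma badjN T : badj (- T) = - badj T.
Proof. by apply: badj_uniq => x y; rewrite !bNE ipNl ipN ip_adj. Qed.
Lemma badjZ c T : badj (c *: T) = c^*%C *: badj T.
Proof. by apply: badj_uniq => x y; rewrite !bZE ipZl ipZ ip_adj. Qed.
Lemma badj1 : badj 1 = 1. Proof. exact: badj_uniq. Qed.
Lemma badjK T : badj (badj T) = T.
Proof. by apply: badj_uniq => x y; rewrite ip_adjr. Qed.

Definition bnd T (c : R) := forall x, hnorm (T x) <= c * hnorm x.

Lemma bop_bounded T : exists2 c, 0 <= c & bnd T c.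
Proof. by have [S /adjoint_bounded] := bopP T. Qed.

Lemma bndD T S c d : bnd T c -> bnd S d -> bnd (T + S) (c + d).
Proof. by move=> hT hS x; rewrite mulrDl (le_trans (hnormD _ _))// lerD. Qed.
Lemma bndN T c : bnd T c -> bnd (- T) c.
Proof. by move=> hT x; rewrite bNE hnormN. Qed.
Lemma bndM T S c d : 0 <= c -> bnd T c -> bnd S d -> bnd (T * S) (c * d).
Proof. by move=> c0 hT hS x; rewrite -mulrA (le_trans (hT _))// ler_wpM2l. Qed.
Lemma bndZ T a c : bnd T c -> bnd (a *: T) (normc a * c).
Proof. by move=> hT x; rewrite bZE hnormZ -mulrA ler_wpM2l ?normc_ge0. Qed.
Lemma bnd_le T c d : c <= d -> bnd T c -> bnd T d.
Proof. by move=> cd hT x; rewrite (le_trans (hT x))// ler_wpM2r ?hnorm_ge0. Qed.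

Lemma bnd_adj T c : 0 <= c -> bnd T c -> bnd (badj T) c.
Proof.
move=> c0 hT y; have [->|n0] := eqVneq (hnorm (badj T y)) 0.
  by rewrite mulr_ge0 ?hnorm_ge0.
have p : 0 < hnorm (badj T y) by rewrite lt_def n0 hnorm_ge0.
rewrite -(ler_pM2r p) -expr2 hnorm_sqr -ip_adj.
rewrite (le_trans (Re_le_normc _))// (le_trans (cauchy_schwarz _ _))//.
by rewrite mulrAC ler_wpM2r ?hnorm_ge0// hT.
Qed.

(** Surjectivity of [T] and of its adjoint thus suffices for a right inverse in [bop], although the
    preimages are picked by choice. *)
Lemma inv_adjoint T (W W' : E -> E) : (forall x, T (W x) = x) ->
  (forall y, badj T (W' y) = y) -> adjoint W W'.
Proof.
by move=> h h'; apply: ip_adjoint => x y; rewrite -{1}(h' y) -ip_adj h.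
Qed.

(** A solution of T x = y is a fixed point of x |-> y - (T x - x), which contracts by [r]. *)
Lemma neumann_surj T r : 0 <= r < 1 -> bnd (T - 1) r -> forall y, exists x, T x = y.
Proof.
move=> r01 hT y; have [|x hx] := @hcontraction R E (fun x => y - (T x - x)) r r01.
  move=> u v.
  have -> : y - (T u - u) - (y - (T v - v)) = (T - 1) (v - u).
    rewrite bBE b1E bopB [- (y - _)]opprB [LHS]addrC addrA subrK !opprB.
    by rewrite [u - T u]addrC addrACA [- v + u]addrC.
  by rewrite (le_trans (hT _))// hdistC.
exists x; move/eqP: hx; rewrite subr_eq addrC subrK => /eqP -> //.
Qed.

Lemma neumann_inj T r x y : 0 <= r < 1 -> bnd (T - 1) r -> T x = T y -> x = y.
Proof.
move=> /andP[r0 r1] hT e; apply/eqP; rewrite -subr_eq0; apply/eqP/hnorm0_eq0.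
have := hT (x - y); rewrite bBE b1E bopB e subrr sub0r hnormN => h.
apply/eqP; rewrite eq_le hnorm_ge0 andbT leNgt; apply/negP => p.
by move: h; rewrite leNgt gtr_pMl// r1.
Qed.

(** The adjoint satisfies the same bound, so both operators are onto and [inv_adjoint] makes the
    right inverse adjointable; injectivity makes it two-sided. *)
Lemma neumann T r : 0 <= r < 1 -> bnd (T - 1) r -> exists S, T * S = 1 /\ S * T = 1.
Proof.
move=> r01 hT; have [/andP[r0 r1]] := (r01, I) => _.
have hT' : bnd (badj T - 1) r by rewrite -badj1 -badjN -badjD; exact: bnd_adj.
have s := neumann_surj r01 hT; have s' := neumann_surj r01 hT'.
have adj := inv_adjoint (fun x => svalP (cid (s x))) (fun x => svalP (cid (s' x))).
exists (Bop (ex_intro _ _ adj)); split; apply: bop_eq => x; rewrite bME b1E /=.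
  exact: (svalP (cid (s x))).
by apply: (neumann_inj r01 hT); exact: (svalP (cid (s (T x)))).
Qed.
End Ring.

(** * Compact operators and the index modulo compact operators *)

Section Compact.
Lemma compactOp_zero (X : topologicalType) (E : hilbMod R X) (f : E -> E) :
  (forall x, f x = 0) -> compactOp f.
Proof.
move=> h e e0; exists [::] => z c c0 _; rewrite big_nil subr0 h.
exact: norm_le0.
Qed.

Lemma rank1E (E F : hilbMod R pt) (x : F) (y z : E) : rank1 x y z = ip y z *: x.
Proof.
apply: ip_inj => w; rewrite /ip /rank1 hm_act_ip ?hm_ipZ//.
exact: hm_cont.
Qed.

Lemma compactOpP (E F : hilbMod R pt) (T : E -> F) : compactOp T <->
  forall e, 0 < e -> exists s : seq (F * E), forall z,
    hnorm (T z - \sum_(p <- s) ip p.2 z *: p.1) <= e * hnorm z.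
Proof.
split=> h e e0; have [s hs] := h e e0; exists s => z.
  under eq_bigr do rewrite -rank1E.
  by apply/norm_leE; [rewrite mulr_ge0 ?hnorm_ge0// ltW | exact: hs (hnorm_ge0 z) (norm_leW z)].
move=> c c0 /norm_leE => /(_ c0) zc; apply/norm_leE; first by rewrite mulr_ge0// ltW.
under eq_bigr do rewrite rank1E.
by rewrite (le_trans (hs z))// ler_pM2l.
Qed.

(** The rank one map x <y, .> becomes (U x) <V' y, .>, and boundedness of [U] and [V] preserves the
    approximation. *)
Lemma compactOp_comp (E F G H : hilbMod R pt) (V : E -> F) V' (T : F -> G) (U : G -> H) U' :
  adjoint V V' -> adjoint U U' -> compactOp T -> compactOp (fun x => U (T (V x))).
Proof.
move=> hV hU /compactOpP hT; apply/compactOpP => e e0.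
have [c c0 hc] := adjoint_bounded hV; have [d d0 hd] := adjoint_bounded hU.
have cd : 0 < c * d + 1 by rewrite ltr_wpDl// mulr_ge0.
have [s hs] := hT (e / (c * d + 1)) (divr_gt0 e0 cd).
exists [seq (U p.1, V' p.2) | p <- s] => z.
have -> : U (T (V z)) - \sum_(p <- [seq (U p.1, V' p.2) | p <- s]) ip p.2 z *: p.1 =
    U (T (V z) - \sum_(p <- s) ip p.2 (V z) *: p.1).
  rewrite (adjointD _ _ hU) (adjointN _ hU); congr (_ - _).
  have U0 : U 0 = 0 by apply: (addrI (U 0)); rewrite -(adjointD _ _ hU) !addr0.
  rewrite big_map (big_morph U (fun x y => adjointD x y hU) U0); apply: eq_bigr => p _ /=.
  apply: ip_inj => w; rewrite -(adjointP (adjoint_sym hU)) !ipZ.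
  by rewrite (adjointP (adjoint_sym hU)) (adjointP (adjoint_sym hV)).
rewrite (le_trans (hd _))// (le_trans (ler_wpM2l d0 (hs _)))//.
rewrite (le_trans (ler_wpM2l d0 (ler_wpM2l _ (hc z))))//; first by rewrite divr_ge0 ?ltW.
have -> : d * (e / (c * d + 1) * (c * hnorm z)) = e * (c * d / (c * d + 1)) * hnorm z.
  by field; rewrite gt_eqF.
rewrite ler_wpM2r ?hnorm_ge0// ler_piMr ?(ltW e0)// ler_pdivrMr// mul1r.
by rewrite lerDl.
Qed.

Lemma compactOpD (E F : hilbMod R pt) (T S : E -> F) :
  compactOp T -> compactOp S -> compactOp (fun x => T x + S x).
Proof.
move=> /compactOpP hT /compactOpP hS; apply/compactOpP => e e0.
have e2 : 0 < e / 2 by rewrite divr_gt0.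
have [s hs] := hT _ e2; have [s' hs'] := hS _ e2.
exists (s ++ s') => z; rewrite big_cat opprD addrACA (le_trans (hnormD _ _))//.
by rewrite [e]splitr mulrDl lerD.
Qed.

Variable E : hilbMod R pt.
Implicit Types (T S U K : bop E).

Lemma cpt0 : compactOp (0 : bop E).
Proof. exact: compactOp_zero. Qed.
Lemma cptD T S : compactOp T -> compactOp S -> compactOp (T + S).
Proof. exact: compactOpD. Qed.
Lemma cptN T : compactOp T -> compactOp (- T).
Proof. exact: compactOpN. Qed.
Lemma cptB T S : compactOp T -> compactOp S -> compactOp (T - S).
Proof. by move=> hT hS; apply: cptD => //; exact: cptN. Qed.
Lemma cptMl T S : compactOp T -> compactOp (S * T).
Proof.
have [S' hS'] := bopP S.
by apply: (@compactOp_comp _ _ _ _ id id T S) => //; exact: hS'.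
Qed.
Lemma cptMr T S : compactOp T -> compactOp (T * S).
Proof.
have [S' hS'] := bopP S.
by apply: (@compactOp_comp _ _ _ _ S S' T id id) => //; exact: hS'.
Qed.
Lemma cptZ c T : compactOp T -> compactOp (c *: T).
Proof.
move=> h; have -> : c *: T = (c *: (1 : bop E) : bop E) * T by rewrite -bscaleAl mul1r.
exact: cptMl.
Qed.

Lemma bfinrank_subproof (s : seq (E * E)) :
  exists U : E -> E, adjoint (fun z : E => \sum_(p <- s) ip p.2 z *: p.1) U.
Proof.
exists (fun z => \sum_(p <- s) ip p.1 z *: p.2); apply: ip_adjoint => x y.
elim: s => [|p s IH]; rewrite ?big_nil ?ip0 ?ip0l// !big_cons ipDl ipD IH; congr (_ + _).
by rewrite ipZl ipZ mulrC -ipC.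
Qed.
Definition bfinrank s : bop E := Bop (bfinrank_subproof s).

Lemma cpt_bfinrank s : compactOp (bfinrank s).
Proof.
apply/compactOpP => e e0; exists s => z.
by rewrite subrr hnorm0 mulr_ge0 ?hnorm_ge0// ltW.
Qed.

(** Equality in the Calkin algebra, kept as a congruence on [bop]. *)
Definition ceq T S := compactOp (T - S).

Lemma ceq_refl T : ceq T T. Proof. by rewrite /ceq subrr; exact: cpt0. Qed.
Lemma ceq_sym T S : ceq T S -> ceq S T.
Proof. by rewrite /ceq => /cptN; rewrite opprB. Qed.
Lemma ceq_trans S T U : ceq T S -> ceq S U -> ceq T U.
Proof.
rewrite /ceq => h k; have -> : T - U = (T - S) + (S - U) by rewrite addrA subrK.
exact: cptD.
Qed.
Lemma ceqD T T' S S' : ceq T T' -> ceq S S' -> ceq (T + S) (T' + S').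
Proof. by rewrite /ceq opprD addrACA; exact: cptD. Qed.
Lemma ceqN T T' : ceq T T' -> ceq (- T) (- T').
Proof. by rewrite /ceq -opprD; exact: cptN. Qed.
Lemma ceqB T T' S S' : ceq T T' -> ceq S S' -> ceq (T - S) (T' - S').
Proof. by move=> h k; apply: ceqD => //; exact: ceqN. Qed.
Lemma ceqM T T' S S' : ceq T T' -> ceq S S' -> ceq (T * S) (T' * S').
Proof.
rewrite /ceq => h k; have -> : T * S - T' * S' = (T - T') * S + T' * (S - S').
  by rewrite mulrBl mulrBr addrA subrK.
by apply: cptD; [exact: cptMr | exact: cptMl].
Qed.
Lemma ceqZ c T T' : ceq T T' -> ceq (c *: T) (c *: T').
Proof. by rewrite /ceq -scalerBr; exact: cptZ. Qed.
Lemma ceqMl T S S' : ceq S S' -> ceq (T * S) (T * S').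
Proof. by apply: ceqM; exact: ceq_refl. Qed.
Lemma ceqMr T S S' : ceq S S' -> ceq (S * T) (S' * T).
Proof. by move=> h; apply: ceqM => //; exact: ceq_refl. Qed.

Definition idx T (k : int) := has_index T [set: E] [set: E] k.

Lemma idx_uniq T k l : idx T k -> idx T l -> k = l.
Proof. by apply: has_index_uniq; exact: bop_lin. Qed.

Lemma idxM T S k l : idx T k -> idx S l -> idx (T * S) (k + l).
Proof. by apply: (has_index_comp (T := T) (S := S)); exact: bop_lin. Qed.

Lemma idx_inv T S : T * S = 1 -> S * T = 1 -> idx T 0.
Proof.
move=> TS ST; apply: (has_index_bij (S := S)); first exact: bop_lin.
  by move=> x; rewrite -bME ST.
by move=> x; rewrite -bME TS.
Qed.

Lemma idx_finrank s : idx (1 + bfinrank s) 0.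
Proof.
apply: (@has_index_finite_rank _ _ _ [seq p.1 | p <- s]); first exact: (bop_lin (bfinrank s)).
move=> x; exists (fun i => ip (nth (0, 0) s i).2 x) => /=.
rewrite (big_nth (0, 0)) big_mkord size_map.
by apply: eq_bigr => i _; rewrite (nth_map (0, 0)).
Qed.

(** A finite-rank approximation of [K] within (1 - r)/2 leaves V = T minus that operator at distance
    below 1 from 1, hence invertible. Then T = V (1 + finite rank), and both factors have index
    0. *)
Lemma idx_compact_small T K r : compactOp K -> 0 <= r < 1 -> bnd (T - K - 1) r -> idx T 0.
Proof.
move=> /compactOpP hK /andP[r0 r1] hT.
have e0 : 0 < (1 - r) / 2 by rewrite divr_gt0 ?subr_gt0.
have [s hs] := hK _ e0.
pose V := T - bfinrank s.
have hV : bnd (V - 1) (r + (1 - r) / 2).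
  have -> : V - 1 = (T - K - 1) + (K - bfinrank s).
    by rewrite /V [T - K - 1]addrAC subrKA [RHS]addrAC.
  by apply: bndD => // z; exact: hs.
have [|W [VW WV]] := neumann _ hV; first by apply/andP; split; lra.
have -> : T = V * (1 + bfinrank [seq (W p.1, p.2) | p <- s]).
  have -> : bfinrank [seq (W p.1, p.2) | p <- s] = W * bfinrank s.
    apply: bop_eq => x; rewrite bME /= big_map bop_sum.
    by apply: eq_bigr => p _; rewrite bopZ.
  by rewrite mulrDr mulr1 mulrA VW mul1r subrK.
rewrite -(addr0 0); exact: idxM (idx_inv VW WV) (idx_finrank _).
Qed.

Lemma idx_ceq1 T : ceq T 1 -> idx T 0.
Proof.
move=> h; apply: (idx_compact_small (r := 0) h); first by rewrite lexx ltr01.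
by move=> x; rewrite opprB subrKC subrr hnorm0 mul0r.
Qed.

(** Both products have index 0, being 1 modulo compacts. [has_index_factor] gives each factor a
    finite index, and additivity makes the two indices opposite. *)
Lemma idx_parametrix T S : ceq (T * S) 1 -> ceq (S * T) 1 -> exists k, idx T k /\ idx S (- k).
Proof.
move=> TS ST.
have hT := bop_lin T; have hS := bop_lin S.
have [k hk] := has_index_factor hT hS hS (idx_ceq1 ST) (idx_ceq1 TS).
have [l hl] := has_index_factor hS hT hT (idx_ceq1 TS) (idx_ceq1 ST).
exists k; split=> //.
have -> : - k = l by apply/eqP; rewrite eq_sym -addr_eq0 addrC; apply/eqP/(idx_uniq (idxM hk hl))/idx_ceq1.
exact: hl.
Qed.

(** The product [S * T'] has index 0 and [S] has the index opposite to that of [T]. Compact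
    perturbations (r = 0) and small perturbations in norm are both instances. *)
Lemma idx_stable T S T' K r k k' : ceq (T * S) 1 -> ceq (S * T) 1 ->
  compactOp K -> 0 <= r < 1 -> bnd (S * T' - K - 1) r ->
  idx T k -> idx T' k' -> k' = k.
Proof.
move=> TS ST hK r01 hST hk hk'; have [l [hl hl']] := idx_parametrix TS ST.
have h0 := idx_compact_small hK r01 hST.
have := idx_uniq (idxM hl' hk') h0; rewrite (idx_uniq hk hl) => /eqP.
by rewrite addrC subr_eq0 => /eqP.
Qed.

Lemma idx_ceq T S T' k : ceq (T * S) 1 -> ceq (S * T) 1 -> ceq T' T ->
  idx T k -> idx T' k.
Proof.
move=> TS ST hT hk.
have TS' : ceq (T' * S) 1 by apply: ceq_trans TS; exact: ceqMr.
have ST' : ceq (S * T') 1 by apply: ceq_trans ST; exact: ceqMl.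
have [k' [hk' _]] := idx_parametrix TS' ST'.
have -> // : k = k'; apply/esym/(idx_stable (T' := T') (r := 0) TS ST ST') => //.
  by rewrite lexx ltr01.
by move=> x; rewrite opprB subrKC subrr hnorm0 mul0r.
Qed.
End Compact.

End Operators.

(** * Toeplitz compressions and amplifications *)

Section Toeplitz.
Variables (R : realType) (E : hilbMod R pt) (p : bop E).
Hypothesis hp : ceq (p * p) p.
Implicit Types v w : bop E.

(** The corner of [v] at [p], completed by the identity on the complement; [p] is idempotent only
    modulo compacts. *)
Definition toeplitz v : bop E := p * v * p + 1 - p.

Lemma toeplitz_simpl v : ceq (p * v) (v * p) -> ceq (toeplitz v) (v * p + (1 - p)).
Proof.
move=> hv; rewrite /toeplitz -addrA; apply: ceqD; last exact: ceq_refl.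
apply: ceq_trans (ceqMr _ hv) _.
by rewrite -mulrA; exact: ceqMl.
Qed.

(** Since [p] commutes with both symbols modulo compacts, each compression is v p + (1 - p) there,
    and the mixed terms of the product are compact. *)
Lemma toeplitzM v w : ceq (p * v) (v * p) -> ceq (p * w) (w * p) ->
  ceq (toeplitz v * toeplitz w) (toeplitz (v * w)).
Proof.
move=> hv hw; have hvw : ceq (p * (v * w)) (v * w * p).
  by apply: (@ceq_trans _ _ (v * p * w)); [rewrite mulrA; exact: ceqMr | rewrite -!mulrA; exact: ceqMl].
apply: ceq_trans (ceqM (toeplitz_simpl hv) (toeplitz_simpl hw)) _.
apply: ceq_trans (ceq_sym (toeplitz_simpl hvw)).
have ex (a b c : bop E) : (a + c) * (b + c) = a * b + (a * c + (c * b + c * c)).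
  by rewrite mulrDl !mulrDr -addrA.
set q := 1 - p; rewrite ex; apply: ceqD.
  rewrite -!mulrA; apply: ceqMl; rewrite mulrA.
  apply: ceq_trans (ceqMr _ hw) _; rewrite -mulrA; exact: ceqMl.
have h0 : ceq (v * p * q) 0.
  rewrite /q mulrBr mulr1 -mulrA -(subrr (v * p)).
  by apply: ceqB; [exact: ceq_refl | exact: ceqMl].
have h1 : ceq (q * (w * p)) 0.
  rewrite /q mulrBl mul1r -(subrr (w * p)); apply: ceqB; first exact: ceq_refl.
  by rewrite mulrA; apply: ceq_trans (ceqMr _ hw) _; rewrite -mulrA; exact: ceqMl.
have h2 : ceq (q * q) q.
  rewrite /q mulrBr mulr1 -[X in ceq _ X]subr0; apply: ceqB; first exact: ceq_refl.
  by rewrite mulrBl mul1r -(subrr p); apply: ceqB => //; exact: ceq_refl.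
by have := ceqD h0 (ceqD h1 h2); rewrite !add0r.
Qed.

Lemma toeplitz1 : ceq (toeplitz 1) 1.
Proof.
rewrite /toeplitz mulr1 -addrA; apply: (@ceq_trans _ _ (p + (1 - p))).
  by apply: ceqD => //; exact: ceq_refl.
by rewrite addrC subrK; exact: ceq_refl.
Qed.
End Toeplitz.

(** * Finite powers of a Hilbert space and operator matrices *)

Section Amplification.
Variables (R : realType) (M : hilbMod R pt).
Local Open Scope complex_scope.

Section Ampl.
Variable n : nat.
Local Notation MM := {ffun 'I_n -> M}.
Implicit Types x y z : MM.

Definition hampl_act (f : pt -> R[i]) x : MM := [ffun i => hm_act f (x i)].
Definition hampl_ip x y (t : pt) : R[i] := \sum_(i < n) hm_ip (x i) (y i) t.

Lemma hampl_cont x y : continuous (hampl_ip x y : pt -> R[i]^o).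
Proof.
rewrite (_ : hampl_ip x y = \sum_(i < n) (hm_ip (x i) (y i) : pt -> R[i]^o)); last first.
  by apply/funext => t; rewrite fct_sumE.
elim/big_rec: _ => [|i f _ hf] t; first exact: cvg_cst.
by apply: cvgD; [exact: hm_cont | exact: hf].
Qed.
Lemma hampl_ipD x y z t : hampl_ip x (y + z) t = hampl_ip x y t + hampl_ip x z t.
Proof. by rewrite -big_split /=; apply: eq_bigr => i _; rewrite ffunE hm_ipD. Qed.
Lemma hampl_ipZ x (c : R[i]) y t : hampl_ip x (c *: y) t = c * hampl_ip x y t.
Proof. by rewrite mulr_sumr; apply: eq_bigr => i _; rewrite ffunE hm_ipZ. Qed.
Lemma hampl_ipC x y t : hampl_ip y x t = Num.conj (hampl_ip x y t).
Proof. by rewrite rmorph_sum; apply: eq_bigr => i _; rewrite hm_ipC. Qed.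
Lemma hampl_act_ip x (f : pt -> R[i]) y t : continuous (f : pt -> R[i]^o) ->
  hampl_ip x (hampl_act f y) t = f t * hampl_ip x y t.
Proof.
by move=> cf; rewrite mulr_sumr; apply: eq_bigr => i _; rewrite ffunE hm_act_ip.
Qed.
Lemma hampl_ip_ge0 x t : 0 <= hampl_ip x x t.
Proof. by apply: sumr_ge0 => i _; exact: hm_ip_ge0. Qed.
Lemma hampl_ip_eq0 x : (forall t, hampl_ip x x t = 0) -> x = 0.
Proof.
move=> h; apply/ffunP => i; rewrite ffunE; apply: hm_ip_eq0 => t.
have /eqP := h t; rewrite psumr_eq0 => [/allP /(_ i)|j _]; last exact: hm_ip_ge0.
by rewrite mem_index_enum => /(_ isT)/= /eqP.
Qed.

Lemma hampl_le_coord x (c : R) i :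
  (forall t, hampl_ip x x t <= (c ^+ 2)%:C) -> norm_le (x i) c.
Proof.
move=> h t; apply: le_trans (h t); rewrite /hampl_ip (bigD1 i)//= lerDl.
by apply: sumr_ge0 => j _; exact: hm_ip_ge0.
Qed.

Lemma hampl_le x (c : R) : 0 <= c -> (forall i, hnorm (x i) <= c / n%:R) ->
  forall t, hampl_ip x x t <= (c ^+ 2)%:C.
Proof.
move=> c0 h []; have -> : hampl_ip x x tt = (\sum_(i < n) hnorm (x i) ^+ 2)%:C.
  by rewrite rmorph_sum; apply: eq_bigr => i _; rewrite -[LHS]/(ip (x i) (x i)) ipxxE.
have [n0|n0] := posnP n.
  by rewrite big1 ?lecR ?exprn_ge0// => i; have := ltn_ord i; rewrite [X in (_ < X)%N]n0.
have nR : 0 < n%:R :> R by rewrite ltr0n.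
rewrite lecR (@le_trans _ _ (\sum_(i < n) (c / n%:R) ^+ 2))//.
  by apply: ler_sum => i _; rewrite ler_pXn2r ?nnegrE ?hnorm_ge0 ?divr_ge0.
have -> : \sum_(i < n) (c / n%:R) ^+ 2 = c ^+ 2 * n%:R^-1.
  by rewrite sumr_const card_ord -mulr_natr; field; rewrite gt_eqF.
by rewrite ler_piMr ?exprn_ge0// invf_le1// ler1n.
Qed.

Lemma hampl_complete (a : nat -> MM) :
  (forall e : R, 0 < e -> exists N : nat, forall m k : nat,
     (N <= m)%N -> (N <= k)%N ->
     forall t, hampl_ip (a m - a k) (a m - a k) t <= (e ^+ 2)%:C) ->
  exists l : MM, forall e : R, 0 < e -> exists N : nat, forall k : nat,
    (N <= k)%N -> forall t, hampl_ip (a k - l) (a k - l) t <= (e ^+ 2)%:C.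
Proof.
move=> h.
have hi i : exists l : M, forall e : R, 0 < e -> exists N : nat, forall k,
    (N <= k)%N -> hnorm (a k i - l) <= e.
  apply: hcomplete => e e0; have [N hN] := h e e0; exists N => m k hm hk.
  have := hampl_le_coord i (hN m k hm hk).
  by rewrite !ffunE => /norm_leE; apply; exact: ltW.
exists [ffun i => sval (cid (hi i))] => e e0.
have en (i : 'I_n) : 0 < e / n%:R.
  by rewrite divr_gt0// ltr0n; exact: leq_ltn_trans (ltn_ord i).
pose N i := sval (cid (svalP (cid (hi i)) _ (en i))).
have hN i := svalP (cid (svalP (cid (hi i)) _ (en i))).
exists (\max_i N i)%N => k hk; apply: hampl_le; first exact: ltW.
move=> i; rewrite !ffunE; apply: hN; apply: leq_trans hk.
exact: (leq_bigmax i).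
Qed.

(** The carrier is [{ffun 'I_n -> M}], the very space on which [index1] is computed, so the theory
    of [bop] applies to the pairing directly. *)
Definition hampl : hilbMod R pt := @HilbMod R pt MM hampl_act hampl_ip
  hampl_cont hampl_ipD hampl_ipZ hampl_ipC hampl_act_ip hampl_ip_ge0 hampl_ip_eq0
  hampl_complete.

Lemma ip_hampl (x y : hampl) : ip x y = \sum_(i < n) ip (x i) (y i).
Proof. by []. Qed.

Definition hinj (i : 'I_n) (x : M) : hampl := [ffun j => if j == i then x else 0].
Definition hproj (i : 'I_n) (x : hampl) : M := x i.

Lemma hinj_adjoint i : adjoint (hinj i) (hproj i).
Proof.
apply: ip_adjoint => x y; rewrite ip_hampl (bigD1 i)//= ffunE eqxx big1 ?addr0// => j ji.
by rewrite ffunE (negbTE ji) ip0l.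
Qed.

Lemma hinj_sum (x : hampl) : x = \sum_(i < n) hinj i (x i).
Proof.
apply/ffunP => j; rewrite sum_ffunE (bigD1 j)//= ffunE eqxx big1 ?addr0// => i ij.
by rewrite ffunE eq_sym (negbTE ij).
Qed.

Lemma hnorm_inj i (x : M) : hnorm (hinj i x) = hnorm x.
Proof.
rewrite /hnorm ip_hampl (bigD1 i)//= ffunE eqxx big1 ?addr0// => j ji.
by rewrite ffunE (negbTE ji) ip0.
Qed.

Lemma hnorm_coord (x : hampl) i : hnorm (x i) <= hnorm x.
Proof.
by apply/norm_leE; [exact: hnorm_ge0 | apply: hampl_le_coord; exact: norm_leW].
Qed.

Lemma hnorm_ampl_sum (x : hampl) : hnorm x <= \sum_(i < n) hnorm (x i).
Proof.
rewrite {1}[x]hinj_sum (le_trans (hnorm_sum _ _))//.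
by apply: ler_sum => i _; rewrite hnorm_inj.
Qed.

Definition mop_fun (K : 'M[bop M]_n) (x : hampl) : hampl :=
  [ffun i => \sum_(j < n) K i j (x j)].
Lemma mop_subproof K : exists S : hampl -> hampl, adjoint (mop_fun K) S.
Proof.
exists (mop_fun (\matrix_(i, j) badj (K j i))); apply: ip_adjoint => x y.
rewrite !ip_hampl.
transitivity (\sum_(i < n) \sum_(j < n) ip (K i j (x j)) (y i)).
  apply: eq_bigr => i _; rewrite ffunE.
  rewrite (big_morph (fun u => ip u (y i)) (id1 := 0) (op1 := +%R))//.
    by move=> u v; exact: ipDl.
  exact: ip0l.
rewrite exchange_big; apply: eq_bigr => j _; rewrite ffunE.
rewrite (big_morph (fun u => ip (x j) u) (id1 := 0) (op1 := +%R)).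
- by apply: eq_bigr => i _; rewrite mxE ip_adj.
- by move=> u v; exact: ipD.
- exact: ip0.
Qed.
Definition mop K : bop hampl := Bop (mop_subproof K).

Lemma mopE K x i : mop K x i = \sum_(j < n) K i j (x j). Proof. exact: ffunE. Qed.

Lemma bop_sumE I (s : seq I) (F : I -> bop M) (x : M) :
  (\sum_(i <- s) F i) x = \sum_(i <- s) F i x.
Proof. by rewrite (big_morph (fun T : bop M => T x) (id1 := 0) (op1 := +%R)). Qed.

Lemma hamplDE (x y : hampl) i : (x + y) i = x i + y i. Proof. exact: ffunE. Qed.
Lemma hamplNE (x : hampl) i : (- x) i = - x i. Proof. exact: ffunE. Qed.

Lemma mopD K L : mop (K + L) = mop K + mop L.
Proof.
apply: bop_eq => x; apply/ffunP => i; rewrite bDE hamplDE !mopE -big_split /=.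
by apply: eq_bigr => j _; rewrite mxE.
Qed.
Lemma mopN K : mop (- K) = - mop K.
Proof.
apply: bop_eq => x; apply/ffunP => i; rewrite bNE hamplNE !mopE -sumrN.
by apply: eq_bigr => j _; rewrite mxE.
Qed.
Lemma mopB K L : mop (K - L) = mop K - mop L.
Proof. by rewrite mopD mopN. Qed.
Lemma mopM K L : mop (K *m L) = mop K * mop L.
Proof.
apply: bop_eq => x; apply/ffunP => i; rewrite bME !mopE.
under eq_bigr do rewrite mxE bop_sumE.
rewrite exchange_big; apply: eq_bigr => j _ /=.
by rewrite mopE bop_sum.
Qed.
Lemma mop1 : mop 1%:M = 1.
Proof.
apply: bop_eq => x; apply/ffunP => i; rewrite b1E mopE (bigD1 i)//= mxE eqxx.
by rewrite big1 ?addr0// => j ji; rewrite mxE eq_sym (negbTE ji).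
Qed.

(** An operator matrix is a finite sum of its entries composed with adjointable injections and
    projections, which reduces compactness to the entries. *)
Lemma mop_sum K x : mop K x = \sum_(i < n) \sum_(j < n) hinj i (K i j (hproj j x)).
Proof.
rewrite [LHS]hinj_sum; apply: eq_bigr => i _; rewrite mopE.
apply: (big_morph (hinj i)) => [u v|]; first exact: adjointD (hinj_adjoint i).
by apply/ffunP => j; rewrite !ffunE; case: ifP.
Qed.

Lemma compactOp_sum (E F : hilbMod R pt) (I : Type) (s : seq I) (T : I -> E -> F) :
  (forall i, compactOp (T i)) -> compactOp (fun x : E => \sum_(i <- s) T i x).
Proof.
move=> hT; elim: s => [|i s IH].
  apply/compactOpP => e e0; exists [::] => z.
  by rewrite !big_nil subr0 hnorm0 mulr_ge0 ?hnorm_ge0// ltW.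
rewrite (_ : (fun x : E => _) = (fun x : E => T i x + \sum_(j <- s) T j x)).
  exact: compactOpD.
by apply/funext => x; rewrite big_cons.
Qed.

Lemma cpt_mop (K : 'M[bop M]_n) : (forall i j, compactOp (K i j)) -> compactOp (mop K).
Proof.
move=> hK; rewrite (_ : bfun _ = (fun x : hampl => \sum_(i < n) \sum_(j < n) hinj i (K i j (hproj j x)))).
  apply: compactOp_sum => i; apply: compactOp_sum => j.
  exact: compactOp_comp (adjoint_sym (hinj_adjoint j)) (hinj_adjoint i) (hK i j).
by apply/funext => x; rewrite mop_sum.
Qed.

Lemma ceq_mop (K L : 'M[bop M]_n) : (forall i j, ceq (K i j) (L i j)) -> ceq (mop K) (mop L).
Proof.
by move=> h; rewrite /ceq -mopB; apply: cpt_mop => i j; rewrite !mxE; exact: h.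
Qed.

Lemma bnd_mop (K : 'M[bop M]_n) (c : R) : (forall i j, bnd (K i j) c) ->
  0 <= c -> bnd (mop K) ((n * n)%:R * c).
Proof.
move=> hK c0 x; rewrite (le_trans (hnorm_ampl_sum _))//.
rewrite (@le_trans _ _ (\sum_(i < n) \sum_(j < n) c * hnorm (x : hampl)))//.
  apply: ler_sum => i _; rewrite mopE (le_trans (hnorm_sum _ _))//.
  apply: ler_sum => j _; rewrite (le_trans (hK _ _ _))//.
  by rewrite ler_wpM2l// hnorm_coord.
by rewrite !sumr_const card_ord -mulrnA -mulrA [leRHS]mulr_natl.
Qed.
End Ampl.
End Amplification.

(** * The unit interval *)

Section Seg.
Variables (R : realType).
Local Notation normc := Normc.normc.
Local Open Scope complex_scope.

Lemma seg_nearP (a b : R) (x : seg a b) (P : set (seg a b)) :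
  (\forall y \near x, P y) <->
  exists2 d : R, 0 < d & forall y : seg a b, `|val y - val x| < d -> P y.
Proof.
split=> [|[d d0 h]].
  move=> [U [[V oV <-] Ox OP]].
  have /nbhs_ballP [d /= d0 hd] : nbhs (val x : R) V by apply: open_nbhs_nbhs; split.
  exists d => // y yx; apply: OP => /=; apply: hd.
  by rewrite /ball /= distrC.
have c : {for x, continuous (fun t : seg a b => val t : R)} by exact: initial_continuous.
move/cvgrPdist_lt : c => /(_ _ d0); apply: filterS => y hy; apply: h.
by rewrite distrC.
Qed.

Lemma clamp_subproof (r : R) : 0 <= Num.min 1 (Num.max 0 r) <= 1.
Proof. by rewrite le_min ler01 le_max lexx /= ge_min lexx. Qed.
(** A retraction of the line onto the segment type: through it, compactness and connectedness of the
    interval as a set of reals become available for [seg01 R]. *)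
Definition clamp (r : R) : seg01 R := segpt (clamp_subproof r).

Lemma clampK (t : seg01 R) : clamp (val t) = t.
Proof.
apply: val_inj => /=; have := valP t; rewrite inE/= in_itv/= => /andP[t0 t1].
by rewrite max_r// min_r.
Qed.

Lemma max0_dist (x y : R) : `|Num.max 0 x - Num.max 0 y| <= `|x - y|.
Proof.
have [x0|x0] := lerP x 0; have [y0|y0] := lerP y 0; rewrite ?subrr ?normr0//.
- by rewrite sub0r normrN gtr0_norm// distrC ger0_norm; lra.
- by rewrite subr0 gtr0_norm// ger0_norm; lra.
Qed.

Lemma continuousRP (X : topologicalType) (f : X -> R) :
  (forall x e, 0 < e -> \forall y \near x, `|f y - f x| < e) -> continuous f.
Proof.
move=> h x; apply/cvgrPdist_lt => e e0; have := h x e e0.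
by apply: filterS => y; rewrite distrC.
Qed.

Lemma continuousR_sum (X : topologicalType) I (s : seq I) (f : I -> X -> R) :
  (forall i, continuous (f i)) -> continuous (fun x => \sum_(i <- s) f i x).
Proof.
move=> cf; elim: s => [|i s IH] x.
  rewrite (_ : (fun x => _) = (fun=> 0)); first exact: cvg_cst.
  by apply/funext => y; rewrite big_nil.
rewrite (_ : (fun x => _) = (fun x => f i x + \sum_(j <- s) f j x)).
  by apply: cvgD; [exact: cf | exact: IH].
by apply/funext => y; rewrite big_cons.
Qed.

Lemma continuousR_div (X : topologicalType) (f g : X -> R) : (forall x, g x != 0) ->
  continuous f -> continuous g -> continuous (fun x => f x / g x).
Proof. by move=> g0 cf cg x; apply: cvgM; [exact: cf | apply: cvgV => //; exact: cg]. Qed.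

Lemma seg_lipschitz_continuous (a b : R) (g : seg a b -> R) :
  (forall s t, `|g s - g t| <= `|val s - val t|) -> continuous g.
Proof.
move=> h; apply: continuousRP => t e e0; apply/seg_nearP; exists e => // s st.
exact: le_lt_trans st.
Qed.

Lemma clamp_dist (r s : R) : `|val (clamp r) - val (clamp s)| <= `|r - s|.
Proof.
have k x y : `|Num.min 1 x - Num.min 1 y| <= `|x - y| :> R.
  have [x0|x0] := lerP 1 x; have [y0|y0] := lerP 1 y; rewrite ?subrr ?normr0//.
  - by rewrite ger0_norm ?ger0_norm; lra.
  - by rewrite distrC [leRHS]distrC ger0_norm ?ger0_norm; lra.
exact: le_trans (k _ _) (max0_dist _ _).
Qed.

Lemma clamp0 : clamp 0 = seg0 R.
Proof. by rewrite -[RHS]clampK. Qed.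
Lemma clamp1 : clamp 1 = seg1 R.
Proof. by rewrite -[RHS]clampK. Qed.

(** The set of parameters where [f] takes its initial value is open and closed, and the interval is
    connected. *)
Lemma seg01_locally_constant (T : Type) (f : seg01 R -> T) :
  (forall t : seg01 R, exists2 d : R, 0 < d &
    forall s : seg01 R, `|val s - val t| < d -> f s = f t) ->
  f (seg0 R) = f (seg1 R).
Proof.
move=> h; pose U := [set r : R | f (clamp r) = f (seg0 R)].
have hU r : exists2 d : R, 0 < d & forall s, ball r d s -> f (clamp s) = f (clamp r).
  have [d d0 hd] := h (clamp r); exists d => // s rs; apply: hd.
  by apply: le_lt_trans (clamp_dist _ _) _; rewrite distrC.
have oU : open U.
  rewrite openE => r Ur; have [d d0 hd] := hU r; apply/nbhs_ballP; exists d => // s /hd.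
  by rewrite /U /= => ->.
have cU : closed U.
  rewrite -[U]setCK; apply: open_closedC; rewrite openE => r Ur.
  have [d d0 hd] := hU r; apply/nbhs_ballP; exists d => // s /hd.
  by rewrite /U /= => ->.
have : `[0, 1]%classic `&` U = `[0, 1]%classic.
  apply: segment_connected.
  - by exists 0; split; [rewrite /= in_itv/= lexx ler01 | rewrite /U/= clamp0].
  - by exists U.
  - by exists U.
move/seteqP => [_ /(_ 1)] []; first by rewrite /= in_itv/= lexx ler01.
by move=> _; rewrite /U/= clamp1.
Qed.

Lemma continuousCP (X : topologicalType) (f : X -> R[i]) :
  continuous (f : X -> R[i]^o) <->
  forall x e, 0 < e -> \forall y \near x, normc (f y - f x) < e.
Proof.
have hn (u v : R[i]^o) : `|u - v| = (normc (v - u : R[i]))%:C.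
  by rewrite distrC; change (`|(v - u : R[i])| = (normc (v - u))%:C); case: (v - u : R[i]).
split=> h x; last first.
  apply/cvgrPdist_lt => e; rewrite ltcE /= => /andP[/eqP e1 e0].
  have := h x _ e0; apply: filterS => y hy.
  by rewrite hn ltcE /= e1 eqxx.
move=> e e0; have /cvgrPdist_lt /(_ e%:C) := h x.
rewrite ltcR => /(_ e0); apply: filterS => y.
by rewrite hn ltcR.
Qed.

Lemma continuous_RtoC (X : topologicalType) (f : X -> R) :
  continuous f -> continuous ((fun x => (f x)%:C) : X -> R[i]^o).
Proof.
move=> h; apply/continuousCP => x e e0; have /cvgrPdist_lt /(_ e e0) := h x.
by apply: filterS => y; rewrite -RcB normcR distrC.
Qed.

(** A finite subcover by balls on which [f] varies by at most [e], with a subordinate partition of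
    unity. The weights are scalar functions and the coefficients fixed elements, the shape needed to
    approximate by compact operators over [0,1]. *)
Lemma partition_approx (A : cstarAlgType R) (f : seg01 R -> A) (e : R) :
  ccontinuous f -> 0 < e ->
  exists n (w : 'I_n -> seg01 R -> R[i]) (a : 'I_n -> A),
    [/\ forall i, continuous (w i : seg01 R -> R[i]^o),
      forall i t, normc (w i t) <= 1 &
      forall t, cnorm (f t - \sum_(i < n) w i t *: a i) <= e].
Proof.
move=> cf e0.
have hd r : exists d : R, 0 < d /\ forall s, ball r d s -> cnorm (f (clamp s) - f (clamp r)) <= e.
  have /seg_nearP [d d0 h] := cf (clamp r) e e0; exists d; split=> // s rs.
  by apply/ltW/h; apply: le_lt_trans (clamp_dist _ _) _; rewrite distrC.
pose d r := sval (cid (hd r)).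
have d0 r : 0 < d r by have [] := svalP (cid (hd r)).
have hf r s : ball r (d r) s -> cnorm (f (clamp s) - f (clamp r)) <= e.
  by have [_] := svalP (cid (hd r)); exact.
have := @segment_compact R 0 1; rewrite compact_cover.
move=> /(_ R setT (fun r => ball r (d r))) [].
- by move=> r _; exact: ball_open.
- by move=> r _; exists r => //; exact: ballxx.
move=> D _ hD.
(* Tent functions, positive exactly on the balls of the cover; dividing by their sum [S] yields the
   partition of unity. *)
pose h (r : R) (t : seg01 R) : R := Num.max 0 (d r - `|val t - r|).
have h0 r t : 0 <= h r t by rewrite le_max lexx.
have ch r : continuous (h r).
  apply: seg_lipschitz_continuous => s t; apply: (le_trans (max0_dist _ _)).
  rewrite opprB addrC addrA subrK; apply: (le_trans (ler_dist_dist _ _)).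
  by rewrite opprB addrA subrK distrC.
have hpos r t : 0 < h r t -> ball r (d r) (val t).
  by rewrite /h /ball /= lt_max ltxx /= subr_gt0 distrC.
pose s := finmap.enum_fset D; pose S t := \sum_(r <- s) h r t.
have S0 t : 0 < S t.
  have [|r rD rt] := hD (val t).
    by have := valP t; rewrite inE.
  have rs : r \in s by exact: rD.
  rewrite /S (big_rem r rs)/= ltr_pwDl//; last by apply: sumr_ge0 => ? _.
  by rewrite /h lt_max subr_gt0; apply/orP; right; move: rt; rewrite /ball /= distrC.
have cS : continuous S.
  exact: continuousR_sum.
exists (size s), (fun i t => (h s`_i t / S t)%:C), (fun i => f (clamp s`_i)); split.
  move=> i; apply: continuous_RtoC; apply: continuousR_div => //.
  by move=> t; rewrite gt_eqF.
  move=> i t; rewrite normcR ger0_norm; last by rewrite divr_ge0// ltW.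
  rewrite ler_pdivrMr// mul1r /S (big_rem _ (mem_nth 0 (ltn_ord i)))/= lerDl.
  by apply: sumr_ge0 => ? _.
move=> t; rewrite -(big_mkord xpredT (fun i => (h s`_i t / S t)%:C *: f (clamp s`_i))).
rewrite -(big_nth 0 xpredT (fun r => (h r t / S t)%:C *: f (clamp r))).
have w1 : \sum_(r <- s) h r t / S t = 1.
  by rewrite -mulr_suml -/(S t) divff// gt_eqF.
have {1}-> : f t = \sum_(r <- s) ((h r t / S t)%:C *: f t).
  by rewrite -scaler_suml -rmorph_sum w1 scale1r.
rewrite -sumrB; apply: (@le_trans _ _ (\sum_(r <- s) h r t / S t * e)); last first.
  by rewrite -mulr_suml w1 mul1r.
have -> : \sum_(r <- s) ((h r t / S t)%:C *: f t - (h r t / S t)%:C *: f (clamp r)) =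
    \sum_(r <- s) ((h r t / S t)%:C *: (f t - f (clamp r))).
  by apply: eq_bigr => r _; rewrite scalerBr.
elim/big_rec2: _ => [|r x y _ h1]; first by rewrite cnorm0.
apply: (le_trans (cnormD _ _)); apply: lerD => //.
have q0 : 0 <= h r t / S t by rewrite divr_ge0// ltW.
rewrite cnorm_scale ger0_norm//; have [hr|] := ltrP 0 (h r t).
  by rewrite ler_wpM2l// -[X in f X - _]clampK; apply: hf; exact: hpos.
move=> hr; have -> : h r t = 0 by apply/eqP; rewrite eq_le hr h0.
by rewrite !mul0r.
Qed.
End Seg.

(** * Square roots in C*-algebras and norms of representations *)

Section CStarSqrt.
Variables (R : realType) (A : cstarAlgType R).
Local Open Scope complex_scope.
Implicit Types a h k x y : A.

Lemma starZr (r : R) x : star (r%:C *: x) = r%:C *: star x.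
Proof. by rewrite starZ; congr (_ *: _); exact: conjc_real. Qed.

Lemma cnormBC x y : cnorm (x - y) = cnorm (y - x).
Proof. by rewrite -cnormN opprB. Qed.

Lemma cdist_tri x y z (a b : R) :
  cnorm (x - y) <= a -> cnorm (y - z) <= b -> cnorm (x - z) <= a + b.
Proof.
by move=> h1 h2; rewrite -(subrK y x) -addrA (le_trans (cnormD _ _))// lerD.
Qed.

Lemma cnorm_lt_eps x : (forall e, 0 < e -> cnorm x <= e) -> x = 0.
Proof.
move=> h; apply: cnorm_eq0; apply/eqP; rewrite eq_le cnorm_ge0 andbT.
by apply/ler_addgt0Pr => e e0; rewrite add0r h.
Qed.

(* 1 - k is the square root of 1 - h: the equation (1 - k)^2 = 1 - h reads
   k = (h + k^2) / 2, a contraction on the self-adjoint ball of radius ||h||. *)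
Lemma cstar_sqrt h : star h = h -> cnorm h < 1 ->
  exists b, star b = b /\ b * b = 1 - h.
Proof.
move=> hs h1; set r := cnorm h; have r0 : 0 <= r by exact: cnorm_ge0.
pose D x y (a : R) : Prop := cnorm (x - y) <= a.
pose S x : Prop := star x = x /\ cnorm x <= r.
pose f k := (2^-1 : R)%:C *: (h + k * k).
have Dxx x : D x x 0 by rewrite /D subrr cnorm0.
have Dsym x y (a : R) : D x y a -> D y x a by rewrite /D cnormBC.
have Dtri x y z (a b : R) : D x y a -> D y z b -> D x z (a + b) by exact: cdist_tri.
have Dle x y (a b : R) : a <= b -> D x y a -> D x y b.
  by move=> ab; rewrite /D => /le_trans; apply.
have Dc (x : nat -> A) : (forall n, S (x n)) ->
    (forall e, 0 < e -> exists N, forall m n, (N <= m)%N -> (N <= n)%N ->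
      D (x m) (x n) e) ->
    exists l, S l /\ forall e, 0 < e -> exists N, forall n, (N <= n)%N -> D (x n) l e.
  move=> Sx /cnorm_complete [l hl]; exists l; split=> //; split.
    apply/eqP; rewrite -subr_eq0; apply/eqP/cnorm_lt_eps => e e0.
    have e2 : 0 < e / 2 by rewrite divr_gt0.
    have [N /(_ N (leqnn N)) hN] := hl _ e2; rewrite [e]splitr.
    apply: (@cdist_tri _ (x N)); last exact: hN.
    by rewrite -(Sx N).1 -starN -starD cnormS cnormBC.
  apply/ler_addgt0Pr => e e0; have [N /(_ N (leqnn N)) hN] := hl _ e0.
  rewrite -[l](subrK (x N)) addrC (le_trans (cnormD _ _))// lerD ?(Sx N).2//.
  by rewrite cnormBC.
have Sf x : S x -> S (f x).
  move=> [sx nx]; split.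
    by rewrite /f starZr starD starM hs sx.
  rewrite /f cnorm_scale ger0_norm ?invr_ge0// ler_pdivrMl//.
  have n2 : cnorm (x * x) <= r.
    rewrite (le_trans (cnormM _ _))// -[leRHS]mulr1 ler_pM ?cnorm_ge0//.
    by rewrite (le_trans nx)// ltW.
  by rewrite (le_trans (cnormD _ _))// [leRHS]mulr_natl mulr2n lerD.
have Df x y c : S x -> S y -> 0 <= c -> D x y c -> D (f x) (f y) (r * c).
  move=> [_ nx] [_ ny] c0 xy; rewrite /D.
  have -> : f x - f y = (2^-1 : R)%:C *: (x * (x - y) + (x - y) * y).
    rewrite /f -scalerBr; congr (_ *: _).
    by rewrite opprD addrACA subrr add0r mulrBr mulrBl addrA subrK.
  rewrite cnorm_scale ger0_norm ?invr_ge0// ler_pdivrMl//.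
  rewrite (le_trans (cnormD _ _))// [leRHS]mulr_natl mulr2n lerD//.
    by rewrite (le_trans (cnormM _ _))// ler_pM ?cnorm_ge0.
  by rewrite (le_trans (cnormM _ _))// [r * c]mulrC ler_pM ?cnorm_ge0.
have S0 : S 0 by split; [exact: star0 | rewrite cnorm0].
have r01 : 0 <= r < 1 by rewrite r0.
have [k [[ks _] hk]] := contraction_fixpoint Dxx Dsym Dtri Dle Dc (cnorm_ge0 (0 - f 0))
  r01 S0 Sf Df (lexx _).
have fk : f k = k by apply/eqP; rewrite -subr_eq0; apply/eqP/cnorm_lt_eps.
exists (1 - k); split; first by rewrite starD starN star1 ks.
have h2 : h + k * k = k + k.
  have := congr1 (fun x => (2 : R)%:C *: x) fk.
  rewrite /f scalerA -RcM divff// scale1r => ->.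
  by rewrite RcD scalerDl scale1r.
rewrite mulrBr mulr1 mulrBl mul1r -[in RHS](addrK (k * k) h) h2.
by rewrite -[LHS]addrA -opprD addrA.
Qed.
End CStarSqrt.

(** * Representations of a Kasparov module as operators *)

Section Rep.
Variables (R : realType) (A : starAlgType R) (M : kasMod A pt).
Local Open Scope complex_scope.

Definition rho (a : A) : bop M := Bop (ex_intro _ _ (@kas_repS _ _ _ M a)).
Definition kasF : bop M := Bop (ex_intro _ _ (@kas_opS _ _ _ M)).

Lemma rhoD a b : rho (a + b) = rho a + rho b.
Proof.
by apply: bop_eq => x; rewrite bDE /= -[a in LHS]scale1r kas_repL scale1r.
Qed.
Lemma rho0 : rho 0 = 0.
Proof. by apply: (addrI (rho 0)); rewrite -rhoD !addr0. Qed.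
Lemma rhoZ c a : rho (c *: a) = c *: rho a.
Proof.
apply: bop_eq => x; rewrite bZE /= -[c *: a]addr0 kas_repL.
by rewrite -[kas_rep 0 x]/(rho 0 x) rho0 addr0.
Qed.
Lemma rhoM a b : rho (a * b) = rho a * rho b.
Proof. by apply: bop_eq => x; rewrite bME /= kas_repM. Qed.
Lemma rhoN a : rho (- a) = - rho a.
Proof. by rewrite -scaleN1r rhoZ scaleN1r. Qed.
Lemma rhoB a b : rho (a - b) = rho a - rho b.
Proof. by rewrite rhoD rhoN. Qed.
Lemma rho_sum I (s : seq I) (f : I -> A) : rho (\sum_(i <- s) f i) = \sum_(i <- s) rho (f i).
Proof. by rewrite (big_morph rho rhoD rho0). Qed.
Lemma badj_rho a : badj (rho a) = rho (star a).
Proof. by apply: badj_uniq => x y; exact: kas_repS. Qed.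

Lemma rho1l a : rho 1 * rho a = rho a. Proof. by rewrite -rhoM mul1r. Qed.
Lemma rho1r a : rho a * rho 1 = rho a. Proof. by rewrite -rhoM mulr1. Qed.

Lemma rho_sq a : ceq (rho a * kasF * kasF) (rho a).
Proof.
rewrite /ceq -mulrA -[X in _ - X]mulr1 -mulrBr; exact: (@kas_sq _ _ _ M a).
Qed.
Lemma rho_comm a : ceq (kasF * rho a) (rho a * kasF).
Proof. exact: (@kas_comm _ _ _ M a). Qed.
Lemma badj_kasF x : badj kasF x = kas_adj x.
Proof.
have -> // : badj kasF = Bop (ex_intro _ _ (adjoint_sym (@kas_opS _ _ _ M))).
by apply: badj_uniq => u v; exact: kas_opS.
Qed.
Lemma rho_sa a : ceq (rho a * kasF) (rho a * badj kasF).
Proof.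
rewrite /ceq -mulrBr; have -> : (rho a * (kasF - badj kasF) : bop M) =
   (fun x => kas_rep a (kas_op x - kas_adj x)) :> (M -> M).
  by apply/funext => x; rewrite -[LHS]/(rho a (kasF x - badj kasF x)) badj_kasF.
exact: kas_sa.
Qed.
End Rep.

Section RepBound.
Variables (R : realType) (A : cstarAlgType R) (M : kasMod A pt).
Local Open Scope complex_scope.

(** With P = rho 1 an orthogonal projection, ||P x||^2 = <x, P x>, and Cauchy-Schwarz allows
    division by ||P x||. *)
Lemma hnorm_rho1 (x : M) : hnorm (rho M 1 x) <= hnorm x.
Proof.
have [->|n0] := eqVneq (hnorm (rho M 1 x)) 0; first exact: hnorm_ge0.
have p : 0 < hnorm (rho M 1 x) by rewrite lt_def n0 hnorm_ge0.
rewrite -(ler_pM2r p) -expr2 hnorm_sqr ip_adj badj_rho star1 -bME -rhoM mulr1.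
exact: le_trans (Re_le_normc _) (cauchy_schwarz _ _).
Qed.

(** For t above the norm of [a], 1 - a^* a / t^2 = b^2 with b self-adjoint, so ||rho(a) x||^2 / t^2
    is at most ||rho(1) x||^2: the difference is ||rho(b) x||^2. Then t decreases to the norm of
    [a]. *)
Lemma bnd_rho (a : A) : bnd (rho M a) (cnorm a).
Proof.
move=> x; have : forall e, 0 < e -> hnorm (rho M a x) <= (cnorm a + e) * hnorm x; last first.
  move=> h; apply/ler_addgt0Pr => e e0.
  have q : 0 < hnorm x + 1 by rewrite ltr_wpDl ?hnorm_ge0.
  have := h _ (divr_gt0 e0 q); rewrite mulrDl => /le_trans; apply.
  rewrite lerD2l mulrAC ler_pdivrMr// ler_wpM2l ?(ltW e0)//.
  by rewrite lerDl.
move=> e e0; set t := cnorm a + e.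
have t0 : 0 < t by rewrite ltr_wpDl ?cnorm_ge0.
pose h := ((t ^+ 2)^-1)%:C *: (star a * a).
have hh : star h = h by rewrite /h starZr starM starK.
have h1 : cnorm h < 1.
  rewrite /h cnorm_scale ger0_norm ?invr_ge0 ?sqr_ge0// cnorm_star.
  rewrite ltr_pdivrMl ?exprn_gt0// mulr1 ltr_pXn2r// ?nnegrE ?cnorm_ge0 ?(ltW t0)//.
  by rewrite /t ltrDl.
have [b [bs bb]] := cstar_sqrt hh h1.
have hb : hnorm (rho M b x) ^+ 2 = hnorm (rho M 1 x) ^+ 2 - (t ^+ 2)^-1 * hnorm (rho M a x) ^+ 2.
  rewrite !hnorm_sqr !ip_adj !badj_rho bs star1 -!bME -!rhoM mulr1 bb rhoB.
  rewrite bBE ipB rhoZ bZE ipZ.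
  by case: (ip x (rho M 1 x)) => p q; case: (ip _ _) => u v /=; rewrite mul0r subr0.
have := sqr_ge0 (hnorm (rho M b x)); rewrite hb subr_ge0 ler_pdivrMl ?exprn_gt0// => h2.
have h3 : hnorm (rho M 1 x) ^+ 2 <= hnorm x ^+ 2.
  by rewrite ler_pXn2r ?nnegrE ?hnorm_ge0// hnorm_rho1.
rewrite -(@ler_pXn2r _ 2)// ?nnegrE ?hnorm_ge0 ?mulr_ge0 ?hnorm_ge0 ?(ltW t0)//.
by rewrite exprMn (le_trans h2)// ler_pM2l ?exprn_gt0.
Qed.
End RepBound.

(** * The odd index pairing *)

Section RepProjection.
Variables (R : realType) (A : starAlgType R) (M : kasMod A pt).
Local Open Scope complex_scope.

Definition halfF : bop M := (2^-1 : R[i]) *: (1 + kasF M).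
(** The right factor [rho M 1] appears when the operator of [index1], given on the range of
    [rho M 1], is extended to the whole space; it also makes [repP_rho1] an exact equality. *)
Definition repP : bop M := rho M 1 * halfF * rho M 1.

Lemma halfF_comm a : ceq (halfF * rho M a) (rho M a * halfF).
Proof.
rewrite /halfF -bscaleAl -bscaleAr; apply: ceqZ; rewrite mulrDl mulrDr mul1r mulr1.
by apply: ceqD; [exact: ceq_refl | exact: rho_comm].
Qed.

(** F^2 is 1 modulo compacts only after multiplication by a represented element, hence the factor
    [rho M 1] in front; the rest is (1 + F)^2 = 2 (1 + F). *)
Lemma halfF_sqr : ceq (rho M 1 * halfF * halfF) (rho M 1 * halfF).
Proof.
rewrite /halfF -!bscaleAr -bscaleAl; apply: ceqZ.
apply: (@ceq_trans _ _ ((2^-1 : R[i]) *: ((rho M 1 + rho M 1) + (rho M 1 * kasF M + rho M 1 * kasF M)))).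
  apply: ceqZ; rewrite [rho M 1 * (1 + _)]mulrDr mulr1 mulrDl !mulrDr !mulr1.
  apply: (@ceq_trans _ _ (rho M 1 + rho M 1 * kasF M + (rho M 1 * kasF M + rho M 1))).
    by do 2![apply: ceqD; first exact: ceq_refl]; exact: rho_sq.
  by rewrite [_ * kasF M + rho M 1]addrC addrACA; exact: ceq_refl.
have -> : rho M 1 + rho M 1 + (rho M 1 * kasF M + rho M 1 * kasF M) =
    (2 : R[i]) *: (rho M 1 * (1 + kasF M)).
  by rewrite scaler_nat mulr2n mulrDr mulr1 addrACA.
by rewrite scalerA mulVf ?pnatr_eq0// scale1r; exact: ceq_refl.
Qed.

Lemma repP_simpl : ceq repP (rho M 1 * halfF).
Proof.
rewrite /repP -mulrA; apply: ceq_trans (ceqMl _ (halfF_comm 1)) _.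
by rewrite mulrA rho1l; exact: ceq_refl.
Qed.

Lemma repP_idem : ceq (repP * repP) repP.
Proof.
apply: ceq_trans (ceqM repP_simpl repP_simpl) _.
apply: ceq_trans (ceq_sym repP_simpl).
apply: (@ceq_trans _ _ (rho M 1 * halfF * halfF)); last exact: halfF_sqr.
rewrite -mulrA [halfF * (_ * _)]mulrA.
apply: ceq_trans (ceqMl _ (ceqMr _ (halfF_comm 1))) _.
by rewrite !mulrA rho1l; exact: ceq_refl.
Qed.

Lemma repP_comm a : ceq (repP * rho M a) (rho M a * repP).
Proof.
apply: ceq_trans (ceqMr _ repP_simpl) _.
apply: ceq_trans (ceqMl _ (ceq_sym repP_simpl)).
rewrite -mulrA; apply: ceq_trans (ceqMl _ (halfF_comm a)) _.
by rewrite !mulrA rho1l rho1r; exact: ceq_refl.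
Qed.
End RepProjection.

(** * Index of the Toeplitz compression of a matrix *)

Section ToeplitzIndex.
Variables (R : realType) (A : starAlgType R) (M : kasMod A pt).

Section Size.
Variable n : nat.
Implicit Types v w : 'M[A]_n.

Definition mrho v : bop (hampl M n) := mop (map_mx (rho M) v).
Definition mscal (T : bop M) : bop (hampl M n) := mop T%:M.
Definition mtoep v : bop (hampl M n) := toeplitz (mscal (repP M)) (mrho v).

Lemma mrhoM v w : mrho (v *m w) = mrho v * mrho w.
Proof.
rewrite /mrho -mopM; congr mop; apply/matrixP => i j; rewrite !mxE rho_sum.
by apply: eq_bigr => k _; rewrite !mxE rhoM.
Qed.

Lemma mscalE T (x : hampl M n) i : mscal T x i = T (x i).
Proof.
rewrite mopE (bigD1 i)//= mxE eqxx big1 ?addr0// => j ji.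
by rewrite mxE eq_sym (negbTE ji).
Qed.
Lemma mscalM S T : mscal (S * T) = mscal S * mscal T.
Proof. by apply: bop_eq => x; apply/ffunP => i; rewrite bME !mscalE. Qed.
Lemma mscalD S T : mscal (S + T) = mscal S + mscal T.
Proof. by apply: bop_eq => x; apply/ffunP => i; rewrite bDE hamplDE !mscalE. Qed.
Lemma mscal1 : mscal 1 = 1.
Proof. exact: mop1. Qed.
Lemma mscalZ (c : R[i]%C) T : mscal (c *: T) = c *: mscal T.
Proof.
by apply: bop_eq => x; apply/ffunP => i; rewrite bZE [RHS]ffunE !mscalE.
Qed.

Lemma ceq_mscal S T : ceq S T -> ceq (mscal S) (mscal T).
Proof.
move=> h; apply: ceq_mop => i j; rewrite !mxE; case: (i == j); rewrite ?mulr1n ?mulr0n//.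
exact: ceq_refl.
Qed.

Lemma mrho1 : mrho 1%:M = mscal (rho M 1).
Proof.
congr mop; apply/matrixP => i j; rewrite !mxE; case: (i == j); rewrite ?mulr1n ?mulr0n//.
exact: rho0.
Qed.

Lemma mrho1l v : mscal (rho M 1) * mrho v = mrho v.
Proof. by rewrite -mrho1 -mrhoM mul1mx. Qed.

Lemma mrepP_idem : ceq (mscal (repP M) * mscal (repP M)) (mscal (repP M)).
Proof. by rewrite -mscalM; apply: ceq_mscal; exact: repP_idem. Qed.

Lemma mop_mscal (K : 'M[bop M]_n) T : mop K * mscal T = mop (\matrix_(i, j) (K i j * T)).
Proof.
apply: bop_eq => x; apply/ffunP => i; rewrite bME !mopE.
by apply: eq_bigr => j _; rewrite mxE bME mscalE.
Qed.

Lemma mrepP_comm v : ceq (mscal (repP M) * mrho v) (mrho v * mscal (repP M)).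
Proof.
rewrite /mrho mop_mscal -mopM; apply: ceq_mop => i j; rewrite mul_scalar_mx !mxE.
exact: repP_comm.
Qed.

Lemma mtoepM v w : ceq (mtoep v * mtoep w) (mtoep (v *m w)).
Proof.
rewrite /mtoep mrhoM; apply: toeplitzM; [exact: mrepP_idem|exact: mrepP_comm|exact: mrepP_comm].
Qed.

Lemma repP_rho1 : repP M * rho M 1 = repP M.
Proof. by rewrite /repP -mulrA rho1l. Qed.

Lemma mtoep1 : ceq (mtoep 1%:M) 1.
Proof.
have -> : mtoep 1%:M = toeplitz (mscal (repP M)) 1.
  by rewrite /mtoep /toeplitz mrho1 -mscalM repP_rho1 mulr1.
exact: toeplitz1 mrepP_idem.
Qed.

Definition invmat v := exists w, v *m w = 1%:M /\ w *m v = 1%:M.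
Definition tind v : int := Defs.findex (mtoep v) [set: hampl M n] [set: hampl M n].

Lemma mtoep_inv v w : v *m w = 1%:M -> ceq (mtoep v * mtoep w) 1.
Proof. by move=> vw; apply: ceq_trans (mtoepM v w) _; rewrite vw; exact: mtoep1. Qed.

Lemma tindE v k : idx (mtoep v) k -> tind v = k.
Proof. by apply: findexE; exact: bop_lin. Qed.

Lemma idx_tind v : invmat v -> idx (mtoep v) (tind v).
Proof.
move=> [w [vw wv]]; have [k [hk _]] := idx_parametrix (mtoep_inv vw) (mtoep_inv wv).
by rewrite (tindE hk).
Qed.

Lemma tind1 : tind 1%:M = 0.
Proof. by apply/tindE/idx_ceq1; exact: mtoep1. Qed.

Lemma invmatM v w : invmat v -> invmat w -> invmat (v *m w).
Proof.
move=> [v' [h1 h2]] [w' [h3 h4]]; exists (w' *m v'); split.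
  by rewrite mulmxA -(mulmxA v) h3 mulmx1.
by rewrite mulmxA -(mulmxA w') h2 mulmx1.
Qed.

Lemma tindM v w : invmat v -> invmat w -> tind (v *m w) = tind v + tind w.
Proof.
move=> hv hw; have hvw := invmatM hv hw; apply: tindE.
have hk := idxM (idx_tind hv) (idx_tind hw).
have [z [vz zv]] := hvw.
have h := idx_tind hvw.
have := idx_ceq (mtoep_inv vz) (mtoep_inv zv) (mtoepM v w) h.
by move=> h'; rewrite (idx_uniq hk h').
Qed.

(* the operator of the index pairing, extended by the identity off the range of 1 *)
Lemma mtoepE v (x : hampl M n) :
  let Q (x : hampl M n) : hampl M n := amp_rep 1%:M x in
  let P (x : hampl M n) : hampl M n :=
    amp_rep 1%:M (2^-1 *: (x + amp (@kas_op _ _ _ M) x)) in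
  mtoep v x = (P (amp_rep v (P (Q x))) + (Q x - P (Q x))) + (x - Q x).
Proof.
move=> Q P.
have rE w (y : hampl M n) : amp_rep w y = mrho w y :> hampl M n.
  apply/ffunP => i; rewrite mopE ffunE; apply: eq_bigr => j _.
  by rewrite mxE.
have QE y : Q y = mscal (rho M 1) y by rewrite -mrho1 -rE.
have aE (y : hampl M n) : amp (@kas_op _ _ _ M) y = mscal (kasF M) y.
  by apply/ffunP => i; rewrite mscalE ffunE.
have PE y : P y = mscal (rho M 1 * halfF M) y.
  rewrite mscalM bME -mrho1 -rE /P aE; congr amp_rep.
  by rewrite /halfF mscalZ mscalD mscal1.
have PQ : mscal (rho M 1 * halfF M) * mscal (rho M 1) = mscal (repP M).
  by rewrite -mscalM.
have -> : mtoep v = mscal (rho M 1 * halfF M) * mrho v * mscal (rho M 1 * halfF M) * mscal (rho M 1)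
   + (mscal (rho M 1) - mscal (rho M 1 * halfF M) * mscal (rho M 1)) + (1 - mscal (rho M 1)).
  have e1 (a b : bop (hampl M n)) : a - b + (1 - a) = 1 - b by rewrite addrC addrA subrK.
  rewrite -[RHS]addrA e1 -(mulrA _ (mscal _) (mscal _)) PQ /mtoep /toeplitz addrA.
  by rewrite -[in RHS](mrho1l v) [in RHS]mulrA PQ.
by rewrite !bDE !bNE b1E !bME !PE !QE !rE.
Qed.
End Size.

(** The extended operator is [T] on the range of [Q] and the identity on the complement. The kernels
    are equal and inclusion identifies the cokernels, so the same integers are indices of both,
    whether or not one exists. *)
Lemma findex_compress (K : fieldType) (V : lmodType K) (T Q : V -> V) :
  lin_on [set: V] T -> lin_on [set: V] Q -> (forall x, Q (Q x) = Q x) ->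
  (forall x, Q x = x -> Q (T x) = T x) ->
  Defs.findex T [set x | Q x = x] [set x | Q x = x] =
  Defs.findex (fun x => T (Q x) + (x - Q x)) [set: V] [set: V].
Proof.
move=> hT hQ QQ QT; set W := [set x | Q x = x]; set T' := fun x => _.
have sW : subsp W.
  split; first exact: linT0.
  by move=> a x y; rewrite /W /= => hx hy; rewrite hQ// hx hy.
have hT' : lin_on [set: V] T'.
  move=> a x y _ _; rewrite /T' hQ// hT// scalerDr scalerBr [RHS]addrACA.
  by congr (_ + _); rewrite opprD addrACA.
have TQ x : Q x = x -> T' x = T x by rewrite /T' => ->; rewrite subrr addr0.
have QT' x : Q (T' x) = T (Q x).
  by rewrite /T' (linTD _ _ hQ) (linTB _ _ hQ) QQ subrr addr0 QT.
have ek : [set x | W x /\ T x = 0] = [set x | [set: V] x /\ T' x = 0].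
  apply/seteqP; split=> x /= [hx tx]; first by split=> //; rewrite TQ.
  have h : T (Q x) = 0 by rewrite -QT' tx linT0.
  have hx' : Q x = x.
    by move: tx; rewrite /T' h add0r => /eqP; rewrite subr_eq0 => /eqP.
  by split=> //; rewrite -hx'.
have sTW : subsp (T @` W).
  split; first by exists 0; [exact: sW.1 | exact: linT0].
  by move=> a _ _ [x hx <-] [y hy <-]; exists (a *: x + y); [exact: sW.2 | rewrite hT].
have eran x : W x -> (T @` W) x <-> (T' @` [set: V]) x.
  move=> hx; split=> [[y hy e]|[y _ e]]; first by exists y => //; rewrite TQ.
  by exists (Q y); [exact: QQ | rewrite -QT' e].
have surj y : [set: V] y -> exists2 x, W x & (T' @` [set: V]) (y - x).
  move=> _; exists (Q y); first exact: QQ.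
  exists (y - Q y) => //; rewrite /T' (linTB _ _ hQ) QQ subrr linT0// add0r.
  by rewrite subr0.
have e n : qdim W (T @` W) n <-> qdim [set: V] (T' @` [set: V]) n.
  by split; [apply: (qdim_image (f := id) sW sTW (@subspT _ V) (subsp_ran hT')) |
    apply: (qdim_preim (f := id) sW sTW (@subspT _ V) (subsp_ran hT'))].
rewrite /Defs.findex; congr xget; apply/seteqP; split=> k [m [n [hm hn hk]]]; exists m, n; split=> //.
- by rewrite -ek.
- exact/e.
- by rewrite ek.
- exact/e.
Qed.

Lemma index1E (u : gl A) : index1 M u = tind (gl_mx u).
Proof.
rewrite /index1; set n := gl_size u.
set Q := fun x : hampl M n => amp_rep 1%:M x : hampl M n.
set P := fun x : hampl M n => amp_rep 1%:M (2^-1 *: (x + amp (@kas_op _ _ _ M) x)) : hampl M n.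
have rE (v : 'M[A]_n) (x : hampl M n) : amp_rep v x = mrho v x :> hampl M n.
  by apply/ffunP => i; rewrite mopE ffunE; apply: eq_bigr => j _; rewrite mxE.
have QE x : Q x = mrho 1%:M x by exact: rE.
have aE (y : hampl M n) : amp (@kas_op _ _ _ M) y = mscal n (kasF M) y.
  by apply/ffunP => i; rewrite mscalE ffunE.
pose Pb : bop (hampl M n) := mrho 1%:M * ((2^-1 : R[i]%C) *: (1 + mscal n (kasF M))).
have PE x : P x = Pb x by rewrite /P rE aE.
pose T : bop (hampl M n) := Pb * mrho (gl_mx u) * Pb + (1 - Pb).
have TE x : T x = P (amp_rep u (P x)) + (x - P x) by rewrite !PE rE.
have Q2 x : Q (Q x) = Q x by rewrite !QE -bME -mrhoM mulmx1.
have QP x : Q (P x) = P x by rewrite QE PE -bME /Pb mulrA -mrhoM mulmx1.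
have /funext eT := TE.
rewrite /tind; transitivity (Defs.findex T [set x | Q x = x] [set x | Q x = x]).
  by rewrite eT.
rewrite (@findex_compress _ _ T Q).
- by congr Defs.findex; apply/funext => x; rewrite mtoepE TE.
- exact: bop_lin.
- by move=> a x y _ _; rewrite !QE bopD bopZ.
- exact: Q2.
- by move=> x hx; rewrite TE QE bopD bopB -!QE !QP hx.
Qed.
End ToeplitzIndex.

(** * Invariance of the index under stabilization *)

Section Stabilization.
Variables (R : realType) (A : starAlgType R) (M : kasMod A pt).

Section Stab.
Variables (n k : nat).
Hypothesis nk : (n <= k)%N.

(** The case split is that of [gl_stab], which makes the later comparison entrywise. *)
Definition smx (K : 'M[bop M]_n) : 'M[bop M]_k :=
  \matrix_(i < k, j < k)
    match insub (val i), insub (val j) with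
    | Some i', Some j' => K i' j'
    | _, _ => (i == j)%:R
    end.

Definition extz (x : hampl M n) : hampl M k :=
  [ffun i => (if insub (val i) is Some i' then x i' else 0) : M].
Definition restr (y : hampl M k) : hampl M n := [ffun i => y (widen_ord nk i) : M].

Lemma insub_widen (i : 'I_n) : insub (val (widen_ord nk i)) = Some i :> option 'I_n.
Proof. by rewrite /= valK. Qed.

Lemma extzK : cancel extz restr.
Proof. by move=> x; apply/ffunP => i; rewrite !ffunE insub_widen. Qed.

Lemma restrD a (x y : hampl M k) : restr (a *: x + y) = a *: restr x + restr y.
Proof. by apply/ffunP => i; rewrite !ffunE. Qed.

Lemma extzD a (x y : hampl M n) : extz (a *: x + y) = a *: extz x + extz y.
Proof.
apply/ffunP => i; rewrite !ffunE; case: insub => [j|]; rewrite ?ffunE//.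
by rewrite scaler0 addr0.
Qed.

Lemma mop_smx K y : mop (smx K) y = extz (mop K (restr y)) + (y - extz (restr y)).
Proof.
apply/ffunP => i; rewrite mopE hamplDE hamplDE hamplNE !ffunE.
case: insubP => [i' _ ei|ni]; last first.
  rewrite add0r subr0 (bigD1 i)//= !mxE insubF ?(negbTE ni)// eqxx big1 ?addr0// => j ji.
  by rewrite !mxE insubF ?(negbTE ni)// eq_sym (negbTE ji).
have -> : y i = restr y i'.
  by rewrite ffunE; congr (y _); apply: val_inj; rewrite /= -ei.
rewrite subrr addr0; pose F (j : 'I_k) := if insub (val j) is Some j' then K i' j' (y j) else 0.
transitivity (\sum_(j < k) F j).
  apply: eq_bigr => j _; rewrite mxE -ei valK /F; case: insubP => // nj.
  case: eqP => // ij; move: nj; rewrite -ij -ei.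
  by have /= := ltn_ord i' => ->.
rewrite (bigID (fun j : 'I_k => (j < n)%N))/= [X in _ + X]big1 ?addr0; last first.
  by move=> j nj; rewrite /F insubF// (negbTE nj).
rewrite (big_ord_narrow nk) -[RHS]/(mop K (restr y) i') mopE; apply: eq_bigr => j _.
by rewrite /F insub_widen ffunE.
Qed.

(** [mop_smx] shows the stabilized operator to be the identity on the new coordinates, so extension
    by zero identifies kernels and cokernels. *)
Lemma idx_smx K l : idx (mop K) l -> idx (mop (smx K)) l.
Proof.
move=> [m [c [hm hc ->]]]; exists m, c.
have I0 : extz 0 = 0 by apply/ffunP => i; rewrite !ffunE; case: insub => // ?; rewrite ffunE.
have J0 : restr 0 = 0 by apply/ffunP => i; rewrite !ffunE.
have JB (x y : hampl M k) : restr (x - y) = restr x - restr y by apply/ffunP => i; rewrite !ffunE.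
have JT y : restr (mop (smx K) y) = mop K (restr y).
  rewrite mop_smx -[extz _ + _]scale1r -[1 *: _]addr0 restrD J0 addr0 scale1r.
  by rewrite -[X in restr (X + _)]scale1r restrD JB !extzK subrr addr0 scale1r.
have lK := bop_lin (mop K); have lS := bop_lin (mop (smx K)).
split=> //.
- apply: (qdim_image (f := extz) (subsp_ker lK) (@subsp0 _ _) (subsp_ker lS) (@subsp0 _ _)) hm.
  + by move=> a x y _ _; exact: extzD.
  + move=> x [_ hx]; split=> //; rewrite mop_smx extzK hx I0 subrr addr0//.
  + move=> y [_ hy]; have h0 : mop K (restr y) = 0 by rewrite -JT hy J0.
    exists (restr y) => //.
    by move: hy; rewrite mop_smx h0 I0 add0r.
  + move=> x _; split=> [->|h]; first exact: I0.
    by rewrite -(extzK x) h J0.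
- apply: (qdim_image (f := extz) (@subspT _ _) (subsp_ran lK) (@subspT _ _) (subsp_ran lS)) hc => //.
  + by move=> a x y _ _; exact: extzD.
  + move=> y _; exists (restr y) => //; exists (y - extz (restr y)) => //.
    by rewrite mop_smx JB extzK subrr bop0 !I0 subr0 add0r.
  + move=> x _; split=> [[y _ <-]|[y _ e]].
      by exists (extz y) => //; rewrite mop_smx extzK subrr addr0.
    by exists (restr y) => //; rewrite -JT e extzK.
Qed.
End Stab.

Definition tmx n (v : 'M[A]_n) : 'M[bop M]_n :=
  \matrix_(i, j) (repP M * rho M (v i j) * repP M + (if i == j then 1 - repP M else 0)).

Lemma mtoep_tmx n (v : 'M[A]_n) : mtoep M v = mop (tmx v).
Proof.
rewrite /mtoep /toeplitz -addrA.
have -> : 1 - mscal n (repP M) = mscal n (1 - repP M).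
  rewrite mscalD mscal1; congr (_ + _); apply: bop_eq => x; apply/ffunP => i.
  by rewrite bNE hamplNE !mscalE.
rewrite /mrho -mulrA mop_mscal -mopM -mopD; congr mop; apply/matrixP => i j.
rewrite mul_scalar_mx !mxE mulrA; congr (_ + _).
by case: eqP.
Qed.

(** On a new diagonal entry the compression of g (+) 1 has p p + 1 - p with p = [repP M], whereas
    the stabilized compression of g has 1. They agree only modulo compacts, by [repP_idem]. *)
Lemma tind_stab (g : gl A) k : (gl_size g <= k)%N -> invmat (gl_stab k g) ->
  tind M (gl_stab k g) = tind M (gl_mx g).
Proof.
move=> gk hs; have hg : invmat (gl_mx g).
  by exists (gl_inv g); split; [exact: gl_mulV | exact: gl_mulVl].
have h1 := idx_smx gk (_ : idx (mop (tmx (gl_mx g))) _).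
have {}h1 : idx (mop (smx k (tmx (gl_mx g)))) (tind M (gl_mx g)).
  by apply: h1; rewrite -mtoep_tmx; exact: idx_tind.
have h2 := idx_tind M hs; have [w [vw wv]] := hs.
have h : ceq (mop (smx k (tmx (gl_mx g)))) (mtoep M (gl_stab k g)).
  rewrite mtoep_tmx; apply: ceq_mop => i j; rewrite !mxE.
  case: (insubP _ (val i)) => [i' _ ei|ni].
    case: (insubP _ (val j)) => [j' _ ej|nj].
      rewrite mxE.
      have -> : (i' == j') = (i == j) by rewrite -!val_eqE /= ei ej.
      exact: ceq_refl.
    have -> : (i == j) = false.
      by apply/eqP => ij; move: nj; rewrite -ij -ei ltn_ord.
    by rewrite rho0 mulr0 mul0r addr0; exact: ceq_refl.
  case: eqP => _; last by rewrite rho0 mulr0 mul0r addr0; exact: ceq_refl.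
  change (ceq 1 (repP M * rho M 1 * repP M + (1 - repP M))).
  rewrite repP_rho1; apply: ceq_sym; apply: (@ceq_trans _ _ (repP M + (1 - repP M))).
    by apply: ceqD; [exact: repP_idem | exact: ceq_refl].
  by rewrite addrC subrK; exact: ceq_refl.
exact: (idx_uniq (idx_ceq (mtoep_inv M vw) (mtoep_inv M wv) h h2) h1).
Qed.
End Stabilization.

Lemma near_forall2 (X : topologicalType) (x : X) (I J : finType) (P : I -> J -> X -> Prop) :
  (forall i j, \forall y \near x, P i j y) -> \forall y \near x, forall i j, P i j y.
Proof. by move=> h; apply: filter_forall => i; apply: filter_forall => j; exact: h. Qed.

(** * Invariance of the index along paths, and powers *)

Section PathInvariance.
Variables (R : realType) (A : cstarAlgType R) (M : kasMod A pt).

(** Near [t], the compression of the inverse of [gamma t] remains a left inverse modulo compacts up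
    to an error of norm at most 1/2, so the index is locally constant. *)
Lemma tind_path k (gamma : seg01 R -> 'M[A]_k) :
  (forall i j, ccontinuous (fun t => gamma t i j)) ->
  (forall t, invmat (gamma t)) -> tind M (gamma (seg0 R)) = tind M (gamma (seg1 R)).
Proof.
move=> cg ig; apply: (seg01_locally_constant (f := fun t => tind M (gamma t))) => t.
have [v [gv vg]] := ig t.
have [c c0 hc] := bop_bounded (mscal k (repP M)).
have [d d0 hd] := bop_bounded (mtoep M v).
(* A change of the entries by [e] changes the product by at most [B * e]: [d] bounds the parametrix,
   [c] each of the two projections, and [k * k] passes from entries to the matrix. The choice of [e]
   gives B e <= 1/2. *)
pose B := d * (c * ((k * k)%:R * c)).
have B0 : 0 <= B by rewrite !mulr_ge0.
pose e := (2 * (B + 1))^-1.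
have e0 : 0 < e by rewrite invr_gt0 mulr_gt0// ltr_wpDl.
have /seg_nearP [r r0 hr] : \forall s \near (t : seg01 R), forall i, forall j,
    cnorm (gamma s i j - gamma t i j) < e.
  by apply: near_forall2 => i j; exact: cg.
exists r; [exact: r0 | move=> s /hr hs].
have hk := idx_tind M (ig t); have hk' := idx_tind M (ig s).
apply: (idx_stable (r := 2^-1) (K := mtoep M v * mtoep M (gamma t) - 1)
  (mtoep_inv M gv) (mtoep_inv M vg) (mtoep_inv M vg) _ _ hk hk').
  by rewrite invr_ge0 ler0n invf_lt1 ?ltr1n.
have -> : mtoep M v * mtoep M (gamma s) - (mtoep M v * mtoep M (gamma t) - 1) - 1 =
  mtoep M v * (mscal k (repP M) * mrho M (gamma s - gamma t) * mscal k (repP M)).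
  rewrite opprB addrCA [1 + _]addrC addrK -mulrBr; congr (_ * _).
  have eq (a b p : bop (hampl M k)) : a + 1 - p - (b + 1 - p) = a - b.
    by rewrite opprB addrA subrK opprD addrA addrAC addrK.
  rewrite eq -mulrBl -mulrBr; congr (_ * _ * _).
  by rewrite /mrho -mopB; congr mop; apply/matrixP => i j; rewrite !mxE rhoB.
have hm : bnd (mrho M (gamma s - gamma t)) ((k * k)%:R * e).
  apply: bnd_mop; last exact: ltW.
  move=> i j; rewrite !mxE; apply: bnd_le (bnd_rho _).
  exact/ltW/hs.
apply: bnd_le (bndM d0 hd (bndM _ (bndM c0 hc hm) hc)); last first.
  by rewrite !mulr_ge0// ltW.
have -> : d * (c * ((k * k)%:R * e) * c) = B * e by rewrite /B; ring.
rewrite /e ler_pdivrMr ?mulr_gt0 ?ltr_wpDl//; lra.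
Qed.

Lemma index1_homotopic (g h : gl A) : K1rel g h -> index1 M g = index1 M h.
Proof.
move=> [k [gk hk [gamma [cg ig g0 g1]]]]; rewrite !index1E.
have <- : tind M (gl_stab k g) = tind M g by apply: tind_stab => //; rewrite -g0; exact: ig.
have <- : tind M (gl_stab k h) = tind M h by apply: tind_stab => //; rewrite -g1; exact: ig.
by rewrite -g0 -g1; exact: tind_path.
Qed.

(** [qrepr] returns some representative, joined to [g] by a chain of [K1rel] steps in either
    direction; the index is constant along it. *)
Lemma index1_qrepr (g : gl A) : index1 M (qrepr (K1cls g)) = index1 M g.
Proof.
have := cls_qrepr (@K1rel R A) g; rewrite -/(K1cls g).
elim=> [x y /index1_homotopic //|//|x y _ -> //|x y z _ h1 _ h2].
by rewrite h2.
Qed.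

Lemma invmat_gl (g : gl A) : invmat (gl_mx g).
Proof. by exists (gl_inv g); split; [exact: gl_mulV | exact: gl_mulVl]. Qed.

Lemma tind_expr n (v : 'M[A]_n) k : invmat v -> tind M (v ^+ k) = k%:Z * tind M v.
Proof.
move=> hv; suff [] : invmat (v ^+ k) /\ tind M (v ^+ k) = k%:Z * tind M v by [].
elim: k => [|k [h1 h2]].
  rewrite mul0r -[v ^+ 0]/(1%:M); split; last exact: tind1.
  by exists 1%:M; rewrite mul1mx.
rewrite exprS -mulmxE; split; first exact: invmatM.
by rewrite tindM// h2 intS mulrDl mul1r.
Qed.

Lemma index1_pow (g : gl A) (n : int) : index1 M (gl_pow g n) = n * index1 M g.
Proof.
rewrite !index1E; case: n => k /=; first exact/tind_expr/invmat_gl.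
have h : invmat (gl_inv g) := invmat_gl (gl_inverse g).
have e : tind M (gl_inv g) = - tind M (gl_mx g).
  apply/eqP; rewrite -addr_eq0 -tindM; [|exact: h|exact: invmat_gl].
  by rewrite gl_mulVl tind1.
by rewrite (tind_expr k.+1 h) e mulrN NegzE mulNr.
Qed.
End PathInvariance.

Lemma pairing1_pow (R : realType) (A : cstarAlgType R) (g : gl A) (z : KH1 A) (n : int) :
  pairing1 (K1cls (gl_pow g n)) z = n * pairing1 (K1cls g) z.
Proof. by rewrite /pairing1 !index1_qrepr index1_pow. Qed.

(** * Square roots of positive operators *)

Section OperatorLimits.
Variables (R : realType) (H : hilbMod R pt).
Local Open Scope complex_scope.
Implicit Types T S U K : bop H.

Lemma bnd_lt_eps T : (forall e : R, 0 < e -> bnd T e) -> T = 0.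
Proof.
move=> h; apply: bop_eq => x; apply: hnorm_lt_eps => e e0.
have q : 0 < hnorm x + 1 by rewrite ltr_wpDl ?hnorm_ge0.
apply: le_trans (h _ (divr_gt0 e0 q) x) _.
by rewrite mulrAC ler_pdivrMr// ler_wpM2l ?(ltW e0)// lerDl.
Qed.

Lemma bop_pointwise_limit (T : nat -> bop H) :
  (forall e : R, 0 < e -> exists N, forall m n, (N <= m)%N -> (N <= n)%N ->
     bnd (T m - T n) e) ->
  exists f : H -> H, forall e : R, 0 < e -> exists N, forall n, (N <= n)%N ->
    forall x, hnorm (T n x - f x) <= e * hnorm x.
Proof.
move=> h.
have hx x : exists l, forall e : R, 0 < e -> exists N, forall n, (N <= n)%N ->
    hnorm (T n x - l) <= e.
  apply: hcomplete => e e0; have q : 0 < hnorm x + 1 by rewrite ltr_wpDl ?hnorm_ge0.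
  have [N hN] := h _ (divr_gt0 e0 q); exists N => m n hm hn.
  apply: le_trans (hN m n hm hn x) _.
  by rewrite mulrAC ler_pdivrMr// ler_wpM2l ?(ltW e0)// lerDl.
exists (fun x => sval (cid (hx x))) => e e0.
have [N hN] := h e e0; exists N => n hn x; apply/ler_addgt0Pr => d d0.
have [N' hN'] := svalP (cid (hx x)) d d0.
apply: (@hdist_tri _ _ _ (T (maxn N N') x)).
  by apply: hN => //; exact: leq_maxl.
by apply: hN'; exact: leq_maxr.
Qed.

(** The adjoints satisfy the same Cauchy condition by [bnd_adj], and their limit is an adjoint of
    the pointwise limit. *)
Lemma bop_complete (T : nat -> bop H) :
  (forall e : R, 0 < e -> exists N, forall m n, (N <= m)%N -> (N <= n)%N ->
     bnd (T m - T n) e) ->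
  exists U, forall e : R, 0 < e -> exists N, forall n, (N <= n)%N -> bnd (T n - U) e.
Proof.
move=> h; have [f hf] := bop_pointwise_limit h.
have [e e0|g hg] := @bop_pointwise_limit (fun n => badj (T n)).
  have [N hN] := h e e0; exists N => m n hm hn.
  by rewrite -badjN -badjD; apply: bnd_adj; [exact: ltW | exact: hN].
suff adj : adjoint f g by exists (Bop (ex_intro _ _ adj)) => e /hf.
apply: ip_adjoint => x y; apply/eqP; rewrite -subr_eq0; apply/eqP/Normc.eq0_normc/eqP.
rewrite eq_le normc_ge0 andbT; apply/ler_addgt0Pr => e e0; rewrite add0r.
pose q := 2 * (hnorm x * hnorm y) + 1.
have xy : 0 <= hnorm x * hnorm y by rewrite mulr_ge0 ?hnorm_ge0.
have q0 : 0 < q by rewrite /q; lra.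
have [N1 h1] := hf _ (divr_gt0 e0 q0); have [N2 h2] := hg _ (divr_gt0 e0 q0).
have := h1 _ (leq_maxl N1 N2) x; have := h2 _ (leq_maxr N1 N2) y.
set n := maxn N1 N2 => k2 k1.
have -> : ip (f x) y - ip x (g y) = ip (f x - T n x) y + ip x (badj (T n) y - g y).
  by rewrite ipBl ipB ip_adj subrKA.
apply: le_trans (ler_normcD _ _) _.
have l1 := le_trans (cauchy_schwarz (f x - T n x) y)
  (ler_wpM2r (hnorm_ge0 y) _ : _ <= e / q * hnorm x * hnorm y).
have {}l1 := l1 (_ : _ <= _).
have {}l1 : Normc.normc (ip (f x - T n x) y) <= e / q * (hnorm x * hnorm y).
  by rewrite mulrA; apply: l1; rewrite hdistC.
have l2 : Normc.normc (ip x (badj (T n) y - g y)) <= e / q * (hnorm x * hnorm y).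
  by rewrite mulrCA; apply: le_trans (cauchy_schwarz _ _) _; rewrite ler_wpM2l ?hnorm_ge0.
apply: le_trans (lerD l1 l2) _.
rewrite -mulrDr mulrAC ler_pdivrMr// ler_wpM2l ?(ltW e0)// /q; lra.
Qed.

(* As in [cstar_sqrt], 1 - k is a square root of 1 - h. *)
Lemma bop_sqrt (h C1 C2 : bop H) (r : R) : badj h = h -> 0 <= r < 1 -> bnd h r ->
  h * C1 = C1 * h -> h * C2 = C2 * h ->
  exists k, [/\ badj k = k, bnd k r, k * C1 = C1 * k, k * C2 = C2 * k &
    (1 - k) * (1 - k) = 1 - h].
Proof.
move=> hs r01 hr hC1 hC2; have [/andP[r0 r1]] := (r01, I) => _.
pose D T S (c : R) := bnd (T - S) c.
(* Commutation with [C1] and [C2] is made part of the invariant set: the root must later commute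
   with the operator it is divided out of and with the projection. *)
pose S T := [/\ badj T = T, bnd T r, T * C1 = C1 * T & T * C2 = C2 * T].
pose f k : bop H := (2^-1 : R)%:C *: (h + k * k).
have Dxx T : D T T 0 by move=> x; rewrite subrr hnorm0 mul0r.
have Dsym T T' c : D T T' c -> D T' T c by move=> hT; rewrite /D -opprB; exact: bndN.
have Dtri T T' T'' a b : D T T' a -> D T' T'' b -> D T T'' (a + b).
  by move=> h1 h2; have := bndD h1 h2; rewrite subrKA.
have Dle T T' a b : a <= b -> D T T' a -> D T T' b by exact: bnd_le.
have comm_lim (T : nat -> bop H) U C : (forall n, T n * C = C * T n) ->
    (forall e : R, 0 < e -> exists N, forall n, (N <= n)%N -> bnd (T n - U) e) ->
    U * C = C * U.
  move=> hT hU; apply/eqP; rewrite -subr_eq0; apply/eqP/bnd_lt_eps => e e0.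
  have [c c0 hc] := bop_bounded C.
  have q0 : 0 < 2 * c + 1 by lra.
  have [N /(_ N (leqnn N)) hN] := hU _ (divr_gt0 e0 q0).
  have -> : U * C - C * U = C * (T N - U) - (T N - U) * C.
    by rewrite mulrBr mulrBl hT [in RHS]opprB [RHS]addrC subrKA.
  have e1 : 0 <= e / (2 * c + 1) by rewrite divr_ge0 ?ltW.
  apply: bnd_le (bndD (bndM c0 hc hN) (bndN (bndM e1 hN hc))).
  have -> : c * (e / (2 * c + 1)) + e / (2 * c + 1) * c = e * (2 * c) / (2 * c + 1) by ring.
  by rewrite ler_pdivrMr// ler_wpM2l ?(ltW e0)//; lra.
have Dc (T : nat -> bop H) : (forall n, S (T n)) ->
    (forall e, 0 < e -> exists N, forall m n, (N <= m)%N -> (N <= n)%N ->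
      D (T m) (T n) e) ->
    exists l, S l /\ forall e, 0 < e -> exists N, forall n, (N <= n)%N -> D (T n) l e.
  move=> ST /bop_complete [l hl]; exists l; split=> //; split.
  - apply/eqP; rewrite -subr_eq0; apply/eqP/bnd_lt_eps => e e0.
    have e2 : 0 < e / 2 by rewrite divr_gt0.
    have [N /(_ N (leqnn N)) hN] := hl _ e2; have [sN _ _ _] := ST N.
    have -> : badj l - l = - badj (T N - l) + (T N - l).
      by rewrite badjD badjN sN opprB subrKA.
    rewrite [e]splitr; apply: bndD => //; apply: bndN; apply: bnd_adj => //.
    exact: ltW.
  - move=> x; apply/ler_addgt0Pr => e e0.
    have q : 0 < hnorm x + 1 by rewrite ltr_wpDl ?hnorm_ge0.
    have [N /(_ N (leqnn N)) hN] := hl _ (divr_gt0 e0 q); have [_ bN _ _] := ST N.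
    have -> : l x = T N x - (T N - l) x by rewrite bDE bNE opprB addrC subrK.
    apply: le_trans (hnormB _ _) _; apply: lerD; first exact: bN.
    apply: le_trans (hN x) _.
    by rewrite mulrAC ler_pdivrMr// ler_wpM2l ?(ltW e0)// lerDl.
  - by apply: comm_lim hl => n; have [] := ST n.
  - by apply: comm_lim hl => n; have [] := ST n.
have n2 (c : R) : 0 <= c -> Normc.normc ((2^-1 : R)%:C) * (c + c) = c.
  by move=> c0; rewrite normcR ger0_norm ?invr_ge0//; field.
have fC T C : T * C = C * T -> h * C = C * h -> f T * C = C * f T.
  move=> hT hC; rewrite /f -bscaleAl -bscaleAr mulrDl mulrDr hC; congr (_ *: (_ + _)).
  by rewrite -mulrA hT mulrA hT mulrA.
have Sf T : S T -> S (f T).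
  move=> [sT bT c1 c2]; split; [| | exact: fC | exact: fC].
    by rewrite /f badjZ badjD badjM hs sT conjc_real.
  rewrite -(n2 r r0); apply: bndZ; apply: bndD => //.
  apply: bnd_le (bndM r0 bT bT).
  by rewrite -[leRHS]mulr1 ler_wpM2l// ltW.
have Df T T' c : S T -> S T' -> 0 <= c -> D T T' c -> D (f T) (f T') (r * c).
  move=> [_ bT _ _] [_ bT' _ _] c0 TT'.
  have e : f T - f T' = (2^-1 : R)%:C *: (T * (T - T') + (T - T') * T').
    rewrite /f -scalerBr; congr (_ *: _).
    by rewrite opprD addrACA subrr add0r mulrBr mulrBl addrA subrK.
  rewrite /D e -(n2 (r * c)) ?mulr_ge0//; apply: bndZ; apply: bndD; first exact: bndM.
  by rewrite [r * c]mulrC; exact: bndM.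
have S0 : S 0.
  split; rewrite ?mul0r ?mulr0//; last first.
    by move=> x; rewrite hnorm0 mulr_ge0 ?hnorm_ge0.
  by apply: badj_uniq => x y; rewrite !b0E ip0 ip0l.
have [c c0 hc] := bop_bounded (0 - f 0).
have [k [[ks kr k1 k2] hk]] := contraction_fixpoint Dxx Dsym Dtri Dle Dc c0 r01 S0 Sf Df hc.
have fk : f k = k by apply/eqP; rewrite -subr_eq0; apply/eqP/bnd_lt_eps.
exists k; split=> //.
have h2 : h + k * k = k + k.
  have := congr1 (fun x : bop H => (2 : R)%:C *: x) fk.
  rewrite /f scalerA -RcM divff// scale1r => ->.
  by rewrite RcD scalerDl scale1r.
rewrite mulrBr mulr1 mulrBl mul1r -[in RHS](addrK (k * k) h) h2.
by rewrite -[LHS]addrA -opprD addrA.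
Qed.
End OperatorLimits.

(** * Symmetries commuting with a projection *)

Section Symmetries.
Variables (R : realType) (H : hilbMod R pt).
Local Open Scope complex_scope.
Implicit Types T S U P G : bop H.

(* L = sum_i <e_i, .> e_i over a basis e of ker G is positive of finite rank and
   makes G + L injective. *)
Lemma kernel_filling G P : badj G = G -> badj P = P -> G * P = P * G ->
  G * (1 - P) = 1 - P -> ceq (G * G) 1 ->
  exists L, [/\ badj L = L, compactOp L, L * P = P * L &
    forall x, (G + L) x = 0 -> x = 0].
Proof.
move=> Gs Ps GP G1P G2.
(* [G] is its own inverse modulo compacts, so its kernel has a finite basis. *)
have [k [[m [n [[e [he hspan]] _ _]]] _]] := idx_parametrix G2 G2.
pose s := [seq (e i, e i) | i <- enum 'I_m].
pose L := bfinrank s.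
have LE x : L x = \sum_(i < m) ip (e i) x *: e i by rewrite /L /= /s big_map big_enum.
have Ge i : G (e i) = 0 by have [] := he i.
have GL : G * L = 0.
  apply: bop_eq => x; rewrite bME LE bop_sum b0E big1// => i _.
  by rewrite bopZ Ge scaler0.
(* [G] is the identity on the range of 1 - P, so its kernel lies in the range of [P]. *)
have Pe i : P (e i) = e i.
  have : (1 - P) (e i) = 0.
    by rewrite -G1P mulrBr mulr1 GP bDE bNE bME Ge bop0 subrr.
  by rewrite bDE bNE b1E => /eqP; rewrite subr_eq0 => /eqP <-.
have Ls : badj L = L.
  apply: badj_uniq => x y; rewrite !LE.
  rewrite (big_morph (fun u => ip u y) (fun u v => ipDl u v y) (ip0l y)).
  rewrite (big_morph (fun u => ip x u) (fun u v => ipD x u v) (ip0 x)).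
  by apply: eq_bigr => i _; rewrite ipZl ipZ -ipC mulrC.
have PL : P * L = L.
  apply: bop_eq => x; rewrite bME LE bop_sum; apply: eq_bigr => i _.
  by rewrite bopZ Pe.
have LP : L * P = L by rewrite -Ls -[X in _ * X]Ps -badjM PL.
have LG : L * G = 0.
  rewrite -Ls -[X in _ * X]Gs -badjM GL.
  by apply: badj_uniq => x y; rewrite !b0E ip0 ip0l.
exists L; split=> //; [exact: cpt_bfinrank | by rewrite PL LP |].
(* The cross terms G L and L G vanish, so G x = 0 and L x = 0 separately. Then <x, L x> is the sum
   of the squares of the |<e_i, x>|, and [x] is orthogonal to the kernel it belongs to. *)
move=> x hx; have h2 : ip x ((G + L) ((G + L) x)) = ip (G x) (G x) + ip (L x) (L x).
  rewrite -bME mulrDr !mulrDl GL LG add0r addr0 bDE !bME ipD.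
  by rewrite -[in RHS]Gs -[in RHS]Ls !ip_adj !badjK Gs Ls.
move: h2; rewrite hx bop0 ip0 => /esym/eqP.
rewrite paddr_eq0 ?ipxx_ge0// => /andP[/eqP gx /eqP lx].
have {}gx : G x = 0 by apply: hm_ip_eq0 => -[].
have {}lx : L x = 0 by apply: hm_ip_eq0 => -[].
have ex i : ip (e i) x = 0.
  have : ip x (L x) = \sum_(i < m) (Normc.normc (ip (e i) x) ^+ 2)%:C.
    rewrite LE (big_morph (fun u => ip x u) (fun u v => ipD x u v) (ip0 x)).
    by apply: eq_bigr => j _; rewrite ipZ (ipC (e j) x) normc_sqr.
  rewrite lx ip0 => /esym/eqP; rewrite psumr_eq0; last first.
    by move=> j _; rewrite ler0c sqr_ge0.
  move=> /allP /(_ i); rewrite mem_index_enum => /(_ isT) /=.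
  move=> /eqP /complexI /eqP; rewrite sqrf_eq0 => /eqP.
  exact: Normc.eq0_normc.
have [c [hc _]] := hspan x (conj Logic.I gx).
have xe : x = \sum_(i < m) c i *: e i by apply/eqP; rewrite -subr_eq0; apply/eqP.
apply: hm_ip_eq0 => -[]; rewrite -/(ip x x) {2}xe.
rewrite (big_morph (fun u => ip x u) (fun u v => ipD x u v) (ip0 x)) big1// => i _.
by rewrite ipZ ipC ex conjc0 mulr0.
Qed.

Lemma idx_injective_surj T : idx T 0 -> (forall x, T x = 0 -> x = 0) ->
  forall y, exists x, T x = y.
Proof.
move=> [m [n [hm hn e0]]] inj y.
have k0 : [set x | [set: H] x /\ T x = 0] = [set 0].
  apply/seteqP; split=> [x [_ /inj] //|x ->]; split=> //; exact: bop0.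
have m0 : m = 0%N.
  rewrite k0 in hm; apply: (qdim_uniq (@subsp0 _ H) (@subsp0 _ H) hm).
  exists (fun=> 0); split; first by case.
  move=> _ ->; exists (fun=> 0); split; first by rewrite big_ord0 subr0.
  by move=> c _; apply/funext; case.
have {}e0 : n = 0%N by move: e0; rewrite m0 sub0r => /esym/eqP; rewrite oppr_eq0 => /eqP [].
subst n; have [e [_ /(_ y Logic.I) [c [[x _ hx] _]]]] := hn.
by exists x; rewrite hx big_ord0 subr0.
Qed.

(** Polar decomposition of G' = G + L: U = G'^-1 |G'|, where |G'| is the square root of G'^2. All
    factors commute with each other and with [P], and |G'| - 1 is compact, so U agrees with [G]
    modulo compacts. *)
Lemma symmetry_approx G P : badj G = G -> badj P = P -> G * P = P * G ->
  G * (1 - P) = 1 - P -> ceq (G * G) 1 ->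
  exists U, [/\ badj U = U, U * U = 1, U * P = P * U & ceq G U].
Proof.
move=> Gs Ps GP G1P G2.
have [L [Ls cL LP inj]] := kernel_filling Gs Ps GP G1P G2.
set G' := G + L in inj.
have G's : badj G' = G' by rewrite /G' badjD Gs Ls.
have GG' : ceq G G' by rewrite /ceq /G' opprD addrA subrr add0r; exact: cptN.
have G'P : G' * P = P * G' by rewrite /G' mulrDl mulrDr GP LP.
(* [D] is 1 modulo compacts, hence of index 0; being injective it is onto, and so is [G']. *)
pose D := G' * G'.
have D1 : ceq D 1 by apply: ceq_trans G2; apply: ceq_sym; exact: ceqM.
have Dsurj := idx_injective_surj (idx_ceq1 D1) (fun x h => inj x (inj _ h)).
have surj y : exists x, G' x = y by have [x hx] := Dsurj y; exists (G' x).
pose J0 y := sval (cid (surj y)).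
have GJ0 y : G' (J0 y) = y := svalP (cid (surj y)).
have adjJ : adjoint J0 J0 by apply: (inv_adjoint (T := G')) => // y; rewrite G's.
pose J : bop H := Bop (ex_intro _ _ adjJ).
have GJ : G' * J = 1 by apply: bop_eq => y; exact: GJ0.
have JG : J * G' = 1.
  apply: bop_eq => y; apply/eqP; rewrite -subr_eq0; apply/eqP/inj.
  by rewrite bopB -!bME mulrA GJ mul1r mulr1 subrr.
have Js : badj J = J by apply: badj_uniq => x y; exact: (adjointP adjJ).
have [b0 b00 hb0] := bop_bounded G'; have [c0 c00 hc0] := bop_bounded J.
(* The added 1 gives b, c >= 1, which places [q] below in [0, 1). *)
pose b := b0 + 1; pose c := c0 + 1.
have hb : bnd G' b by apply: bnd_le hb0; rewrite lerDl.
have hc : bnd J c by apply: bnd_le hc0; rewrite lerDl.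
have b1 : 1 <= b by rewrite lerDr. have c1 : 1 <= c by rewrite lerDr.
have bp : 0 < b by exact: lt_le_trans b1. have cp : 0 < c by exact: lt_le_trans c1.
(* With t = b^-2, ||h x||^2 = ||x||^2 - 2 t ||G' x||^2 + t^2 ||D x||^2 is at most ||x||^2 - t ||G'
   x||^2, as [b] bounds [G'], hence at most (1 - (b c)^-2) ||x||^2, as [c] bounds its inverse. So
   [bop_sqrt] applies and b (1 - k) is a square root of [D]. *)
pose h : bop H := 1 - ((b ^+ 2)^-1)%:C *: D.
have Dadj : badj D = D by rewrite badjM G's.
have hs : badj h = h by rewrite /h badjD badj1 badjN badjZ Dadj conjc_real.
pose q := 1 - (b * c) ^- 2.
have q0 : 0 <= q.
  by rewrite subr_ge0 invf_le1 ?exprn_gt0 ?mulr_gt0// exprn_ege1// mulr_ege1.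
have q1 : q < 1 by rewrite ltrBlDr ltrDl invr_gt0 exprn_gt0 ?mulr_gt0.
pose r := Num.sqrt q.
have r0 : 0 <= r by exact: sqrtr_ge0.
have r1 : r < 1 by rewrite -(@sqrtr1 R) ltr_sqrt.
have hr : bnd h r.
  move=> x; rewrite -(@ler_pXn2r _ 2)// ?nnegrE ?mulr_ge0 ?hnorm_ge0//.
  rewrite (hnorm_sqr (h x)) exprMn [r ^+ 2]sqr_sqrtr//.
  set t := (b ^+ 2)^-1; have tp : 0 < t by rewrite invr_gt0 exprn_gt0.
  have -> : complex.Re (ip (h x) (h x)) =
      hnorm x ^+ 2 - 2 * t * hnorm (G' x) ^+ 2 + t ^+ 2 * hnorm (D x) ^+ 2.
    have e1 : ip x (D x) = (hnorm (G' x) ^+ 2)%:C.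
      by rewrite -ipxxE [RHS]ip_adj G's.
    have e2 : ip (D x) x = (hnorm (G' x) ^+ 2)%:C by rewrite ip_adj Dadj.
    have -> : h x = x - t%:C *: D x by [].
    rewrite ipB !ipBl !ipZ !ipZl conjc_real e1 e2 !ipxxE.
    have key (u v w z : R) : complex.Re (u%:C - v%:C - (w%:C - z%:C)) = u - v - (w - z) by [].
    by rewrite -!RcM key; ring.
  have n1 : hnorm (D x) ^+ 2 <= b ^+ 2 * hnorm (G' x) ^+ 2.
    rewrite -exprMn ler_pXn2r ?nnegrE ?mulr_ge0 ?hnorm_ge0 ?(ltW bp)//.
    exact: hb.
  have n2 : hnorm x ^+ 2 <= c ^+ 2 * hnorm (G' x) ^+ 2.
    rewrite -exprMn ler_pXn2r ?nnegrE ?mulr_ge0 ?hnorm_ge0 ?(ltW cp)//.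
    by have := hc (G' x); rewrite -bME JG.
  have n3 : t ^+ 2 * hnorm (D x) ^+ 2 <= t * hnorm (G' x) ^+ 2.
    apply: le_trans (ler_wpM2l (sqr_ge0 t) n1) _.
    by rewrite mulrA expr2 -(mulrA t t) [t * b ^+ 2]mulVf ?mulr1// gt_eqF ?exprn_gt0.
  have n4 : t * (c ^+ 2)^-1 * hnorm x ^+ 2 <= t * hnorm (G' x) ^+ 2.
    by rewrite -mulrA ler_pM2l// ler_pdivrMl ?exprn_gt0.
  have -> : q = 1 - t * (c ^+ 2)^-1 by rewrite /q /t exprMn invfM.
  lra.
have r01 : 0 <= r < 1 by rewrite r0.
have hcomm C : G' * C = C * G' -> h * C = C * h.
  move=> hC; rewrite /h mulrBl mulrBr mul1r mulr1 -bscaleAl -bscaleAr; congr (_ - _ *: _).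
  by rewrite /D -mulrA hC mulrA hC mulrA.
have [k [ks kr kG kP kk]] := bop_sqrt hs r01 hr (hcomm G' erefl) (hcomm P G'P).
pose S : bop H := b%:C *: (1 - k).
have SS : S * S = D.
  rewrite /S -bscaleAl -bscaleAr scalerA kk /h opprB addrC subrK scalerA.
  by rewrite -!RcM -expr2 divff ?scale1r// gt_eqF ?exprn_gt0.
have Sadj : badj S = S by rewrite /S badjZ conjc_real badjD badj1 badjN ks.
have Scomm C : k * C = C * k -> S * C = C * S.
  by move=> hC; rewrite /S -bscaleAl -bscaleAr mulrBl mulrBr mul1r mulr1 hC.
have SG := Scomm _ kG; have SP := Scomm _ kP.
have JS : J * S = S * J.
  rewrite -[LHS]mulr1 -GJ -mulrA [S * _]mulrA SG -mulrA mulrA.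
  by rewrite mulrA JG mul1r.
have JP : J * P = P * J.
  by rewrite -[LHS]mulr1 -GJ -mulrA [P * _]mulrA -G'P -mulrA mulrA mulrA JG mul1r.
(* D - 1 = (S - 1)(S + 1) is compact, and S + 1 = (1 + b)(1 - b/(1 + b) k) is invertible because [k]
   has bound r < 1. *)
have S1 : ceq S 1.
  have b1p : 0 < 1 + b by rewrite ltr_wpDr// ltW.
  pose V : bop H := 1 - (b / (1 + b))%:C *: k.
  have hV : bnd (V - 1) r.
    rewrite /V addrAC subrr add0r; apply: bndN.
    apply: bnd_le (bndZ _ kr); rewrite normcR ger0_norm ?divr_ge0 ?(ltW bp) ?(ltW b1p)//.
    by rewrite ler_piMl// ler_pdivrMr// mul1r lerDr.
  have [W [VW WV]] := neumann r01 hV.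
  have e : S + 1 = (1 + b)%:C *: V.
    rewrite /V scalerBr scalerA -RcM mulrCA divff ?mulr1 ?gt_eqF//.
    by rewrite RcD scalerDl scale1r /S scalerBr addrC addrA.
  have e2 : S - 1 = (D - 1) * ((1 + b)^-1%:C *: W).
    have -> : D - 1 = (S - 1) * (S + 1).
      by rewrite mulrBl mul1r !mulrDr mulr1 SS opprD addrA addrK.
    have e1 : (S + 1) * ((1 + b)^-1%:C *: W) = 1.
      by rewrite e -bscaleAl -bscaleAr scalerA VW -RcM divff ?scale1r// gt_eqF.
    by rewrite -mulrA e1 mulr1.
  by rewrite /ceq e2; exact: cptMr.
exists (J * S); split.
- by rewrite badjM Sadj Js JS.
- by rewrite {2}JS mulrA -(mulrA J) SS /D mulrA JG mul1r GJ.
- by rewrite -mulrA SP mulrA JP mulrA.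
- apply: ceq_trans GG' _.
  have -> : G' = J * S * S by rewrite -mulrA SS /D mulrA JG mul1r.
  by rewrite -[X in ceq _ X]mulr1; exact: ceqMl.
Qed.
End Symmetries.

(** * A symmetry equal to F modulo compacts on the range of 1 *)

Section KasparovSymmetry.
Variables (R : realType) (A : starAlgType R) (M : kasMod A pt).
Local Open Scope complex_scope.

Lemma kas_symmetry : exists U : bop M, [/\ badj U = U, U * U = 1,
  U * rho M 1 = rho M 1 * U & ceq (rho M 1 * kasF M) (rho M 1 * U)].
Proof.
set P := rho M 1; set F := kasF M.
have PP : P * P = P by rewrite /P rho1l.
have Ps : badj P = P by rewrite badj_rho star1.
have FP : ceq (F * P) (P * F) by exact: rho_comm.
have FF : ceq (P * F * F) P by exact: rho_sq.
have FS : ceq (P * F) (P * badj F) by exact: rho_sa.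
pose X : bop M := (2^-1 : R)%:C *: (P * F * P + P * badj F * P).
have h2 (T : bop M) : (2^-1 : R)%:C *: (T + T) = T.
  have -> : T + T = (2 : R)%:C *: T by rewrite RcD scalerDl scale1r.
  by rewrite scalerA -RcM mulVf// scale1r.
have PX : P * X = X by rewrite /X -bscaleAr mulrDr !mulrA PP.
have XP : X * P = X by rewrite /X -bscaleAl mulrDl -!mulrA PP.
have Xs : badj X = X.
  rewrite /X badjZ conjc_real badjD !badjM !badjK Ps !mulrA addrC.
  by rewrite -!mulrA.
have XF : ceq X (P * F).
  have h : ceq (P * F * P) (P * F).
    by rewrite -mulrA; apply: ceq_trans (ceqMl P FP) _; rewrite mulrA PP; exact: ceq_refl.
  rewrite -(h2 (P * F)); apply: ceqZ; apply: ceqD => //.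
  by apply: ceq_trans h; apply: ceqMr; exact: ceq_sym.
pose G := X + (1 - P).
have PQ : P * (1 - P) = 0 by rewrite mulrBr mulr1 PP subrr.
have QP : (1 - P) * P = 0 by rewrite mulrBl mul1r PP subrr.
have XQ : X * (1 - P) = 0 by rewrite mulrBr mulr1 XP subrr.
have QX : (1 - P) * X = 0 by rewrite mulrBl mul1r PX subrr.
have QQ : (1 - P) * (1 - P) = 1 - P by rewrite [LHS]mulrBl mul1r PQ subr0.
have PG : P * G = X by rewrite mulrDr PX PQ addr0.
have GP : G * P = X by rewrite mulrDl XP QP addr0.
have GQ : G * (1 - P) = 1 - P by rewrite mulrDl XQ QQ add0r.
have Gs : badj G = G by rewrite badjD Xs badjD badjN badj1 Ps.
have GG : ceq (G * G) 1.
  have -> : G * G = X * X + (1 - P).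
    have dd (a b : bop M) : (a + b) * (a + b) = a * a + a * b + (b * a + b * b).
      by rewrite mulrDl !mulrDr.
    by rewrite /G dd XQ QX QQ addr0 add0r.
  apply: (@ceq_trans _ _ (P + (1 - P))); last by rewrite addrC subrK; exact: ceq_refl.
  apply: ceqD; last exact: ceq_refl.
  apply: ceq_trans (ceqM XF XF) _; apply: ceq_trans FF.
  rewrite -mulrA [F * (_ * _)]mulrA; apply: ceq_trans (ceqMl P (ceqMr F FP)) _.
  by rewrite !mulrA PP; exact: ceq_refl.
have [U [Us UU UP GU]] := symmetry_approx Gs Ps (etrans GP (esym PG)) GQ GG.
exists U; split=> //; apply: ceq_trans (ceq_sym XF) _.
by rewrite -PG; exact: ceqMl.
Qed.
End KasparovSymmetry.

(** * Paths in a Hilbert space as a C([0,1])-module *)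

Section PathSpace.
Variables (R : realType) (H : hilbMod R pt).
Local Open Scope complex_scope.
Local Notation normc := Normc.normc.
Local Notation I01 := (seg01 R).

Definition hcont (x : I01 -> H) := forall (t : I01) (e : R), 0 < e ->
  exists2 d : R, 0 < d & forall s : I01, `|val s - val t| < d -> hnorm (x s - x t) < e.

Lemma hcont_cst (y : H) : hcont (fun=> y).
Proof. by move=> t e e0; exists 1 => // s _; rewrite subrr hnorm0. Qed.

Lemma hcontD (x y : I01 -> H) : hcont x -> hcont y -> hcont (fun t => x t + y t).
Proof.
move=> hx hy t e e0; have e2 : 0 < e / 2 by rewrite divr_gt0.
have [d1 p1 h1] := hx t _ e2; have [d2 p2 h2] := hy t _ e2.
exists (Num.min d1 d2); first by rewrite lt_min p1.
move=> s; rewrite lt_min => /andP[/h1 k1 /h2 k2].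
rewrite opprD addrACA (le_lt_trans (hnormD _ _))//.
by rewrite [e]splitr ltrD.
Qed.

Lemma continuousC_dist (f : I01 -> R[i]) : continuous (f : I01 -> R[i]^o) <->
  forall (t : I01) (e : R), 0 < e -> exists2 d : R, 0 < d &
    forall s : I01, `|val s - val t| < d -> normc (f s - f t) < e.
Proof.
split=> [/continuousCP h t e e0|h]; first by apply/seg_nearP; exact: h.
by apply/continuousCP => t e e0; apply/seg_nearP; exact: h.
Qed.

Lemma hcont_scale (f : I01 -> R[i]) (x : I01 -> H) :
  continuous (f : I01 -> R[i]^o) -> hcont x -> hcont (fun t => f t *: x t).
Proof.
move=> /continuousC_dist hf hx t e e0.
pose K := normc (f t) + hnorm (x t) + 1.
have K0 : 0 < K by rewrite ltr_wpDl// addr_ge0 ?normc_ge0 ?hnorm_ge0.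
pose q := Num.min 1 (e / K).
have q0 : 0 < q by rewrite lt_min ltr01 divr_gt0.
have [d1 p1 h1] := hf t _ q0; have [d2 p2 h2] := hx t _ q0.
exists (Num.min d1 d2); first by rewrite lt_min p1.
move=> s; rewrite lt_min => /andP[/h1 k1 /h2 k2].
have -> : f s *: x s - f t *: x t = (f s - f t) *: x s + f t *: (x s - x t).
  by rewrite scalerBl scalerBr addrA subrK.
rewrite (le_lt_trans (hnormD _ _))// !hnormZ.
have q1 : q <= 1 by rewrite ge_min lexx.
have xs : hnorm (x s) <= hnorm (x t) + 1.
  rewrite -[x s](subrK (x t)) addrC (le_trans (hnormD _ _))// lerD2l.
  by rewrite ltW// (lt_le_trans k2).
have qe : q * K <= e by rewrite -ler_pdivlMr// ge_min lexx orbT.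
have a1 : normc (f s - f t) * hnorm (x s) <= q * (hnorm (x t) + 1).
  by rewrite ler_pM ?normc_ge0 ?hnorm_ge0// ltW.
have [f0|f0] := eqVneq (normc (f t)) 0.
  rewrite f0 mul0r addr0; have [x0|x0] := eqVneq (hnorm (x s)) 0.
    by rewrite x0 mulr0.
  have xp : 0 < hnorm (x s) by rewrite lt_def x0 hnorm_ge0.
  have : normc (f s - f t) * hnorm (x s) < q * hnorm (x s) by rewrite ltr_pM2r.
  move=> l; apply: lt_le_trans l _; apply: le_trans qe.
  by rewrite ler_pM2l// /K f0 add0r.
have fp : 0 < normc (f t) by rewrite lt_def f0 normc_ge0.
have a2 : normc (f t) * hnorm (x s - x t) < normc (f t) * q by rewrite ltr_pM2l.
apply: lt_le_trans (ler_ltD a1 a2) _; apply: le_trans qe.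
by rewrite /K [leLHS]addrC mulrC -mulrDr addrA.
Qed.

Variable Z : bool.

(** With [Z] true the paths vanish at the endpoint 1, which yields the module contracting a
    degenerate cycle to zero; with [Z] false all continuous paths are taken. *)
Definition hpathSet : set (I01 -> H) := [set x | hcont x /\ (Z -> x (seg1 R) = 0)].

Lemma hpathSet_closed : GRing.submod_closed (mem hpathSet : {pred I01 -> H}).
Proof.
split; first by rewrite inE; split=> //; exact: hcont_cst.
move=> c x y; rewrite !inE => -[hx zx] [hy zy]; split.
  apply: hcontD => //; apply: hcont_scale => //; exact: cst_continuous.
move=> z; rewrite -[LHS]/(c *: x (seg1 R) + y (seg1 R)) zx// zy//.
by rewrite scaler0 addr0.
Qed.

Record hpath := HPath {
  hpval : I01 -> H;
  hpvalP : hpval \in (mem hpathSet : {pred I01 -> H})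
}.
HB.instance Definition _ := [isSub of hpath for hpval].
HB.instance Definition _ := [Choice of hpath by <:].
HB.instance Definition _ :=
  GRing.SubChoice_isSubLmodule.Build R[i] (I01 -> H) (mem hpathSet : {pred I01 -> H}) hpath
    (GRing.submod_closed_semi hpathSet_closed).

Lemma hpath_cont (x : hpath) : hcont (hpval x).
Proof. by have := hpvalP x; rewrite inE => -[]. Qed.
Lemma hpath_end (x : hpath) : Z -> hpval x (seg1 R) = 0.
Proof. by have := hpvalP x; rewrite inE => -[]. Qed.
Lemma hpath_eq (x y : hpath) : (forall t, hpval x t = hpval y t) -> x = y.
Proof. by move=> h; apply: val_inj; apply/funext. Qed.

(** The default 0 makes this total: [hm_act] has to be defined for discontinuous functions too. *)
Definition mkpath (f : I01 -> H) : hpath :=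
  match pselect (f \in (mem hpathSet : {pred I01 -> H})) with
  | left h => HPath h
  | right _ => 0
  end.

Lemma mkpathE f : hcont f -> (Z -> f (seg1 R) = 0) -> hpval (mkpath f) = f.
Proof.
move=> hf zf; rewrite /mkpath; case: pselect => // -[].
by rewrite inE.
Qed.

Definition hp_act (f : I01 -> R[i]) (x : hpath) : hpath := mkpath (fun t => f t *: hpval x t).
Definition hp_ip (x y : hpath) (t : I01) : R[i] := ip (hpval x t) (hpval y t).

Lemma hp_cont x y : continuous (hp_ip x y : I01 -> R[i]^o).
Proof.
apply/continuousC_dist => t e e0.
pose K := hnorm (hpval x t) + hnorm (hpval y t) + 1.
have K0 : 0 < K by rewrite ltr_wpDl// addr_ge0 ?hnorm_ge0.
pose q := Num.min 1 (e / (2 * K)).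
have q0 : 0 < q by rewrite lt_min ltr01 divr_gt0// mulr_gt0.
have [d1 p1 h1] := hpath_cont x t q0; have [d2 p2 h2] := hpath_cont y t q0.
exists (Num.min d1 d2); first by rewrite lt_min p1.
move=> s; rewrite lt_min => /andP[/h1 k1 /h2 k2].
have -> : hp_ip x y s - hp_ip x y t =
    ip (hpval x s - hpval x t) (hpval y s) + ip (hpval x t) (hpval y s - hpval y t).
  by rewrite ipBl ipB addrA subrK.
apply: le_lt_trans (ler_normcD _ _) _.
have q1 : q <= 1 by rewrite ge_min lexx.
have ys : hnorm (hpval y s) <= hnorm (hpval y t) + 1.
  rewrite -[hpval y s](subrK (hpval y t)) addrC (le_trans (hnormD _ _))// lerD2l.
  by rewrite ltW// (lt_le_trans k2).
have qe : q * (2 * K) <= e by rewrite -ler_pdivlMr ?mulr_gt0// ge_min lexx orbT.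
have a1 := le_trans (cauchy_schwarz (hpval x s - hpval x t) (hpval y s))
  (ler_pM (hnorm_ge0 _) (hnorm_ge0 _) (ltW k1) ys).
have a2 := le_trans (cauchy_schwarz (hpval x t) (hpval y s - hpval y t))
  (ler_wpM2l (hnorm_ge0 _) (ltW k2)).
apply: le_lt_trans (lerD a1 a2) _; apply: lt_le_trans qe.
have -> : q * (hnorm (hpval y t) + 1) + hnorm (hpval x t) * q = q * K by rewrite /K; ring.
by rewrite ltr_pM2l// ltr_pMl// ltr1n.
Qed.

Lemma hp_ipD x y z t : hp_ip x (y + z) t = hp_ip x y t + hp_ip x z t.
Proof. exact: ipD. Qed.
Lemma hp_ipZ x (c : R[i]) y t : hp_ip x (c *: y) t = c * hp_ip x y t.
Proof. exact: ipZ. Qed.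
Lemma hp_ipC x y t : hp_ip y x t = Num.conj (hp_ip x y t).
Proof. exact: hm_ipC. Qed.
Lemma hp_act_ip x (f : I01 -> R[i]) y t : continuous (f : I01 -> R[i]^o) ->
  hp_ip x (hp_act f y) t = f t * hp_ip x y t.
Proof.
move=> cf; rewrite /hp_ip /hp_act mkpathE; first exact: ipZ.
  by apply: hcont_scale => //; exact: hpath_cont.
by move=> z; rewrite hpath_end// scaler0.
Qed.
Lemma hp_ip_ge0 x t : 0 <= hp_ip x x t.
Proof. exact: ipxx_ge0. Qed.
Lemma hp_ip_eq0 x : (forall t, hp_ip x x t = 0) -> x = 0.
Proof. by move=> h; apply: hpath_eq => t; apply: hm_ip_eq0 => -[]; exact: h. Qed.

Lemma hp_norm_leE x (c : R) : 0 <= c ->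
  (forall t, hp_ip x x t <= (c ^+ 2)%:C) <-> (forall t, hnorm (hpval x t) <= c).
Proof.
move=> c0; split=> h t.
  by have := h t; rewrite /hp_ip ipxxE lecR ler_pXn2r ?nnegrE ?hnorm_ge0.
by rewrite /hp_ip ipxxE lecR ler_pXn2r ?nnegrE ?hnorm_ge0.
Qed.

Lemma hp_complete (a : nat -> hpath) :
  (forall e : R, 0 < e -> exists N : nat, forall m n : nat,
     (N <= m)%N -> (N <= n)%N ->
     forall t, hp_ip (a m - a n) (a m - a n) t <= (e ^+ 2)%:C) ->
  exists l : hpath, forall e : R, 0 < e -> exists N : nat, forall n : nat,
    (N <= n)%N -> forall t, hp_ip (a n - l) (a n - l) t <= (e ^+ 2)%:C.
Proof.
move=> h0.
have h e : 0 < e -> exists N, forall m n, (N <= m)%N -> (N <= n)%N ->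
    forall t, hnorm (hpval (a m) t - hpval (a n) t) <= e.
  move=> e0; have [N hN] := h0 e e0; exists N => m n hm hn.
  by have /hp_norm_leE := hN m n hm hn; apply; exact: ltW.
have hl t : exists l, forall e, 0 < e -> exists N, forall n, (N <= n)%N ->
    hnorm (hpval (a n) t - l) <= e.
  by apply: hcomplete => e /h [N hN]; exists N => m n hm hn; exact: hN.
pose f t := sval (cid (hl t)).
have hf e : 0 < e -> exists N, forall n, (N <= n)%N ->
    forall t, hnorm (hpval (a n) t - f t) <= e.
  move=> e0; have [N hN] := h e e0; exists N => n hn t; apply/ler_addgt0Pr => d d0.
  have [N' hN'] := svalP (cid (hl t)) d d0.
  apply: (@hdist_tri _ _ _ (hpval (a (maxn N N')) t)).
    by apply: hN => //; exact: leq_maxl.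
  by apply: hN'; exact: leq_maxr.
have cf : hcont f.
  move=> t e e0; have e3 : 0 < e / 4 by rewrite divr_gt0.
  have [N /(_ N (leqnn N)) hN] := hf _ e3.
  have [d d0 hd] := hpath_cont (a N) t e3; exists d => // s /hd k.
  have k1 := hN s; have k2 := hN t; rewrite hdistC in k1.
  have := hdist_tri k1 (hdist_tri (ltW k) k2) => /le_lt_trans; apply; lra.
have zf : Z -> f (seg1 R) = 0.
  move=> z; apply: hnorm_lt_eps => e /hf [N /(_ N (leqnn N) (seg1 R))].
  by rewrite hpath_end// sub0r hnormN.
exists (mkpath f) => e e0; have [N hN] := hf e e0; exists N => n hn.
apply/hp_norm_leE; first exact: ltW.
move=> t; rewrite -[hpval _ t]/(hpval (a n) t - hpval (mkpath f) t) mkpathE//.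
exact: hN.
Qed.

Definition hpathM : hilbMod R I01 := @HilbMod R I01 hpath hp_act hp_ip
  hp_cont hp_ipD hp_ipZ hp_ipC hp_act_ip hp_ip_ge0 hp_ip_eq0 hp_complete.

End PathSpace.

(** * Fields of operators *)

Lemma continuousC_mul (R : realType) (X : topologicalType) (f g : X -> R[i]%C) :
  continuous (f : X -> R[i]%C^o) -> continuous (g : X -> R[i]%C^o) ->
  continuous ((fun x => f x * g x) : X -> R[i]%C^o).
Proof. by move=> cf cg x; apply: cvgM; [exact: cf | exact: cg]. Qed.

Section Fields.
Variables (R : realType) (H : hilbMod R pt).
Local Open Scope complex_scope.
Local Notation normc := Normc.normc.
Local Notation I01 := (seg01 R).
Implicit Types T S : I01 -> bop H.

(** A uniform bound and strong continuity make [T] act on continuous paths; when the adjoints form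
    such a family as well, [fieldop T] is adjointable. *)
Definition opfield T := (exists2 C : R, 0 <= C & forall t, bnd (T t) C) /\
  forall x : H, hcont (fun t => T t x).

Lemma opfield_cst (K : bop H) : opfield (fun=> K).
Proof.
split; first by have [C C0 hC] := bop_bounded K; exists C.
by move=> x; exact: hcont_cst.
Qed.

Lemma opfieldD T S : opfield T -> opfield S -> opfield (fun t => T t + S t).
Proof.
move=> [[C C0 hC] cT] [[D D0 hD] cS]; split.
  by exists (C + D); [exact: addr_ge0 | move=> t; exact: bndD].
by move=> x; exact: hcontD.
Qed.

Lemma opfieldZ (w : I01 -> R[i]) T : continuous (w : I01 -> R[i]^o) ->
  (forall t, normc (w t) <= 1) -> opfield T -> opfield (fun t => w t *: T t).
Proof.
move=> cw w1 [[C C0 hC] cT]; split.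
  exists C => // t x; rewrite bZE hnormZ; apply: le_trans (hC t x).
  by rewrite ler_piMl ?hnorm_ge0.
by move=> x; apply: (hcont_scale (x := fun t => T t x)).
Qed.

Section Act.
Variable Z : bool.
Local Notation E := (hpathM H Z).

Definition fieldop T (x : E) : E := mkpath Z (fun t => T t (hpval x t)).

Lemma opfield_path T (x : E) : opfield T -> hcont (fun t => T t (hpval x t)).
Proof.
move=> [[C C0 hC] cT] t e e0.
have e2 : 0 < e / 2 by rewrite divr_gt0.
have q0 : 0 < e / 2 / (C + 1) by rewrite divr_gt0// ltr_wpDl.
have [d1 p1 h1] := hpath_cont x t q0; have [d2 p2 h2] := cT (hpval x t) t _ e2.
exists (Num.min d1 d2); first by rewrite lt_min p1.
move=> s; rewrite lt_min => /andP[/h1 k1 /h2 k2].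
have -> : T s (hpval x s) - T t (hpval x t) =
    T s (hpval x s - hpval x t) + (T s (hpval x t) - T t (hpval x t)).
  by rewrite bopB addrA subrK.
rewrite (le_lt_trans (hnormD _ _))// [e]splitr ler_ltD//.
apply: le_trans (hC s _) _; apply: le_trans (ler_wpM2l C0 (ltW k1)) _.
by rewrite mulrCA ler_piMr ?(ltW e2)// ler_pdivrMr ?ltr_wpDl// mul1r lerDl.
Qed.

Lemma fieldopE T (x : E) t : opfield T -> hpval (fieldop T x) t = T t (hpval x t).
Proof.
move=> hT; rewrite /fieldop mkpathE//; first exact: opfield_path.
by move=> z; rewrite hpath_end// bop0.
Qed.

Lemma fieldop_adjoint T S : opfield T -> opfield S -> (forall t, badj (T t) = S t) ->
  adjoint (fieldop T) (fieldop S).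
Proof.
move=> hT hS TS x y t; rewrite -[LHS]/(ip _ _) -[RHS]/(ip _ _) !fieldopE// -TS.
exact: ip_adj.
Qed.

Lemma hpathM_norm_leE (x : E) (c : R) : 0 <= c ->
  norm_le x c <-> forall t, hnorm (hpval x t) <= c.
Proof. exact: hp_norm_leE. Qed.

End Act.

(* norm-continuous families of compact operators *)
Definition fcompact T := forall e : R, 0 < e ->
  exists n (w : 'I_n -> I01 -> R[i]) (K : 'I_n -> bop H),
    [/\ forall i, continuous (w i : I01 -> R[i]^o), forall i t, normc (w i t) <= 1,
      forall i, compactOp (K i) & forall t, bnd (T t - \sum_(i < n) w i t *: K i) e].

Lemma hpvalB (Z : bool) (x y : hpathM H Z) t : hpval (x - y) t = hpval x t - hpval y t.
Proof. by []. Qed.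

Lemma hpval_sum (Z : bool) I (s : seq I) (F : I -> hpathM H Z) t :
  hpval (\sum_(i <- s) F i) t = \sum_(i <- s) hpval (F i) t.
Proof. by rewrite (big_morph (fun x : hpathM H Z => hpval x t) (id1 := 0) (op1 := +%R)). Qed.

(** Each w_i(t) K_i is approximated by rank one operators of the path module, built from the paths
    w_i(t) x and the constant paths y. Constant paths belong to the module only without the end
    condition, hence [false]. *)
Lemma compactOp_fcompact T (f : hpathM H false -> hpathM H false) :
  (forall x t, hpval (f x) t = T t (hpval x t)) -> fcompact T -> compactOp f.
Proof.
move=> hf hT e e0; have e2 : 0 < e / 2 by rewrite divr_gt0.
have [n [w [K [cw w1 cK hK]]]] := hT _ e2.
have d0 : 0 < e / 2 / (n%:R + 1) by rewrite divr_gt0// ltr_wpDl.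
have hs i : exists s : seq (H * H), forall z,
    hnorm (K i z - \sum_(p <- s) ip p.2 z *: p.1) <= e / 2 / (n%:R + 1) * hnorm z.
  by have /compactOpP := cK i; apply.
pose s i := sval (cid (hs i)); have hs' i := svalP (cid (hs i)).
pose X i (p : H * H) : hpathM H false := mkpath false (fun t => w i t *: p.1).
pose Y (p : H * H) : hpathM H false := mkpath false (fun=> p.2).
exists (flatten [seq [seq (X i p, Y p) | p <- s i] | i <- enum 'I_n]) => z c c0.
move=> /hpathM_norm_leE => /(_ c0) zc; apply/hpathM_norm_leE; first by rewrite mulr_ge0// ltW.
move=> t.
have -> : hpval (f z - \sum_(p <- flatten [seq [seq (X i p, Y p) | p <- s i] | i <- enum 'I_n])
     rank1 p.1 p.2 z) t =
   (T t - \sum_(i < n) w i t *: K i) (hpval z t) +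
   \sum_(i < n) w i t *: (K i (hpval z t) - \sum_(p <- s i) ip p.2 (hpval z t) *: p.1).
  rewrite hpvalB hf hpval_sum.
  rewrite big_flatten /= big_map big_enum /=.
  have -> : \sum_(i < n) w i t *: (K i (hpval z t) - \sum_(p <- s i) ip p.2 (hpval z t) *: p.1) =
     \sum_(i < n) w i t *: K i (hpval z t) -
     \sum_(i < n) w i t *: (\sum_(p <- s i) ip p.2 (hpval z t) *: p.1).
    by rewrite -sumrB; apply: eq_bigr => i _; rewrite scalerBr.
  rewrite bop_sumE subrKA; congr (_ - _); apply: eq_big => // i _.
  rewrite big_map scaler_sumr; apply: eq_bigr => p _ /=.
  rewrite /hp_act mkpathE//; last first.
    apply: hcont_scale; [exact: hp_cont | exact: hpath_cont].
  rewrite /X mkpathE//; last by apply: hcont_scale => //; exact: hcont_cst.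
  rewrite /hp_ip /Y mkpathE//; last exact: hcont_cst.
  by rewrite !scalerA mulrC.
apply: le_trans (hnormD _ _) _.
rewrite [e]splitr mulrDl; apply: lerD.
  by apply: le_trans (hK t _) _; rewrite ler_wpM2l// ltW.
apply: le_trans (hnorm_sum _ _) _.
apply: (@le_trans _ _ (\sum_(i < n) e / 2 / (n%:R + 1) * c)).
  apply: ler_sum => i _; rewrite hnormZ -[leRHS]mul1r.
  apply: ler_pM; rewrite ?normc_ge0 ?hnorm_ge0//.
  by apply: le_trans (hs' i _) _; rewrite ler_wpM2l// ltW.
rewrite sumr_const card_ord -[leLHS]mulr_natl mulrA ler_wpM2r//.
by rewrite mulrCA ler_piMr ?(ltW e2)// ler_pdivrMr ?ltr_wpDl// mul1r lerDl.
Qed.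

Lemma fcompact_cst (K : bop H) : compactOp K -> fcompact (fun=> K).
Proof.
move=> hK e e0; exists 1%N, (fun _ _ => 1), (fun=> K); split=> //.
- by move=> _; exact: cst_continuous.
- by move=> _ _; rewrite Normc.normc1.
- move=> t x; rewrite big_ord1 scale1r subrr hnorm0 mulr_ge0 ?hnorm_ge0//.
  exact: ltW.
Qed.

Lemma fcompactD T S : fcompact T -> fcompact S -> fcompact (fun t => T t + S t).
Proof.
move=> hT hS e e0; have e2 : 0 < e / 2 by rewrite divr_gt0.
have [n [w [K [cw w1 cK hK]]]] := hT _ e2.
have [m [v [L [cv v1 cL hL]]]] := hS _ e2.
exists (n + m)%N, (fun i => match fintype.split i with inl j => w j | inr j => v j end),
  (fun i => match fintype.split i with inl j => K j | inr j => L j end); split.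
- by move=> i; case: fintype.split.
- by move=> i t; case: fintype.split.
- by move=> i; case: fintype.split.
move=> t; rewrite big_split_ord /=.
under eq_bigr do rewrite (unsplitK (inl _)).
under [X in _ - (_ + X)]eq_bigr do rewrite (unsplitK (inr _)).
by rewrite opprD addrACA [e]splitr; exact: bndD.
Qed.

Lemma fcompactZ (v : I01 -> R[i]) T : continuous (v : I01 -> R[i]^o) ->
  (forall t, normc (v t) <= 1) -> fcompact T -> fcompact (fun t => v t *: T t).
Proof.
move=> cv v1 hT e e0; have [n [w [K [cw w1 cK hK]]]] := hT _ e0.
exists n, (fun i t => v t * w i t), K; split; [| |exact: cK|].
- exact: (fun i => continuousC_mul cv (cw i)).
- move=> i t; rewrite Normc.normcM -[1]mulr1; apply: ler_pM => //; exact: normc_ge0.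
move=> t x.
have -> : v t *: T t - \sum_(i < n) (v t * w i t) *: K i = v t *: (T t - \sum_(i < n) w i t *: K i).
  by rewrite scalerBr scaler_sumr; under [in RHS]eq_bigr do rewrite scalerA.
rewrite bZE hnormZ; apply: le_trans (hK t x).
by rewrite ler_piMl ?hnorm_ge0.
Qed.

(** [partition_approx] approximates [f] by weights times fixed elements, and a bounded linear [Phi]
    carries this to weights times compact operators. *)
Lemma fcompact_linear (A : cstarAlgType R) (Phi : A -> bop H) (C : R) (f : I01 -> A) :
  0 <= C -> (forall a b, Phi (a + b) = Phi a + Phi b) ->
  (forall (c : R[i]) a, Phi (c *: a) = c *: Phi a) ->
  (forall a, bnd (Phi a) (C * cnorm a)) -> (forall a, compactOp (Phi a)) ->
  ccontinuous f -> fcompact (fun t => Phi (f t)).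
Proof.
move=> C0 PD PZ Pb Pc cf e e0; have q0 : 0 < e / (C + 1) by rewrite divr_gt0// ltr_wpDl.
have [n [w [a [cw w1 ha]]]] := partition_approx cf q0.
exists n, w, (fun i => Phi (a i)); split=> // t.
have P0 : Phi 0 = 0 by apply: (addrI (Phi 0)); rewrite -PD !addr0.
have PN x : Phi (- x) = - Phi x by rewrite -scaleN1r PZ scaleN1r.
have -> : Phi (f t) - \sum_(i < n) w i t *: Phi (a i) = Phi (f t - \sum_(i < n) w i t *: a i).
  by rewrite PD PN (big_morph Phi PD P0); under [in RHS]eq_bigr do rewrite PZ.
apply: bnd_le (Pb _); apply: le_trans (ler_wpM2l C0 (ha t)) _.
by rewrite mulrCA ler_piMr ?(ltW e0)// ler_pdivrMr ?ltr_wpDl// mul1r lerDl.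
Qed.
End Fields.

(** * Kasparov modules over C([0,1]) from fields of operators *)

Section FieldModule.
Variables (R : realType) (H : hilbMod R pt) (B : starAlgType R) (Z : bool).
Local Open Scope complex_scope.
Local Notation I01 := (seg01 R).
Variables (r : B -> I01 -> bop H) (F : I01 -> bop H).

(** The compactness criterion needs constant paths; when paths must vanish at 1, the Kasparov
    conditions are asked to hold exactly. *)
Definition fvanish (T : I01 -> bop H) := (forall t, T t = 0) \/ (~~ Z /\ fcompact T).

Hypothesis rf : forall b, opfield (r b).
Hypothesis Ff : opfield F.
Hypothesis Faf : opfield (fun t => badj (F t)).
Hypothesis rL : forall (c : R[i]) a b t, r (c *: a + b) t = c *: r a t + r b t.
Hypothesis rM : forall a b t, r (a * b) t = r a t * r b t.
Hypothesis rS : forall a t, badj (r a t) = r (star a) t.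
Hypothesis Fsq : forall a, fvanish (fun t => r a t * (F t * F t - 1)).
Hypothesis Fcomm : forall a, fvanish (fun t => F t * r a t - r a t * F t).
Hypothesis Fsa : forall a, fvanish (fun t => r a t * (F t - badj (F t))).

Local Notation E := (hpathM H Z).

Lemma compactOp_fvanish (T : I01 -> bop H) (f : E -> E) :
  (forall x t, hpval (f x) t = T t (hpval x t)) -> fvanish T -> compactOp f.
Proof.
move=> hf [T0|[]].
  apply: compactOp_zero => x; apply: hpath_eq => t.
  by rewrite hf T0.
move: f hf; case: Z => // f hf _; exact: compactOp_fcompact.
Qed.

Definition fm_rep (a : B) : E -> E := fieldop (r a).
Definition fm_op : E -> E := fieldop F.
Definition fm_adj : E -> E := fieldop (fun t => badj (F t)).

Lemma fm_repL (c : R[i]) (a b : B) x :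
  fm_rep (c *: a + b) x = c *: fm_rep a x + fm_rep b x.
Proof.
apply: hpath_eq => t; rewrite -[RHS]/(c *: hpval (fm_rep a x) t + hpval (fm_rep b x) t).
by rewrite !fieldopE// rL.
Qed.
Lemma fm_repM (a b : B) x : fm_rep (a * b) x = fm_rep a (fm_rep b x).
Proof. by apply: hpath_eq => t; rewrite !fieldopE// rM. Qed.
Lemma fm_repS (a : B) : adjoint (fm_rep a) (fm_rep (star a)).
Proof. exact: fieldop_adjoint. Qed.
Lemma fm_opS : adjoint fm_op fm_adj.
Proof. exact: fieldop_adjoint. Qed.

Lemma fm_sq (a : B) : compactOp (fun x => fm_rep a (fm_op (fm_op x) - x)).
Proof.
apply: compactOp_fvanish (Fsq a) => x t.
by rewrite fieldopE// hpvalB !fieldopE.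
Qed.
Lemma fm_comm (a : B) : compactOp (fun x => fm_op (fm_rep a x) - fm_rep a (fm_op x)).
Proof. by apply: compactOp_fvanish (Fcomm a) => x t; rewrite hpvalB !fieldopE. Qed.
Lemma fm_sa (a : B) : compactOp (fun x => fm_rep a (fm_op x - fm_adj x)).
Proof.
by apply: compactOp_fvanish (Fsa a) => x t; rewrite fieldopE// hpvalB !fieldopE.
Qed.

Definition field_mod : kasMod B I01 :=
  KasMod fm_repL fm_repM fm_repS fm_opS fm_sq fm_comm fm_sa.

(** [g] is a parameter so as to cover both the identity and, at the end of a contraction, the map
    onto the zero module. *)
Lemma field_mod_fibre (t : I01) (N : kasMod B pt) (g : H -> N) (s : N -> E) :
  (forall y, g (hpval (s y) t) = y) ->
  (forall x y : E, ip (g (hpval x t)) (g (hpval y t)) = ip (hpval x t) (hpval y t)) ->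
  (forall b x, g (r b t x) = kas_rep b (g x)) ->
  (forall x, g (F t x) = kas_op (g x)) ->
  is_fibre t (M := field_mod) (N := N) (fun x : E => g (hpval x t)).
Proof.
move=> gs gi gr gF; split.
- by move=> y; exists (s y).
- by move=> x y; exact: gi.
- by move=> b x; rewrite -gr -[kas_rep b x]/(fieldop (r b) x) fieldopE.
- by move=> x; rewrite -gF -[kas_op x]/(fieldop F x) fieldopE.
Qed.
End FieldModule.

(** * K-homology of cones *)

Section ConeHomotopy.
Variables (R : realType) (A : cstarAlgType R).
Local Open Scope complex_scope.
Local Notation normc := Normc.normc.
Local Notation I01 := (seg01 R).

Lemma cnormZc (c : R[i]) (x : A) : cnorm (c *: x) = normc c * cnorm x.
Proof. by apply: complexI; rewrite cnormZ RcM; congr (_ * _); case: c. Qed.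

Lemma ccontinuous_bounded (f : I01 -> A) : ccontinuous f ->
  exists2 C : R, 0 <= C & forall t, cnorm (f t) <= C.
Proof.
move=> cf; have [n [w [a [_ w1 ha]]]] := partition_approx cf ltr01.
exists (1 + \sum_(i < n) cnorm (a i)).
  by rewrite addr_ge0// sumr_ge0// => i _; exact: cnorm_ge0.
move=> t; rewrite -[f t](subrK (\sum_(i < n) w i t *: a i)).
apply: (le_trans (cnormD _ _)); apply: lerD => //.
elim/big_rec2: _ => [|i x y _ h]; first by rewrite cnorm0.
apply: (le_trans (cnormD _ _)); apply: lerD => //.
by rewrite cnormZc ler_piMl ?cnorm_ge0.
Qed.

Lemma opfield_rho (M : kasMod A pt) (f : I01 -> A) : ccontinuous f ->
  opfield (fun t => rho M (f t)).
Proof.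
move=> cf; split.
  have [C C0 hC] := ccontinuous_bounded cf; exists C => // t.
  exact: bnd_le (hC t) (bnd_rho _).
move=> x t e e0; have q0 : 0 < e / (hnorm x + 1) by rewrite divr_gt0// ltr_wpDl ?hnorm_ge0.
have /seg_nearP [d d0 hd] := cf t _ q0; exists d => // s /hd h.
rewrite -[X in hnorm X]/((rho M (f s) - rho M (f t)) x) -rhoB.
apply: le_lt_trans (bnd_rho _ x) _.
apply: (@le_lt_trans _ _ (e / (hnorm x + 1) * hnorm x)).
  by rewrite ler_wpM2r ?hnorm_ge0// ltW.
by rewrite mulrAC ltr_pdivrMr ?ltr_wpDl ?hnorm_ge0// ltr_pM2l// ltrDl.
Qed.

Variables (T : ptopologicalType) (e x0 : T) (s : I01 -> T).
Hypothesis s0 : s (seg0 R) = x0.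
Hypothesis s1 : s (seg1 R) = e.
Hypothesis sc : forall f : T -> A, ccontinuous f -> ccontinuous (fun t => f (s t)).
Variable M : kasMod A pt.
Local Notation C := (cone A e).
Local Notation ev := (coneEval A e).

Lemma cone_ccontinuous (f : C) : ccontinuous (Defs.ssval f : T -> A).
Proof. by have := Defs.ssvalP f; rewrite inE => -[]. Qed.
Lemma cone_end (f : C) : exists c : R[i], ev e f = c *: 1.
Proof. by have := Defs.ssvalP f; rewrite inE => -[]. Qed.

Definition slide_rep (f : C) (t : I01) : bop M := rho M (ev (s t) f).

(** The operator is constant, and its defect in each Kasparov condition is linear, bounded and
    compact-valued in the element f(s t), so [fcompact_linear] applies along the slide. *)
Lemma cone_slide : homotopic1 (kas_pull (ev x0) M) (kas_pull (ev e) M).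
Proof.
have cfs (f : C) : ccontinuous (fun t => ev (s t) f) := sc (cone_ccontinuous f).
have rf f : opfield (slide_rep f) by exact: opfield_rho.
have Ff := opfield_cst (kasF M).
have Faf := opfield_cst (badj (kasF M)).
have rL (c : R[i]) a b t : slide_rep (c *: a + b) t = c *: slide_rep a t + slide_rep b t.
  by rewrite /slide_rep shomD shomZ rhoD rhoZ.
have rM a b t : slide_rep (a * b) t = slide_rep a t * slide_rep b t.
  by rewrite /slide_rep shomM rhoM.
have rS a t : badj (slide_rep a t) = slide_rep (star a) t.
  by rewrite /slide_rep shomS badj_rho.
have fl (K : bop M) (a : C) : (forall b, compactOp (rho M b * K)) ->
    fvanish false (fun t => slide_rep a t * K).
  move=> hK; right; split=> //; have [c c0 hc] := bop_bounded K.
  apply: (@fcompact_linear _ _ A (fun b => rho M b * K) c (fun t => ev (s t) a)) => //.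
  - by move=> b b'; rewrite rhoD mulrDl.
  - by move=> d b; rewrite rhoZ -bscaleAl.
  - by move=> b; rewrite mulrC; apply: bndM => //; [exact: cnorm_ge0 | exact: bnd_rho].
have sq a : fvanish false (fun t => slide_rep a t * (kasF M * kasF M - 1)).
  by apply: fl => b; rewrite mulrBr mulr1 mulrA; exact: rho_sq.
have sa a : fvanish false (fun t => slide_rep a t * (kasF M - badj (kasF M))).
  by apply: fl => b; rewrite mulrBr; exact: rho_sa.
have comm a : fvanish false (fun t => kasF M * slide_rep a t - slide_rep a t * kasF M).
  right; split=> //; have [c c0 hc] := bop_bounded (kasF M).
  apply: (@fcompact_linear _ _ A (fun b => kasF M * rho M b - rho M b * kasF M) (c + c)
    (fun t => ev (s t) a)) => //.
  - exact: addr_ge0.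
  - by move=> b b'; rewrite rhoD mulrDl mulrDr opprD addrACA.
  - by move=> d b; rewrite rhoZ -bscaleAl -bscaleAr scalerBr.
  - move=> b; rewrite mulrDl; apply: bndD; first by apply: bndM => //; exact: bnd_rho.
    by apply: bndN; rewrite mulrC; apply: bndM => //; [exact: cnorm_ge0 | exact: bnd_rho].
  - by move=> b; exact: rho_comm.
have fib (t : I01) (x : T) : s t = x ->
    exists q, is_fibre t (M := field_mod rf Ff Faf rL rM rS sq comm sa)
      (N := kas_pull (ev x) M) q.
  move=> <-; exists (fun z : hpathM M false => hpval z t).
  apply: (@field_mod_fibre _ _ _ _ _ _ rf Ff Faf rL rM rS sq comm sa t
    (kas_pull (ev (s t)) M) id (fun y => mkpath false (fun=> y))) => //.
  by move=> y; rewrite mkpathE//; exact: hcont_cst.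
exists (field_mod rf Ff Faf rL rM rS sq comm sa); split; exact: fib.
Qed.
End ConeHomotopy.

(** Isolates the powers of the weight [w], whose coefficients are fixed operators, as [fcompact]
    requires. *)
Lemma bop_quadratic (R : realType) (H : hilbMod R pt) (c w : R[i]%C) (P F D : bop H) :
  c *: P * ((F + w *: D) * (F + w *: D) - 1) = c *: (P * F * F - P) +
    w *: (c *: (P * F * D + P * D * F)) + w *: (w *: (c *: (P * D * D))).
Proof.
rewrite -bscaleAl.
have sc (x : bop H) : w *: (c *: x) = c *: (w *: x) by rewrite !scalerA mulrC.
rewrite !sc -!scalerDr; congr (_ *: _).
have -> : (F + w *: D) * (F + w *: D) = F * F + w *: (F * D) + (w *: (D * F) + w *: (w *: (D * D))).
  by rewrite mulrDl !mulrDr -!bscaleAl -!bscaleAr.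
rewrite mulrBr mulr1 !mulrDr -!bscaleAr !mulrA scalerDr !addrA.
rewrite [LHS]addrAC; congr (_ + _); rewrite [LHS]addrAC; congr (_ + _).
by rewrite [LHS]addrAC.
Qed.

(** * Modules on which the algebra acts by multiples of a projection *)

Section ScalarModule.
Variables (R : realType) (B : starAlgType R) (M : kasMod B pt).
Local Open Scope complex_scope.
Local Notation I01 := (seg01 R).
(* the algebra acts on M through a character *)
Hypothesis scal : forall b : B, exists c : R[i], rho M b = c *: rho M 1.
Variable U : bop M.
Hypothesis Us : badj U = U.
Hypothesis UU : U * U = 1.
Hypothesis UP : U * rho M 1 = rho M 1 * U.
Hypothesis PFU : ceq (rho M 1 * kasF M) (rho M 1 * U).

Lemma symm_comm b : U * rho M b = rho M b * U.
Proof. by have [c ->] := scal b; rewrite -bscaleAl -bscaleAr UP. Qed.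

Lemma symm_opS : adjoint U U.
Proof. by apply: ip_adjoint => x y; rewrite ip_adj Us. Qed.

Lemma rep0 b : kas_rep b (0 : M) = 0.
Proof. exact: (bop0 (rho M b)). Qed.

Lemma symm_sq b : compactOp (fun x => kas_rep b (U (U x) - x)).
Proof. by apply: compactOp_zero => x; rewrite -bME UU b1E subrr rep0. Qed.
Lemma symm_commc b : compactOp (fun x => U (kas_rep b x) - kas_rep b (U x)).
Proof.
apply: compactOp_zero => x; rewrite -[X in X - _]/((U * rho M b) x) symm_comm.
by rewrite bME subrr.
Qed.
Lemma symm_sa b : compactOp (fun x => kas_rep b (U x - U x)).
Proof. by apply: compactOp_zero => x; rewrite subrr rep0. Qed.

Definition symm_mod : kasMod B pt :=
  KasMod (@kas_repL _ _ _ M) (@kas_repM _ _ _ M) (@kas_repS _ _ _ M)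
    symm_opS symm_sq symm_commc symm_sa.

(** Written with the single weight -t, of modulus at most 1, on a fixed difference: the form that
    [opfieldZ] and [fcompactZ] accept. *)
Definition line (t : I01) : bop M := kasF M + (- val t)%:C *: (kasF M - U).

Let w (t : I01) : R[i] := (- val t)%:C.
Let cw : continuous (w : I01 -> R[i]^o).
Proof.
apply: continuous_RtoC; apply: seg_lipschitz_continuous => s t.
by rewrite -opprD normrN.
Qed.
Let w1 t : Normc.normc (w t) <= 1.
Proof.
rewrite normcR normrN; have := valP t; rewrite inE/= in_itv/= => /andP[t0 t1].
by rewrite ger0_norm.
Qed.

Lemma line0 : line (seg0 R) = kasF M.
Proof. by rewrite /line /= oppr0 scale0r addr0. Qed.
Lemma line1 : line (seg1 R) = U.
Proof. by rewrite /line /= rmorphN1 scaleN1r opprB addrC subrK. Qed.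

Let rrep (b : B) (t : I01) : bop M := rho M b.
Let rf b : opfield (rrep b). Proof. exact: opfield_cst. Qed.
Let rL (c : R[i]) a b t : rrep (c *: a + b) t = c *: rrep a t + rrep b t.
Proof. by rewrite /rrep rhoD rhoZ. Qed.
Let rM a b t : rrep (a * b) t = rrep a t * rrep b t.
Proof. by rewrite /rrep rhoM. Qed.
Let rS a t : badj (rrep a t) = rrep (star a) t.
Proof. exact: badj_rho. Qed.

Local Notation P := (rho M 1).
Local Notation F := (kasF M).
Local Notation D := (kasF M - U).

Let PD : compactOp (P * D). Proof. by rewrite mulrBr. Qed.
Let FP : ceq (F * P) (P * F). Proof. exact: rho_comm. Qed.
Let DP : ceq (D * P) (P * D).
Proof. by rewrite mulrBl mulrBr UP; apply: ceqB => //; exact: ceq_refl. Qed.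
Let PDs : compactOp (P * (badj F - U)).
Proof.
rewrite mulrBr; apply: (@ceq_trans _ _ (P * F)) => //.
by apply: ceq_sym; exact: rho_sa.
Qed.

Lemma badj_line t : badj (line t) = badj F + w t *: (badj F - U).
Proof. by rewrite badjD badjZ conjc_real badjD badjN Us. Qed.

Let Ff : opfield line.
Proof.
apply: opfieldD; first exact: opfield_cst.
by apply: opfieldZ => //; exact: opfield_cst.
Qed.
Let Faf : opfield (fun t => badj (line t)).
Proof.
rewrite (_ : (fun t => _) = (fun t => badj F + w t *: (badj F - U))); last first.
  by apply/funext => t; exact: badj_line.
apply: opfieldD; first exact: opfield_cst.
by apply: opfieldZ => //; exact: opfield_cst.
Qed.

Lemma fcompact_line (K0 K1 : bop M) : compactOp K0 -> compactOp K1 ->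
  fcompact (fun t => K0 + w t *: K1).
Proof.
by move=> h0 h1; apply: fcompactD; [|apply: fcompactZ => //]; exact: fcompact_cst.
Qed.

Lemma line_sq a : fvanish false (fun t => rrep a t * (line t * line t - 1)).
Proof.
right; split=> //; have [c hc] := scal a.
rewrite (_ : (fun t => _) = (fun t => (c *: (P * F * F - P) +
    w t *: (c *: (P * F * D + P * D * F))) + w t *: (w t *: (c *: (P * D * D))))); last first.
  by apply/funext => t; rewrite /rrep hc -bop_quadratic.
apply: fcompactD; last first.
  do 2![apply: fcompactZ => //]; apply: fcompact_cst; apply: cptZ; exact: cptMr.
apply: fcompact_line; apply: cptZ; first exact: rho_sq.
apply: cptD; last exact: cptMr.
(* Only P D is compact, not D = F - U; moving [P] past [F] costs a compact operator and brings it
   next to D. *)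
have -> : P * F * D = (P * F - F * P) * D + F * (P * D).
  by rewrite mulrBl mulrA subrK.
by apply: cptD; [apply: cptMr; exact: ceq_sym | exact: cptMl].
Qed.

Lemma line_comm a : fvanish false (fun t => line t * rrep a t - rrep a t * line t).
Proof.
right; split=> //; have [c hc] := scal a.
rewrite (_ : (fun t => _) = (fun t => c *: (F * P - P * F) + w t *: (c *: (D * P - P * D)))).
  by apply: fcompact_line; exact: cptZ.
apply/funext => t; rewrite /rrep hc /line -/(w t).
have -> : (F + w t *: D) * (c *: P) = c *: (F * P) + w t *: (c *: (D * P)).
  by rewrite -bscaleAr mulrDl scalerDr -bscaleAl !scalerA mulrC.
have -> : c *: P * (F + w t *: D) = c *: (P * F) + w t *: (c *: (P * D)).
  by rewrite -bscaleAl mulrDr scalerDr -bscaleAr !scalerA mulrC.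
by rewrite opprD addrACA !scalerBr.
Qed.

Lemma line_sa a : fvanish false (fun t => rrep a t * (line t - badj (line t))).
Proof.
right; split=> //; have [c hc] := scal a.
rewrite (_ : (fun t => _) = (fun t => c *: (P * F - P * badj F) +
    w t *: (c *: (P * D - P * (badj F - U))))).
  by apply: fcompact_line; apply: cptZ; [exact: rho_sa | exact: cptB].
apply/funext => t; rewrite /rrep hc badj_line /line -/(w t).
rewrite opprD addrACA -scalerBr -bscaleAl mulrDr scalerDr -!bscaleAr -!mulrBr.
by rewrite !scalerA mulrC.
Qed.

Lemma line_homotopic : homotopic1 M symm_mod.
Proof.
exists (field_mod rf Ff Faf rL rM rS line_sq line_comm line_sa); split.
  exists (fun z : hpathM M false => hpval z (seg0 R)).
  apply: (@field_mod_fibre _ _ _ _ _ _ rf Ff Faf rL rM rS line_sq line_comm line_sa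
    (seg0 R) M id (fun y => mkpath false (fun=> y))) => //.
    by move=> y; rewrite mkpathE//; exact: hcont_cst.
  by move=> x; rewrite line0.
exists (fun z : hpathM M false => hpval z (seg1 R)).
apply: (@field_mod_fibre _ _ _ _ _ _ rf Ff Faf rL rM rS line_sq line_comm line_sa
  (seg1 R) symm_mod id (fun y => mkpath false (fun=> y))) => //.
  by move=> y; rewrite mkpathE//; exact: hcont_cst.
by move=> x; rewrite line1.
Qed.

(* An operator with U = U^* , U^2 = 1 commuting with the action is degenerate:
   the module of paths in M ending at 0 contracts it. *)
Lemma symm_mod_null : homotopic1 symm_mod (kas_zero pt B).
Proof.
have Uf := opfield_cst U; have Uaf := opfield_cst (badj U).
(* The conditions hold exactly for the symmetry, which permits the module of paths vanishing at
   1. *)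
have sq a : fvanish true (fun t => rrep a t * (U * U - 1)).
  by left=> t; rewrite UU subrr mulr0.
have comm a : fvanish true (fun t => U * rrep a t - rrep a t * U).
  by left=> t; rewrite /rrep symm_comm subrr.
have sa a : fvanish true (fun t => rrep a t * (U - badj U)).
  by left=> t; rewrite Us subrr mulr0.
exists (field_mod rf Uf Uaf rL rM rS sq comm sa); split.
  exists (fun z : hpathM M true => hpval z (seg0 R)).
  (* As w(t) = -t, the section t |-> (1 + w t) y is (1 - t) y: it starts at y and vanishes at 1. *)
  apply: (@field_mod_fibre _ _ _ _ _ _ rf Uf Uaf rL rM rS sq comm sa
    (seg0 R) symm_mod id (fun y => mkpath true (fun t => (1 + w t) *: y))) => //.
  move=> y; rewrite mkpathE/=.
  - by rewrite /w /= oppr0 addr0 scale1r.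
  - apply: (@hcont_scale _ M (fun t => 1 + w t) (fun=> y)); last exact: hcont_cst.
    apply/continuousC_dist => t e e0.
    have /continuousC_dist /(_ t e e0) [d d0 hd] := cw; exists d => // s /hd.
    by rewrite opprD addrACA subrr add0r.
  - by move=> _; rewrite /w /= rmorphN1 subrr scale0r.
exists (fun z : hpathM M true => 0).
apply: (@field_mod_fibre _ _ _ _ _ _ rf Uf Uaf rL rM rS sq comm sa
  (seg1 R) (kas_zero pt B) (fun=> 0) (fun=> 0)).
- by move=> y; exact: rV0_eq.
- by move=> x y; rewrite (hpath_end x)// !ip0l.
- by move=> b x; exact: rV0_eq.
- by move=> x; exact: rV0_eq.
Qed.
End ScalarModule.

(** * Vanishing of pullbacks to a cone *)

Section KH1Vanishing.
Variables (R : realType).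
Local Open Scope complex_scope.

(** [KH1] is a quotient by the generated equivalence, so the slide, the segment to the symmetry and
    the contraction are chained without being concatenated into one homotopy. *)
Lemma KH1pull_cone (A : cstarAlgType R) (T : ptopologicalType) (e x0 : T) (s : seg01 R -> T)
  (z : KH1 A) : s (seg0 R) = x0 -> s (seg1 R) = e ->
  (forall f : T -> A, ccontinuous f -> ccontinuous (fun t => f (s t))) ->
  KH1pull (coneEval A e x0) z = KH1zero.
Proof.
move=> s0 s1 sc; apply/cls_eq; set M := qrepr z.
have h1 := cone_slide s0 s1 sc M.
set N := kas_pull (coneEval A e e) M in h1.
have scal (f : cone A e) : exists c : R[i], rho N f = c *: rho N 1.
  have [c hc] := cone_end f; exists c; apply: bop_eq => x.
  rewrite bZE -[LHS]/(rho M (coneEval A e e f) x) -[rho N 1 x]/(rho M (coneEval A e e 1) x).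
  by rewrite hc rhoZ shom1.
have [U [Us UU UP PFU]] := kas_symmetry N.
apply: (rst_trans _ _ _ N); first exact: rst_step.
apply: (rst_trans _ _ _ (symm_mod scal Us UU UP)).
  by apply: rst_step; exact: line_homotopic.
by apply: rst_step; exact: symm_mod_null.
Qed.

Lemma homotopic1_opp (A : starAlgType R) (M N : kasMod A pt) :
  homotopic1 M N -> homotopic1 (kas_opp M) (kas_opp N).
Proof.
have fib (H : kasMod A (seg01 R)) t (L : kasMod A pt) q :
    is_fibre t (M := H) (N := L) q -> is_fibre t (M := kas_opp H) (N := kas_opp L) q.
  move=> [sq iq rq oq]; split=> // x; rewrite /= /kopp_op -oq.
  apply: hm_ip_inj => z []; have [y <-] := sq z.
  by rewrite hm_ipN !iq hm_ipN.
move=> [H [[q hq] [q' hq']]]; exists (kas_opp H); split; [exists q | exists q']; exact: fib.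
Qed.

(** [KH1opp] acts on a representative of the zero class that may differ from the zero module, so the
    chain of homotopies between them is negated step by step. *)
Lemma KH1opp0 (A : starAlgType R) : KH1opp (KH1zero : KH1 A) = KH1zero.
Proof.
apply/cls_eq; apply: (rst_trans _ _ _ (kas_opp (kas_zero pt A))).
  have := cls_qrepr (@homotopic1 R A) (kas_zero pt A).
  rewrite -/(KH1zero : KH1 A) => h; apply: rst_sym.
  elim: h => [x y /homotopic1_opp h|x|x y _|x y z _ h1 _ h2].
  - exact: rst_step.
  - exact: rst_refl.
  - exact: rst_sym.
  - exact: rst_trans h1 h2.
apply: rst_step; exists (kas_zero (seg01 R) A).
have fib t (N : kasMod A pt) (N0 : forall x y : N, x = y) :
    exists q, is_fibre t (M := kas_zero (seg01 R) A) (N := N) q.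
  exists (fun=> 0); split.
  - by move=> y; exists 0; exact: N0.
  - by move=> x y; rewrite hm_ip0.
  - by move=> a x; exact: N0.
  - by move=> x; exact: N0.
by split; apply: fib => x y; exact: rV0_eq.
Qed.
End KH1Vanishing.

(** * The slides of the two cones and the theorem *)

Section Cones.
Variables (R : realType) (A : cstarAlgType R).

Lemma slideL_subproof (t : seg01 R) : 0 <= (1 - val t) / 2 <= (2^-1 : R).
Proof. by have := valP t; rewrite inE/= in_itv/= => /andP[? ?]; lra. Qed.
Lemma slideR_subproof (t : seg01 R) : (2^-1 : R) <= (1 + val t) / 2 <= 1.
Proof. by have := valP t; rewrite inE/= in_itv/= => /andP[? ?]; lra. Qed.
(** Both slides start at 1/2, where [piL] and [piR] evaluate, and end at the point where the
    functions of the cone are scalar. *)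
Definition slideL (t : seg01 R) : segL R := segpt (slideL_subproof t).
Definition slideR (t : seg01 R) : segR R := segpt (slideR_subproof t).

Lemma ccontinuous_slide (a b : R) (s : seg01 R -> seg a b) (f : seg a b -> A) :
  (forall t t', `|val (s t) - val (s t')| <= `|val t - val t'|) ->
  ccontinuous f -> ccontinuous (fun t => f (s t)).
Proof.
move=> hs cf t e e0; have /seg_nearP [d d0 hd] := cf (s t) e e0.
by apply/seg_nearP; exists d => // t' ht; apply: hd; exact: le_lt_trans ht.
Qed.

Lemma KH1pull_piL (z : KH1 A) : KH1pull (piL A) z = KH1zero.
Proof.
apply: (KH1pull_cone (s := slideL)).
- by apply: val_inj; rewrite /= subr0 mul1r.
- by apply: val_inj; rewrite /= subrr mul0r.
move=> f; apply: (@ccontinuous_slide 0 2^-1 slideL) => t t' /=.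
have -> : (1 - val t) / 2 - (1 - val t') / 2 = (val t' - val t) / 2 by field.
by rewrite normrM distrC ler_piMr// ger0_norm; lra.
Qed.

Lemma KH1pull_piR (z : KH1 A) : KH1pull (piR A) z = KH1zero.
Proof.
apply: (KH1pull_cone (s := slideR)).
- by apply: val_inj; rewrite /= addr0 mul1r.
- by apply: val_inj; rewrite /=; field.
move=> f; apply: (@ccontinuous_slide 2^-1 1 slideR) => t t' /=.
have -> : (1 + val t) / 2 - (1 + val t') / 2 = (val t - val t') / 2 by field.
by rewrite normrM ler_piMr// ger0_norm; lra.
Qed.
End Cones.

Theorem mainTheorem2 (R : realType) (A : cstarAlgType R)
    (N : nat) (u : 'M[A]_N) (hu : mx_unitary u)
    (hK0 : iso_int (@K0add A) (K0cls (idem1 1 : idem A)))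
    (hK1 : iso_int (@K1add R A) (K1cls (unitary_gl hu)))
    (delta01 : KH0 (susp A) -> KH1 A)
    (hdelta : is_boundary01 delta01)
    (hcompat : compatible10 delta01) :
  forall z : KH1 A,
    (exists w : KH0 (susp A), delta01 w = z) /\
    forall w : KH0 (susp A), delta01 w = z ->
      forall n : int,
        pairing0 (bd10 (K1cls (gl_pow (unitary_gl hu) n))) w =
          pairing1 (K1cls (gl_pow (unitary_gl hu) n)) z /\
        pairing1 (K1cls (gl_pow (unitary_gl hu) n)) z =
          n * pairing1 (K1cls (unitary_gl hu)) z.
Proof.
move=> z; split.
  have [_ _ exact_at] := hdelta; apply/exact_at.
  by rewrite KH1pull_piL KH1pull_piR KH1opp0.
move=> w <- n; split; first exact: hcompat.
exact: pairing1_pow.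
Qed.
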